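(* Let $d=2$, $1\le p<\infty$, $a>1-1/p$ and $b\in\mathbb R$. Then $$\varepsilon_k(\mathbf W^{a,b}_1,L_p)\asymp \varepsilon_k(\bar{\mathbf W}^{a,b}_1,L_p)\asymp k^{-a}(\log k)^{a+b},\qquad k\ge 2.$$
   Context: Functions are complex-valued and $2\pi$-periodic in each of $d$ variables; $L_p=L_p(\mathbb T^d)$ with respect to the normalized measure $(2\pi)^{-d}d\mathbf x$; $\hat f(\mathbf k)=(2\pi)^{-d}\int_{\mathbb T^d}f(\mathbf x)e^{-i(\mathbf k,\mathbf x)}d\mathbf x$. For $\mathbf s\in\mathbb Z_+^d$ (nonnegative integer coordinates) let $\rho(\mathbf s)=\{\mathbf k\in\mathbb Z^d:[2^{s_j-1}]\le|k_j|<2^{s_j},\ j=1,\dots,d\}$, where $[\cdot]$ is the integer part. Put $\|\mathbf s\|_1=s_1+\dots+s_d$, $Q_n=\bigcup_{\|\mathbf s\|_1\le n}\rho(\mathbf s)$, and let $\mathcal T(Q_n)$ be the space of trigonometric polynomials with frequencies in $Q_n$. For $f\in L_1$ let $\delta_{\mathbf s}(f)=\sum_{\mathbf k\in\rho(\mathbf s)}\hat f(\mathbf k)e^{i(\mathbf k,\mathbf x)}$ and $f_l=\sum_{\|\mathbf s\|_1=l}\delta_{\mathbf s}(f)$, $l=0,1,2,\dots$. Classes: $\mathbf W^{a,b}_q=\{f\in L_1:\|f_l\|_q\le 2^{-al}(\bar l)^{(d-1)b}\text{ for all } l\ge0\}$, $\bar l=\max(l,1)$; and $\bar{\mathbf W}^{a,b}_q$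 is the set of functions $f=\sum_{n=1}^\infty t_n$ (convergence in $L_q$) with $t_n\in\mathcal T(Q_n)$, $\|t_n\|_q\le2^{-an}n^{b(d-1)}$. Entropy numbers: for a subset $A$ of a Banach space $X$, $\varepsilon_k(A,X)=\inf\{\varepsilon:\exists y^1,\dots,y^{2^k}\in X,\ A\subseteq\bigcup_{j=1}^{2^k}B_X(y^j,\varepsilon)\}$, where $B_X(y,r)=\{x\in X:\|x-y\|\le r\}$. $A_k\ll B_k$ means $A_k\le CB_k$ for all $k$ with $C$ independent of $k$ (it may depend on the other parameters); $A_k\asymp B_k$ means $A_k\ll B_k$ and $B_k\ll A_k$. *)

(* Defs.v *)
From mathcomp Require Import all_boot all_order all_algebra.
From mathcomp Require Import all_classical all_reals all_analysis.
From mathcomp Require Import complex.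

Set Implicit Arguments.
Unset Strict Implicit.
Unset Printing Implicit Defensive.

Import Order.TTheory GRing.Theory Num.Theory.
Import numFieldNormedType.Exports.

Local Open Scope classical_set_scope.
Local Open Scope ring_scope.
Local Open Scope complex_scope.

(* The dimension is d = 2 throughout.  Functions on the torus are functions on
   the plane that are 2pi-periodic in each variable; they are not quotiented by
   a.e. equality, so that L_p is a seminormed space here.  Its closed balls are
   the preimages of those of the Banach space L_p, which leaves the entropy
   numbers unchanged. *)

Section Torus.
Variable R : realType.
Local Notation plane := (measurableTypeR R * measurableTypeR R)%type.
Local Notation func := (plane -> R[i]).

Definition period_square : set plane := `[0, 2 * pi] `*` `[0, 2 * pi].

Lemma measurable_period_square : measurable period_square.
Proof. by apply: measurableX; exact: measurable_itv. Qed.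

Lemma inv_area_ge0 : 0 <= (2 * pi : R) ^- 2.
Proof. by rewrite invr_ge0 sqr_ge0. Qed.

(* Normalized Lebesgue measure on one period, as a measure on the plane. *)
Definition torus_measure : {measure set plane -> \bar R} :=
  mscale (NngNum inv_area_ge0)
    (mrestr (lebesgue_measure \x lebesgue_measure)%E measurable_period_square).

Definition periodic2 (f : func) : Prop :=
  forall x y : R, f (x + 2 * pi, y) = f (x, y) /\ f (x, y + 2 * pi) = f (x, y).

Definition cmeasurable (f : func) : Prop :=
  measurable_fun setT (fun x => complex.Re (f x)) /\
  measurable_fun setT (fun x => complex.Im (f x)).

Definition normL (p : \bar R) (f : func) : \bar R :=
  Lnorm torus_measure p (fun x => (ComplexField.Normc.normc (f x))%:E).

Definition L (p : \bar R) : set func :=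
  [set f | [/\ periodic2 f, cmeasurable f & (normL p f < +oo)%E]].

Definition cintegral (f : func) : R[i] :=
  Rintegral torus_measure setT (fun x => complex.Re (f x)) +i*
  Rintegral torus_measure setT (fun x => complex.Im (f x)).

Definition expi (t : R) : R[i] := cos t +i* sin t.

Definition dot (k : int * int) (x : plane) : R :=
  k.1%:~R * x.1 + k.2%:~R * x.2.

Definition fourier (f : func) (k : int * int) : R[i] :=
  cintegral (fun x => f x * expi (- dot k x)).

(* The natural number 2 ^ s %/ 2 is the integer part of 2^(s-1), also at
   s = 0, where it is 0. *)
Definition in_dyadic (s : nat) (k : int) : Prop :=
  (2 ^ s %/ 2 <= `|k| < 2 ^ s)%N.

Definition rho (s : nat * nat) : set (int * int) :=
  [set k | in_dyadic s.1 k.1 /\ in_dyadic s.2 k.2].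

Definition Q (n : nat) : set (int * int) :=
  \bigcup_(s in [set s : nat * nat | (s.1 + s.2 <= n)%N]) rho s.

Definition trig_poly (K : set (int * int)) : set func :=
  [set f | exists c : int * int -> R[i],
     f = fun x => \sum_(k \in K) c k * expi (dot k x)].

Definition delta (s : nat * nat) (f : func) : func :=
  fun x => \sum_(k \in rho s) fourier f k * expi (dot k x).

Definition layer (l : nat) (f : func) : func :=
  fun x => \sum_(s \in [set s : nat * nat | (s.1 + s.2)%N = l]) delta s f x.

(* In the next two definitions the exponent (d-1)b is b, since d = 2. *)
Definition W (a b : R) (q : \bar R) : set func :=
  [set f | L 1%E f /\ forall l : nat,
     (normL q (layer l f)
        <= (2 `^ (- (a * l%:R)) * (maxn l 1)%:R `^ b)%:E)%E].

Definition Wbar (a b : R) (q : \bar R) : set func :=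
  [set f | L q f /\ exists t : nat -> func,
     (forall n : nat, (1 <= n)%N ->
        trig_poly (Q n) (t n) /\
        (normL q (t n) <= (2 `^ (- (a * n%:R)) * n%:R `^ b)%:E)%E) /\
     normL q (fun x => f x - \sum_(1 <= n < N.+1) t n x) @[N --> \oo] --> 0%E].

End Torus.

Section Entropy.
Variables (R : realType) (T : zmodType).

(* The space is the subset X of T with the seminorm N.  The value is +oo when
   no radius is admissible. *)
Definition entropy_number (X : set T) (N : T -> \bar R) (A : set T) (k : nat) :
    \bar R :=
  ereal_inf [set eps%:E | eps in [set eps : R |
    exists y : 'I_(2 ^ k) -> T, (forall j, X (y j)) /\
      A `<=` \bigcup_j [set x | X x /\ (N (x - y j)%R <= eps%:E)%E]]].

End Entropy.

Definition entropyL (R : realType) (p : \bar R)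
    (A : set (measurableTypeR R * measurableTypeR R -> R[i])) (k : nat) :
    \bar R :=
  entropy_number (@L R p) (@normL R p) A k.

(* Domination and order equivalence of sequences indexed by k >= 2. *)
Definition dominated (R : realType) (A B : nat -> \bar R) : Prop :=
  exists C : R, 0 < C /\ forall k : nat, (2 <= k)%N -> (A k <= C%:E * B k)%E.

Definition order_equiv (R : realType) (A B : nat -> \bar R) : Prop :=
  dominated A B /\ dominated B A.

(* Main.v *)
(* Upper bound: a block t in T(Q_n) is recovered from samples of its dyadic pieces taken with
   de la Vallee Poussin kernels.  Splitting the indices s with |s|_1 = l into lacunary classes, a
   Riesz product whose higher-order terms have frequencies outside Q_n bounds the l_1 norm of the
   samples by sqrt(n) |t|_1 instead of the trivial n |t|_1; conversely, moments of lacunary sums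
   show that samples of size w / sqrt(n) synthesize a function of L_2r norm O(w).  Quantizing the
   samples thus codes the L_1 ball of T(Q_n) up to an L_p error w with O(n 2^n w^(-g)) bits for
   any g < 1, while for large w interpolation with L_1 gives the error w^((1 + eta) (1 - 1/p)).
   Choosing w geometrically in |n - m|, where k ~ m 2^m, gives the total error 2^(-a m) m^b.

   Lower bound: L_p norms dominate the L_1 norm, and a covering of the unit L_1 ball of the
   polynomials on one hyperbolic layer by 2^k balls of radius 1/4 can be iterated; counting
   polynomials with coefficients on a fine grid shows that k is at least the dimension (n + 1) 2^n.

   A function of W is the L_1 limit of its hyperbolic partial sums: the remainder pairs with
   every fixed trigonometric polynomial as a tail of the layers, and trigonometric polynomials
   with values in [0, 1] approximate every indicator in weighted L_1. *)

Require Import Defs.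
From mathcomp Require Import all_boot all_order all_algebra.
From mathcomp Require Import all_classical all_reals all_analysis measurable_realfun.
From mathcomp Require Import complex ring lra zify.

Set Implicit Arguments.
Unset Strict Implicit.
Unset Printing Implicit Defensive.

Import Order.TTheory GRing.Theory Num.Theory.
Import numFieldNormedType.Exports.

Local Open Scope classical_set_scope.
Local Open Scope ring_scope.

(** * The normalized measure of the torus *)

Section TorusIntegral.
Variable R : realType.
Local Notation plane := (measurableTypeR R * measurableTypeR R)%type.
Local Notation mu := (@torus_measure R).
Local Notation leb := (@lebesgue_measure R).

(** The two square roots of n cancel. The normalized samples have l_1 norm O(sqrt n), and the
    admissible quantization step on the top layer is of order 2^(-n) w / sqrt n; so about n 2^n / w
    steps are spread over about n 2^n coordinates, and counting integer vectors gives the dimension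
    times a function of w alone, with no logarithm lost. The Riesz product has to leave the cross
    Q_n even when it is built on a layer l < n. This forces gaps n - l + O(1) between the indices of
    a class, and the bound is multiplied by that gap. Steps finer by (3/4)^(n-l) on layer l make the
    errors of the layers summable, and the smaller number of frequencies there affords them. Above
    the critical level m the dimension grows like 2^(n-m), so w must grow like 2^((1+eta)(n-m)). An
    error proportional to w would then require a > 1; the interpolation with L_1 lowers the
    threshold to 1 - 1/p, and high moments make the loss eta as small as desired. *)

Lemma twopi_gt0 : 0 < 2 * pi :> R.
Proof. by rewrite mulr_gt0 // pi_gt0. Qed.

Lemma ge0_integral_torus (f : plane -> \bar R) :
  measurable_fun [set: plane] f -> (forall x, (0 <= f x)%E) ->
  (\int[mu]_x f x = ((2 * pi) ^- 2)%:E *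
    \int[leb]_(x in `[0%R, (2 * pi)%R]) \int[leb]_(y in `[0%R, (2 * pi)%R]) f (x, y))%E.
Proof.
move=> mf f0.
rewrite /torus_measure ge0_integral_mscale//=; congr (_ * _)%E.
set sq := @period_square R.
have msq : measurable sq by exact: measurable_period_square.
rewrite -(setUv sq) ge0_integral_setU //=; last 3 first.
- exact: measurableC.
- by rewrite setUv.
- exact/disj_setPCl.
rewrite (eq_measure_integral (leb \x leb)%E) /=; last first.
  by move=> A mA AD; rewrite /mrestr setIidl.
rewrite [X in (_ + X)%E](_ : _ = 0%E) ?adde0; last first.
  rewrite (eq_measure_integral mzero) ?integral_measure_zero //=.
  move=> A mA AD; rewrite /mrestr /mzero (_ : A `&` _ = set0) ?measure0//.
  by apply/disjoints_subset.
rewrite integral_mkcond fubini_tonelli1; last 2 first.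
- apply/(measurable_restrictT _ msq). exact: (measurable_funTS mf).
- by move=> x; rewrite erestrict_ge0.
rewrite [RHS]integral_mkcond; apply: eq_integral => x _; rewrite /fubini_F !patchE.
case: ifPn => [x1|x1].
  rewrite [RHS]integral_mkcond; apply: eq_integral => y _; rewrite !patchE.
  congr (if _ then _ else _).
  by apply/idP/idP; rewrite !inE /sq /period_square /=; [case | split => //; rewrite inE in x1].
rewrite integral0_eq // => y _; rewrite patchE ifN //.
by apply: contra x1; rewrite !inE => -[].
Qed.

(** The summand 1 keeps the integrand nonnegative, as [ge0_integral_torus] requires. *)
Lemma integral_period_cos (k : int) (c : R) : k != 0 ->
  (\int[leb]_(y in `[0%R, (2 * pi)%R]) (1 + cos (k%:~R * y + c))%:E = (2 * pi)%:E)%E.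
Proof.
move=> k0; have kr : k%:~R != 0 :> R by rewrite intr_eq0.
pose F := fun y : R => y + (k%:~R)^-1 * sin (k%:~R * y + c).
have dF (y : R) : is_derive y 1 F (1 + cos (k%:~R * y + c)).
  rewrite /F; apply: is_derive_eq.
  by rewrite /GRing.scale /=; field.
have cF : continuous F.
  by move=> y; apply/differentiable_continuous/derivable1_diffP; case: (dF y).
have per : sin (k%:~R * (2 * pi) + c) = sin c.
  have P := @sinD2pi R.
  have Pn (n : nat) (a : R) : sin (a + n%:R * (2 * pi)) = sin a.
    by rewrite -(periodicn P n a); congr sin; rewrite -mulr_natr -(mulr_natr pi 2); ring.
  case: k {kr k0 F dF cF} => n; rewrite ?NegzE.
    by rewrite addrC; exact: Pn.
  rewrite -(Pn n.+1); congr sin; rewrite mulrNz -pmulrn. by rewrite mulNr addrAC addNr add0r.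
rewrite (@continuous_FTC2 _ _ F) //.
- rewrite /F per mulr0 !add0r -EFinB. by rewrite addrK.
- exact: twopi_gt0.
- apply: continuous_subspaceT => y; apply/differentiable_continuous/derivable1_diffP.
  have : is_derive y 1 (fun y => 1 + cos (k%:~R * y + c)) (- sin (k%:~R * y + c) * k%:~R).
    by apply: is_derive_eq; rewrite /GRing.scale /=; ring.
  by case.
- split; first by move=> x _; case: (dF x).
  + by apply: cvg_at_right_filter; exact: cF.
  + by apply: cvg_at_left_filter; exact: cF.
- by move=> x _; rewrite derive1E; apply: derive_val.
Qed.


Lemma integral_period_cst (c : R) : 0 <= c ->
  (\int[leb]_(y in `[0%R, (2 * pi)%R]) c%:E = (c * (2 * pi))%:E)%E.
Proof.
move=> c0; rewrite integral_cst //= lebesgue_measure_itv /= lte_fin twopi_gt0.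
by rewrite sube0 EFinM.
Qed.

Lemma torus_measureT : mu setT = 1%E.
Proof.
rewrite -[LHS]mul1e -integral_cst // ge0_integral_torus //=.
under eq_integral do rewrite integral_period_cst //.
rewrite integral_period_cst ?mul1r ?(ltW twopi_gt0) // -EFinM; congr EFin.
by rewrite -expr2 mulVf // sqrf_eq0 gt_eqF // twopi_gt0.
Qed.

Lemma mu_lty : (mu setT < +oo)%E.
Proof. by rewrite torus_measureT ltry. Qed.

Definition mean (f : plane -> R) : R := \int[mu]_x f x.

(** On a probability space bounded measurable functions are integrable and stable under sums and
    products, so [mean] can be manipulated on them without integrability conditions. *)
Definition nice (f : plane -> R) : Prop :=
  measurable_fun setT f /\ exists C : R, forall x, `|f x| <= C.

Lemma nice_integrable f : nice f -> mu.-integrable setT (EFin \o f).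
Proof.
move=> [mf [C fC]]; apply: measurable_bounded_integrable => //.
  exact: mu_lty.
by exists C; split; [exact: num_real|move=> D CD x _; exact: (le_trans (fC x) (ltW CD))].
Qed.

Lemma nice_cst c : nice (fun=> c).
Proof. by split; [exact: measurable_cst|exists `|c|]. Qed.

Lemma niceD f g : nice f -> nice g -> nice (fun x => f x + g x).
Proof.
move=> [mf [C fC]] [mg [D gD]]; split; first exact: measurable_funD.
by exists (C + D) => x; apply: le_trans (ler_normD _ _) _; exact: lerD.
Qed.

Lemma niceM f g : nice f -> nice g -> nice (fun x => f x * g x).
Proof.
move=> [mf [C fC]] [mg [D gD]]; split; first exact: measurable_funM.
by exists (C * D) => x; rewrite normrM ler_pM.
Qed.

Lemma niceZ c f : nice f -> nice (fun x => c * f x).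
Proof. by apply: niceM; exact: nice_cst. Qed.

Lemma niceN f : nice f -> nice (fun x => - f x).
Proof.
move=> [mf [C fC]]; split; first exact: measurableT_comp.
by exists C => x; rewrite normrN.
Qed.

Lemma niceB f g : nice f -> nice g -> nice (fun x => f x - g x).
Proof. by move=> nf ng; apply: niceD => //; apply: niceN. Qed.

Lemma nice_norm f : nice f -> nice (fun x => `|f x|).
Proof.
move=> [mf [C fC]]; split; first exact: measurableT_comp.
by exists C => x; rewrite normr_id.
Qed.

Lemma niceX n f : nice f -> nice (fun x => f x ^+ n).
Proof.
move=> [mf [C fC]]; split; first exact: measurable_funX.
by exists (C ^+ n) => x; rewrite normrX lerXn2r // nnegrE // (le_trans _ (fC x)).
Qed.

Lemma nice_sum (I : Type) (s : seq I) (P : pred I) (F : I -> plane -> R) :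
  (forall i, P i -> nice (F i)) -> nice (fun x => \sum_(i <- s | P i) F i x).
Proof.
move=> nF; elim: s => [|i s ih].
  have -> : (fun x => \sum_(i <- [::] | P i) F i x) = fun=> 0; last exact: nice_cst.
  by apply/funext => x; rewrite big_nil.
have -> : (fun x => \sum_(j <- i :: s | P j) F j x) = fun x =>
    if P i then F i x + \sum_(i <- s | P i) F i x else \sum_(i <- s | P i) F i x.
  by apply/funext => x; rewrite big_cons.
by case: (boolP (P i)) => // Pi; apply: niceD => //; exact: nF.
Qed.

Lemma meanD f g : nice f -> nice g -> mean (fun x => f x + g x) = mean f + mean g.
Proof. by move=> nf ng; rewrite /mean RintegralD //; exact: nice_integrable. Qed.

Lemma meanZ c f : nice f -> mean (fun x => c * f x) = c * mean f.
Proof. by move=> nf; rewrite /mean RintegralZl //; exact: nice_integrable. Qed.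

Lemma meanN f : nice f -> mean (fun x => - f x) = - mean f.
Proof.
move=> nf; rewrite -[RHS]mulN1r -meanZ //; congr mean.
by apply/funext => x; rewrite mulN1r.
Qed.

Lemma meanB f g : nice f -> nice g -> mean (fun x => f x - g x) = mean f - mean g.
Proof. by move=> nf ng; rewrite meanD ?meanN //; exact: niceN. Qed.

Lemma mean_cst c : mean (fun=> c) = c.
Proof. by rewrite /mean Rintegral_cst //= torus_measureT /= mulr1. Qed.

Lemma le_mean f g : nice f -> nice g -> (forall x, f x <= g x) -> mean f <= mean g.
Proof. by move=> nf ng fg; apply: le_Rintegral => //; exact: nice_integrable. Qed.

Lemma mean_ge0 f : (forall x, 0 <= f x) -> 0 <= mean f.
Proof. by move=> f0; apply: Rintegral_ge0. Qed.

Lemma norm_mean f : nice f -> `|mean f| <= mean (fun x => `|f x|).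
Proof. by move=> nf; apply: le_normr_Rintegral => //; exact: nice_integrable. Qed.

Lemma mean_sum (I : Type) (s : seq I) (P : pred I) (F : I -> plane -> R) :
  (forall i, P i -> nice (F i)) ->
  mean (fun x => \sum_(i <- s | P i) F i x) = \sum_(i <- s | P i) mean (F i).
Proof.
move=> nF; elim: s => [|i s ih].
  rewrite big_nil -[RHS](mean_cst 0); congr mean.
  by apply/funext => x; rewrite big_nil.
have -> : (fun x => \sum_(j <- i :: s | P j) F j x) = fun x =>
    if P i then F i x + \sum_(i <- s | P i) F i x else \sum_(i <- s | P i) F i x.
  by apply/funext => x; rewrite big_cons.
by rewrite big_cons; case: (boolP (P i)) => // Pi; rewrite meanD ?ih //; [exact: nF|exact: nice_sum].
Qed.

Definition wave (k : int * int) (c : R) : plane -> R := fun x => cos (dot k x + c).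

Lemma measurable_dot k : measurable_fun setT (dot k : plane -> R).
Proof.
apply: measurable_funD; apply: measurable_funM; first exact: measurable_cst.
- exact: measurable_fst.
- exact: measurable_cst.
- exact: measurable_snd.
Qed.

Lemma nice_wave k c : nice (wave k c).
Proof.
split; last by exists 1 => x; exact: cos_max.
apply: measurableT_comp; first by apply: continuous_measurable_fun; exact: continuous_cos.
by apply: measurable_funD; [exact: measurable_dot|exact: measurable_cst].
Qed.

Lemma mean_wave k c : mean (wave k c) = if k == 0 then cos c else 0.
Proof.
case: ifPn => [/eqP->|k0].
  rewrite -(mean_cst (cos c)); congr mean; apply/funext => x.
  by rewrite /wave /dot /= !mul0r !add0r.
have nw := nice_wave k c.
suff : mean (fun x => 1 + wave k c x) = 1.
  by rewrite meanD ?mean_cst //; [lra|exact: nice_cst].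
have n1 := niceD (nice_cst 1) nw.
rewrite /mean /Rintegral ge0_integral_torus; last 2 first.
- by apply/measurable_EFinP; case: n1.
- by move=> x; rewrite lee_fin; have := cos_geN1 (dot k x + c); rewrite /wave; lra.
have tp := ltW twopi_gt0.
have E k2 (d : R) : k2 != 0 ->
    (\int[leb]_(y in `[0%R, (2 * pi)%R]) (1 + cos (k2%:~R * y + d))%:E = (2 * pi)%:E)%E.
  exact: integral_period_cos.
have fin : fine (((2 * pi : R) ^- 2)%:E * ((2 * pi) * (2 * pi))%:E)%E = 1.
  by rewrite -EFinM /= -expr2 mulVf // sqrf_eq0 gt_eqF // twopi_gt0.
have [k20|k20] := eqVneq k.2 0.
  have k10 : k.1 != 0.
    by apply: contra_neq k0 => k10; apply/eqP; rewrite -pair_eqE /pair_eq /= k10 k20 !eqxx.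
  have Ey x : (\int[leb]_(y in `[0%R, (2 * pi)%R]) (1 + wave k c (x, y))%:E =
      (2 * pi)%:E * (1 + cos (k.1%:~R * x + c))%:E)%E.
    rewrite /wave /dot /= k20; under eq_integral do rewrite mul0r addr0.
    by rewrite integral_period_cst 1?mulrC ?EFinM //; have := cos_geN1 (k.1%:~R * x + c); lra.
  under eq_integral do rewrite Ey.
  rewrite ge0_integralZl //; last first.
  - apply: measurable_funTS; apply/measurable_EFinP; apply: measurable_funD => //.
    apply: measurableT_comp; first by apply: continuous_measurable_fun; exact: continuous_cos.
    by apply: measurable_funD => //; apply: measurable_funM.
  - by rewrite E // -EFinM.
have Ey x : (\int[leb]_(y in `[0%R, (2 * pi)%R]) (1 + wave k c (x, y))%:E = (2 * pi)%:E)%E.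
  rewrite -(E k.2 (k.1%:~R * x + c)) //; apply: eq_integral => y _.
  by rewrite /wave /dot /=; congr (_ + cos _)%:E; ring.
under eq_integral do rewrite Ey.
by rewrite integral_period_cst.
Qed.

End TorusIntegral.

(** * Real trigonometric polynomials *)

Section TrigPoly.
Variable R : realType.
Local Notation plane := (measurableTypeR R * measurableTypeR R)%type.

(** The phase lets one cosine per term produce sines as well, so [K] need not be symmetric. A list
    of terms, possibly with repeated frequencies, gives the induction [tp_ind]. *)
Definition tp (K : set (int * int)) (u : plane -> R) : Prop :=
  exists s : seq (R * (int * int) * R), (forall i, i \in s -> K i.1.2) /\
    u = fun x => \sum_(i <- s) i.1.1 * wave i.1.2 i.2 x.

Lemma tp_ind K (P : (plane -> R) -> Prop) : P (fun=> 0) ->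
  (forall c k d u, K k -> tp K u -> P u -> P (fun x => c * wave k d x + u x)) ->
  forall u, tp K u -> P u.
Proof.
move=> P0 PS u [s [Ks ->]]; elim: s Ks => [|i s ih] Ks.
  by under eq_fun do rewrite big_nil.
have Ks' j : j \in s -> K j.1.2 by move=> js; apply: Ks; rewrite inE js orbT.
under eq_fun do rewrite big_cons.
by apply: PS; [apply: Ks; rewrite inE eqxx|exists s|exact: ih].
Qed.

Lemma tp_nice K u : tp K u -> nice u.
Proof.
by case=> s [_ ->]; apply: nice_sum => i _; apply: niceZ; exact: nice_wave.
Qed.

Lemma tp_sub K K' u : K `<=` K' -> tp K u -> tp K' u.
Proof. by move=> KK' [s [Ks ->]]; exists s; split => // i /Ks /KK'. Qed.

Lemma tp0 K : tp K (fun=> 0).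
Proof. by exists [::]; split => //; apply/funext => x; rewrite big_nil. Qed.

Lemma tp_eq0 K (u : plane -> R) : (forall x, u x = 0) -> tp K u.
Proof. by move=> u0; have -> : u = (fun=> 0) by [apply/funext]; exact: tp0. Qed.

Lemma tpZ K c u : tp K u -> tp K (fun x => c * u x).
Proof.
case=> s [Ks ->]; exists [seq (c * i.1.1, i.1.2, i.2) | i <- s]; split.
  by move=> i /mapP[j /Ks Kj ->].
by apply/funext => x; rewrite big_map mulr_sumr; apply: eq_bigr => i _ /=; rewrite mulrA.
Qed.

Lemma tpD K u v : tp K u -> tp K v -> tp K (fun x => u x + v x).
Proof.
case=> s [Ks ->] [t [Kt ->]]; exists (s ++ t); split.
  by move=> i; rewrite mem_cat => /orP[/Ks|/Kt].
by apply/funext => x; rewrite big_cat.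
Qed.

Lemma tpB K u v : tp K u -> tp K v -> tp K (fun x => u x - v x).
Proof.
move=> tu /(tpZ (-1)) tv; have := tpD tu tv.
by congr tp; apply/funext => x; rewrite mulN1r.
Qed.

Lemma tp_sum K (I : Type) (s : seq I) (P : pred I) (F : I -> plane -> R) :
  (forall i, P i -> tp K (F i)) -> tp K (fun x => \sum_(i <- s | P i) F i x).
Proof.
move=> nF; elim: s => [|i s ih].
  by under eq_fun do rewrite big_nil; exact: tp0.
have -> : (fun x => \sum_(j <- i :: s | P j) F j x) = fun x =>
    if P i then F i x + \sum_(i <- s | P i) F i x else \sum_(i <- s | P i) F i x.
  by apply/funext => x; rewrite big_cons.
by case: (boolP (P i)) => // Pi; apply: tpD => //; exact: nF.
Qed.

Lemma tp_wave (K : set (int * int)) k c : K k -> tp K (wave k c).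
Proof.
move=> Kk; exists [:: (1, k, c)]; split; first by move=> i; rewrite inE => /eqP ->.
by apply/funext => x; rewrite big_seq1 mul1r.
Qed.

Lemma waveM k l c d x :
  wave k c x * wave l d x = 2^-1 * wave (k + l) (c + d) x + 2^-1 * wave (k - l) (c - d) x :> R.
Proof.
have -> : wave (k + l) (c + d) x = cos ((dot k x + c) + (dot l x + d)) :> R.
  by rewrite /wave /dot /= !rmorphD /=; congr cos; ring.
have -> : wave (k - l) (c - d) x = cos ((dot k x + c) - (dot l x + d)) :> R.
  by rewrite /wave /dot /= !rmorphB /=; congr cos; ring.
rewrite /wave (cosD (dot k x + c)) (cosB (dot k x + c)). by field.
Qed.

(** Differences occur beside sums because a cosine carries both k and -k. *)
Lemma tpM (K K' K'' : set (int * int)) u v :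
  (forall k l, K k -> K' l -> K'' (k + l) /\ K'' (k - l)) ->
  tp K u -> tp K' v -> tp K'' (fun x => u x * v x).
Proof.
move=> KK tu; move: v; apply: tp_ind => [|c l d v Kl tv ih].
  by under eq_fun do rewrite mulr0; exact: tp0.
under eq_fun do rewrite mulrDr; apply: tpD => //.
move: u tu {ih}; apply: tp_ind => [|e k f u Kk tu ih].
  by under eq_fun do rewrite mul0r; exact: tp0.
under eq_fun do rewrite mulrDl; apply: tpD => //.
have -> : (fun x => e * wave k f x * (c * wave l d x)) =
    (fun x => (e * c) * (2^-1 * wave (k + l) (f + d) x + 2^-1 * wave (k - l) (f - d) x)).
  by apply/funext => x; rewrite -waveM; ring.
by apply: tpZ; apply: tpD; apply: tpZ; apply: tp_wave; case: (KK _ _ Kk Kl).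
Qed.

(** This is how Riesz products and lacunary sums use orthogonality: only the absence of the
    frequency 0 from a product matters. *)
Lemma mean_tp0 K u : tp K u -> ~ K 0 -> mean u = 0.
Proof.
move=> + K0; move: u; apply: tp_ind => [|c k d u Kk /tp_nice nu ih].
  exact: mean_cst.
rewrite meanD ?ih //; last by apply: niceZ; exact: nice_wave.
rewrite meanZ; last exact: nice_wave.
by rewrite mean_wave; case: eqP => [k0|]; [rewrite k0 in Kk|rewrite mulr0 add0r].
Qed.

End TrigPoly.

(** * De la Vallee Poussin kernels *)

Section Kernels.
Variable R : realType.
Local Notation plane := (measurableTypeR R * measurableTypeR R)%type.

Definition csum (N : nat) (F : int -> R) : R := \sum_(i < (2 * N).+1) F (i%:Z - N%:Z).

Lemma eq_csum N F G : (forall q, F q = G q) -> csum N F = csum N G.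
Proof. by move=> FG; apply: eq_bigr => i _; rewrite FG. Qed.

Lemma eq_csum_le N F G : (forall q, (`|q| <= N)%N -> F q = G q) -> csum N F = csum N G.
Proof. by move=> FG; apply: eq_bigr => i _; apply: FG; have := ltn_ord i; lia. Qed.

Lemma csumZ N c F : csum N (fun q => c * F q) = c * csum N F.
Proof. by rewrite /csum mulr_sumr. Qed.

Lemma csumD N F G : csum N (fun q => F q + G q) = csum N F + csum N G.
Proof. by rewrite /csum big_split. Qed.

Lemma csumB N F G : csum N (fun q => F q - G q) = csum N F - csum N G.
Proof. by rewrite /csum sumrB. Qed.

Lemma exchange_csum N M (F : int -> int -> R) :
  csum N (fun q => csum M (F q)) = csum M (fun r => csum N (F ^~ r)).
Proof. exact: exchange_big. Qed.

Lemma csum_delta N k F :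
  csum N (fun q => if q == k then F q else 0) = if (`|k| <= N)%N then F k else 0.
Proof.
rewrite /csum; case: ifPn => kN.
  have ki : (absz (k + N%:Z)%R < (2 * N).+1)%N by lia.
  rewrite (bigD1 (Ordinal ki)) //= big1 ?addr0.
    have E : (absz (k + N%:Z))%:Z - N%:Z = k by lia.
    by rewrite E eqxx.
  move=> i ik; case: eqP => // E; case/eqP: ik; apply: val_inj => /=; lia.
by apply: big1 => i _; case: eqP => // E; have := ltn_ord i; lia.
Qed.

Lemma csum_opp N F : csum N F = csum N (fun q => F (- q)).
Proof.
rewrite /csum (reindex_inj rev_ord_inj); apply: eq_bigr => i _ /=.
by congr F; have := ltn_ord i; lia.
Qed.

Lemma csum_odd N F : (forall q, F (- q) = - F q) -> csum N F = 0.
Proof.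
move=> odF; have : csum N F = - csum N F.
  by rewrite {1}csum_opp (eq_csum _ odF) -(mulN1r (csum N F)) -csumZ; apply: eq_csum => q; rewrite mulN1r.
lra.
Qed.

Lemma csum_widen N M F : (N <= M)%N ->
  csum N F = csum M (fun q => if (`|q| <= N)%N then F q else 0).
Proof.
move=> NM; transitivity (csum N (fun q => csum M (fun r => if r == q then F r else 0))).
  by apply: eq_csum_le => q qN; rewrite csum_delta (leq_trans qN NM).
rewrite exchange_csum; apply: eq_csum => r.
have := csum_delta N r (fun=> F r); rewrite -/(csum _ _) => <-.
by apply: eq_csum => q; rewrite eq_sym.
Qed.

Lemma csum_eq0 N F : (forall q, (`|q| <= N)%N -> F q = 0) -> csum N F = 0.
Proof. by move=> F0; apply: big1 => i _; apply: F0; have := ltn_ord i; lia. Qed.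

Lemma csum_count N : csum N (fun=> 1) = (2 * N).+1%:R.
Proof. by rewrite /csum sumr_const card_ord. Qed.

Definition Dir m (t : R) : R := csum m (fun q => cos (q%:~R * t)).

Lemma csum_cos_shift m (c t : R) :
  csum m (fun q => cos (q%:~R * t + c)) = Dir m t * cos c.
Proof.
transitivity (csum m (fun q => cos c * cos (q%:~R * t)) - csum m (fun q => sin c * sin (q%:~R * t))).
  by rewrite -csumB; apply: eq_csum => q; rewrite cosD; ring.
rewrite !csumZ [X in _ - _ * X]csum_odd; first by rewrite mulr0 subr0 mulrC.
by move=> q; rewrite mulrNz mulNr sinN.
Qed.

Lemma DirM m n (t : R) :
  Dir m t * Dir n t = csum m (fun b => csum n (fun a => cos ((a + b)%:~R * t))).
Proof.
rewrite mulrC -[LHS]csumZ; apply: eq_csum => b.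
rewrite -csum_cos_shift; apply: eq_csum => a.
by rewrite intrD mulrDl.
Qed.

(* Fourier coefficients of the product of Dirichlet kernels D_m D_(2m) / (2m+1): equal to 1
   on [-m, m] and to 0 outside [-3m, 3m]. *)
Definition vcoef (m : nat) (q : int) : R :=
  if m == 0%N then 0
  else (2 * m).+1%:R^-1 * csum m (fun b => ((`|q - b| <= 2 * m)%N)%:R).

Lemma vcoefN m q : vcoef m (- q) = vcoef m q.
Proof.
rewrite /vcoef; case: ifP => // _; congr (_ * _).
rewrite csum_opp; apply: eq_csum => b; congr (nat_of_bool _)%:R; lia.
Qed.

Lemma vcoef1 m q : (0 < m)%N -> (`|q| <= m)%N -> vcoef m q = 1.
Proof.
move=> m0 qm; rewrite /vcoef gtn_eqF //.
have -> : csum m (fun b => ((`|q - b| <= 2 * m)%N)%:R) = (2 * m).+1%:R.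
  rewrite -csum_count; apply: eq_csum_le => b bm.
  by rewrite (_ : (_ <= _)%N = true) //; lia.
by rewrite mulVf // pnatr_eq0.
Qed.

Lemma vcoef0 m q : (3 * m < `|q|)%N -> vcoef m q = 0.
Proof.
move=> qm; rewrite /vcoef; case: ifP => // _.
rewrite csum_eq0 ?mulr0 // => b bm.
by rewrite (_ : (_ <= _)%N = false) //; lia.
Qed.

Definition ker N (a : int -> R) (t : R) : R := csum N (fun q => a q * cos (q%:~R * t)).

Definition Vker m : R -> R := ker (3 * m) (vcoef m).

Lemma VkerE m t : (0 < m)%N ->
  Vker m t = (2 * m).+1%:R^-1 * (Dir m t * Dir (2 * m) t).
Proof.
move=> m0; rewrite /Vker /ker DirM.
transitivity ((2 * m).+1%:R^-1 * csum (3 * m) (fun q =>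
    csum m (fun b => (if (`|q - b| <= 2 * m)%N then cos (q%:~R * t) else 0)))).
  rewrite -csumZ; apply: eq_csum => q; rewrite /vcoef gtn_eqF // -mulrA; congr (_ * _).
  rewrite mulrC -csumZ; apply: eq_csum => b.
  by case: ifP; rewrite ?mulr1 ?mulr0.
congr (_ * _); rewrite exchange_csum; apply: eq_csum_le => b bm.
transitivity (csum (3 * m) (fun q => csum (2 * m) (fun a =>
    if a == q - b then cos (q%:~R * t) else 0))).
  by apply: eq_csum => q; rewrite (csum_delta _ _ (fun=> cos (q%:~R * t))).
rewrite exchange_csum; apply: eq_csum_le => a am.
transitivity (csum (3 * m) (fun q => if q == a + b then cos (q%:~R * t) else 0)).
  by apply: eq_csum => q; congr (if _ then _ else _); apply/eqP/eqP; lia.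
by rewrite csum_delta ifT //; lia.
Qed.

(** Majorant of the product of Dirichlet kernels by the arithmetic-geometric mean inequality:
    [gsum_Dir2] evaluates the grid sums of the two squares exactly. *)
Definition Wker m (t : R) : R :=
  (2 * (2 * m).+1%:R)^-1 * (Dir m t ^+ 2 + Dir (2 * m) t ^+ 2).

Lemma Wker_ge0 m t : 0 <= Wker m t.
Proof. by rewrite mulr_ge0 ?invr_ge0 ?addr_ge0 ?sqr_ge0. Qed.

Lemma Vker_le m t : `|Vker m t| <= Wker m t.
Proof.
case: m => [|m].
  by rewrite /Vker /ker csum_eq0 ?normr0 ?Wker_ge0 // => q _; rewrite /vcoef mul0r.
rewrite VkerE // /Wker normrM ger0_norm ?invr_ge0 // invfM [X in _ <= X]mulrAC mulrC.
rewrite ler_wpM2r ?invr_ge0 // normrM.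
have := sqr_ge0 (`|Dir m.+1 t| - `|Dir (2 * m.+1) t|).
rewrite -(normr_id (Dir m.+1 t)) -(normr_id (Dir (2 * m.+1) t)) .
rewrite -(real_normK (num_real (Dir m.+1 t))) -(real_normK (num_real (Dir (2 * m.+1) t))).
rewrite !normr_id; lra.
Qed.

Lemma sin_period (k : int) (x : R) : sin (x + k%:~R * (2 * pi)) = sin x.
Proof.
have Pn (n : nat) (a : R) : sin (a + n%:R * (2 * pi)) = sin a.
  by rewrite -(periodicn (@sinD2pi R) n a); congr sin; rewrite -mulr_natr -(mulr_natr pi 2); ring.
case: k => n; first exact: Pn.
by rewrite NegzE -[RHS](Pn n.+1) -[in RHS](subrK (n.+1%:R * (2 * pi)) x) Pn mulrNz -pmulrn mulNr.
Qed.

Lemma cos_period (k : int) (x : R) : cos (x + k%:~R * (2 * pi)) = cos x.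
Proof. by rewrite -!sinDpihalf -[RHS](sin_period k); congr sin; ring. Qed.

Definition gpt (G i : nat) : R := 2 * pi * (i%:R / G%:R).

(** Multiplied by 2 sin h, where h is half the step of the argument, the sum telescopes over whole
    periods; sin h is nonzero because 0 < |k| < G. *)
Lemma gsum_cos (G : nat) (k : int) (c : R) : (0 < `|k| < G)%N ->
  \sum_(i < G) cos (k%:~R * gpt G i + c) = 0.
Proof.
move=> /andP[k0 kG]; have G0 : G%:R != 0 :> R by rewrite pnatr_eq0; lia.
pose h : R := pi * k%:~R / G%:R.
have sh : sin h != 0.
  have H (n : nat) : (0 < n < G)%N -> sin (pi * n%:R / G%:R) != 0 :> R.
    move=> /andP[n0 nG]; rewrite gt_eqF //; apply: sin_gt0_pi; rewrite -mulrA.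
    have Gp : (0 : R) < G%:R by rewrite ltr0n; lia.
    have nG0 : 0 < n%:R / G%:R :> R by rewrite divr_gt0 // ltr0n.
    rewrite mulr_gt0 ?pi_gt0 //= -[X in _ < X]mulr1 ltr_pM2l ?pi_gt0 //.
    by rewrite ltr_pdivrMr // mul1r ltr_nat.
  case: k k0 kG @h => n; rewrite ?NegzE => k0 kG; first by apply: H; lia.
  by rewrite /= mulrNz mulrN mulNr sinN oppr_eq0; apply: H; lia.
apply: (mulfI (x := 2 * sin h)); first by rewrite mulf_neq0 // pnatr_eq0.
rewrite mulr0 mulr_sumr.
pose g (i : nat) : R := sin (k%:~R * gpt G i + c - h).
rewrite (eq_bigr (fun i : 'I_G => g i.+1 - g i)); last first.
  move=> i _; rewrite /g.
  have -> : k%:~R * gpt G i.+1 + c - h = (k%:~R * gpt G i + c) + h.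
    by rewrite /gpt /h -natr1; field.
  by rewrite sinD (sinB (k%:~R * gpt G i + c)); ring.
rewrite -(big_mkord xpredT (fun i => g i.+1 - g i)) telescope_sumr // /g.
have -> : k%:~R * gpt G G + c - h = (c - h) + k%:~R * (2 * pi).
  by rewrite /gpt divff //; ring.
by rewrite sin_period /gpt mul0r !mulr0 add0r subrr.
Qed.

Definition gpair (G : nat * nat) (i : nat * nat) : plane := (gpt G.1 i.1, gpt G.2 i.2).

Definition gsum (G : nat * nat) (f : nat * nat -> R) : R :=
  \sum_(i1 < G.1) \sum_(i2 < G.2) f (i1 : nat, i2 : nat).

Lemma gsum_wave G (k : int * int) c : (`|k.1| < G.1)%N -> (`|k.2| < G.2)%N ->
  gsum G (fun i => wave k c (gpair G i)) = if k == 0 then (G.1 * G.2)%:R * cos c else 0.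
Proof.
move=> k1 k2; rewrite /gsum /wave /dot /=.
have [k20|k20] := eqVneq k.2 0; last first.
  rewrite [RHS]ifF; last by apply/negbTE; apply: contra k20 => /eqP ->.
  apply: big1 => i _; under eq_bigr => j _ do rewrite -addrA addrCA.
  by apply: gsum_cos; rewrite k2 andbT absz_gt0.
have [k10|k10] := eqVneq k.1 0.
  rewrite ifT; last by apply/eqP; case: (k) k10 k20 => /= ? ? -> ->.
  under eq_bigr => i _ do under eq_bigr => j _ do rewrite k10 k20 !mul0r !add0r.
  by rewrite !sumr_const !card_ord -mulrnA mulr_natl mulnC.
rewrite ifF; last by apply/negbTE; apply: contra k10 => /eqP ->.
rewrite exchange_big /=; apply: big1 => j _.
under eq_bigr => i _ do rewrite k20 mul0r addr0.
by apply: gsum_cos; rewrite k1 andbT absz_gt0.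
Qed.

Lemma exchange_sum_csum (I : finType) m (F : I -> int -> R) :
  \sum_i csum m (F i) = csum m (fun q => \sum_i F i q).
Proof. exact: exchange_big. Qed.

(** Parseval on the grid: the square of D_m has degree 2m < G, so its grid average is its mean. *)
Lemma gsum_Dir2 (G m : nat) (t : R) : (2 * m < G)%N ->
  \sum_(i < G) Dir m (gpt G i - t) ^+ 2 = G%:R * (2 * m).+1%:R.
Proof.
move=> mG.
transitivity (\sum_(i < G) csum m (fun b => csum m (fun a =>
    cos ((a + b)%:~R * gpt G i - (a + b)%:~R * t)))).
  apply: eq_bigr => i _; rewrite expr2 DirM; apply: eq_csum => b; apply: eq_csum => a.
  by rewrite mulrBr.
rewrite exchange_sum_csum -csum_count -csumZ; apply: eq_csum_le => b bm.
rewrite exchange_sum_csum mulr1.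
transitivity (csum m (fun a => if a == - b then G%:R else 0)).
  apply: eq_csum_le => a am; case: eqP => [->|ab].
    rewrite addNr; under eq_bigr => i _ do rewrite !mul0r subr0 cos0.
    by rewrite sumr_const card_ord.
  by rewrite gsum_cos //; lia.
by rewrite (csum_delta _ _ (fun=> G%:R)) abszN bm.
Qed.

Lemma gsum_Wker (G m : nat) (t : R) : (4 * m < G)%N ->
  \sum_(i < G) Wker m (gpt G i - t) <= G%:R * 2.
Proof.
move=> mG; rewrite /Wker -mulr_sumr big_split /= !gsum_Dir2; try lia.
have m0 : (0 : R) < (2 * m).+1%:R by rewrite ltr0n.
rewrite mulrC ler_pdivrMr ?mulr_gt0 // -mulrDr -mulrA ler_wpM2l //.
rewrite -!natrD -!natrM ler_nat; lia.
Qed.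

End Kernels.

(** * Convolution by exact quadrature and the dyadic partition of unity *)

Section Sampling.
Variable R : realType.
Local Notation plane := (measurableTypeR R * measurableTypeR R)%type.

Lemma wave_cos_cos (k q : int * int) (c a b : R) (y : plane) :
  wave k c y * (cos (a - q.1%:~R * y.1) * cos (b - q.2%:~R * y.2)) =
  4^-1 * ((wave (k.1 - q.1, k.2 - q.2) (c + a + b) y +
           wave (k.1 - q.1, k.2 + q.2) (c + a - b) y) +
          (wave (k.1 + q.1, k.2 - q.2) (c - a + b) y +
           wave (k.1 + q.1, k.2 + q.2) (c - a - b) y)).
Proof.
set A := dot k y + c; set B := a - q.1%:~R * y.1; set C := b - q.2%:~R * y.2.
have -> : wave (k.1 - q.1, k.2 - q.2) (c + a + b) y = cos (A + B + C) :> R.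
  by rewrite /wave /dot /A /B /C /dot /= !rmorphB; congr cos; ring.
have -> : wave (k.1 - q.1, k.2 + q.2) (c + a - b) y = cos (A + B - C) :> R.
  by rewrite /wave /dot /A /B /C /dot /= rmorphB rmorphD; congr cos; ring.
have -> : wave (k.1 + q.1, k.2 - q.2) (c - a + b) y = cos (A - B + C) :> R.
  by rewrite /wave /dot /A /B /C /dot /= rmorphB rmorphD; congr cos; ring.
have -> : wave (k.1 + q.1, k.2 + q.2) (c - a - b) y = cos (A - B - C) :> R.
  by rewrite /wave /dot /A /B /C /dot /= !rmorphD; congr cos; ring.
rewrite /wave -/A !(cosD (A + B)) !(cosD (A - B)) !(cosD A) !(sinD A) !cosN !sinN; by field.
Qed.

(** A cosine of frequency k splits evenly between k and -k; this is its overlap with the term q of a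
    kernel. *)
Definition hit (k q : int) : R := 2^-1 * ((q == k)%:R + (q == - k)%:R).

Lemma csum_hit N (a : int -> R) k : (forall q, a (- q) = a q) ->
  (forall q, (N < `|q|)%N -> a q = 0) -> csum N (fun q => a q * hit k q) = a k.
Proof.
move=> ev van.
have D (j : int) : csum N (fun q => a q * (q == j)%:R) = a j.
  transitivity (if (`|j| <= N)%N then a j else 0); last first.
    by case: leqP => // /van ->.
  by rewrite -csum_delta; apply: eq_csum => q; case: eqP; rewrite ?mulr1 ?mulr0.
transitivity (2^-1 * (csum N (fun q => a q * (q == k)%:R) + csum N (fun q => a q * (q == - k)%:R))).
  by rewrite -csumD -csumZ; apply: eq_csum => q; rewrite /hit; ring.
by rewrite !D ev; field.
Qed.

Lemma four_hits (k q : int * int) (c C : R) (x : plane) :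
  let a := q.1%:~R * x.1 in let b := q.2%:~R * x.2 in
  (if (k.1 - q.1, k.2 - q.2) == 0 then C * cos (c + a + b) else 0) +
  (if (k.1 - q.1, k.2 + q.2) == 0 then C * cos (c + a - b) else 0) +
  ((if (k.1 + q.1, k.2 - q.2) == 0 then C * cos (c - a + b) else 0) +
   (if (k.1 + q.1, k.2 + q.2) == 0 then C * cos (c - a - b) else 0)) =
  4 * (hit k.1 q.1 * hit k.2 q.2 * (C * wave k c x)).
Proof.
move=> a b.
have H (e1 e2 : int) (r : R) : (q.1 * e1 = k.1 -> q.2 * e2 = k.2 -> r = C * wave k c x) ->
    (if (k.1 - q.1 * e1, k.2 - q.2 * e2) == 0 then r else 0) =
    (q.1 * e1 == k.1)%:R * (q.2 * e2 == k.2)%:R * (C * wave k c x).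
  move=> Hr; rewrite -pair_eqE /pair_eq /= !subr_eq0 ![_ == q.1 * _]eq_sym ![_ == q.2 * _]eq_sym.
  by case: eqP => [e|_]; case: eqP => [f|_] /=; rewrite ?mul1r ?mul0r // Hr.
have N1 (p j : int) : (p * -1 == j) = (p == - j) by apply/eqP/eqP; lia.
have H11 := H 1 1 (C * cos (c + a + b)).
have H12 := H 1 (-1) (C * cos (c + a - b)).
have H21 := H (-1) 1 (C * cos (c - a + b)).
have H22 := H (-1) (-1) (C * cos (c - a - b)).
rewrite !mulr1 !N1 !mulrN1 !opprK in H11 H12 H21 H22.
rewrite H11 ?H12 ?H21 ?H22; first by rewrite /hit; field.
all: by rewrite /wave /dot /a /b => <- <-; rewrite ?rmorphN; congr (_ * cos _); ring.
Qed.

(** Convolution with an even kernel multiplies a wave by the coefficient of the kernel. The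
    functional [M] is abstract because it is used both as the mean, with [C] = 1, and as a grid sum,
    with [C] the number of points; the latter integrates exactly only the frequencies below the grid
    size. *)
Lemma conv_kernel (M : (plane -> R) -> R) (k : int * int) (c C : R) (x : plane)
    (N1 N2 : nat) (a1 a2 : int -> R) :
  (forall f g, nice f -> nice g -> M (fun y => f y + g y) = M f + M g) ->
  (forall d f, nice f -> M (fun y => d * f y) = d * M f) ->
  (forall l d, (`|l.1| <= `|k.1| + N1)%N -> (`|l.2| <= `|k.2| + N2)%N ->
     M (wave l d) = if l == 0 then C * cos d else 0) ->
  (forall q, a1 (- q) = a1 q) -> (forall q, (N1 < `|q|)%N -> a1 q = 0) ->
  (forall q, a2 (- q) = a2 q) -> (forall q, (N2 < `|q|)%N -> a2 q = 0) ->
  M (fun y => wave k c y * (ker N1 a1 (x.1 - y.1) * ker N2 a2 (x.2 - y.2))) =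
  C * (a1 k.1 * a2 k.2 * wave k c x).
Proof.
move=> MD MZ Mw e1 v1 e2 v2.
have M0 : M (fun=> 0) = 0.
  have := MZ 0 _ (nice_cst 0); by rewrite !mul0r.
have Msum (I : Type) (s : seq I) (F : I -> plane -> R) : (forall i, nice (F i)) ->
    M (fun y => \sum_(i <- s) F i y) = \sum_(i <- s) M (F i).
  move=> nF; elim: s => [|i s ih].
    by rewrite big_nil -[RHS]M0; congr M; apply/funext => y; rewrite big_nil.
  rewrite big_cons -ih -MD; [|exact: nF|by apply: nice_sum => j _; exact: nF].
  by congr M; apply/funext => y; rewrite big_cons.
pose T (q : int * int) : plane -> R :=
  fun y => wave k c y * (cos (q.1%:~R * x.1 - q.1%:~R * y.1) * cos (q.2%:~R * x.2 - q.2%:~R * y.2)).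
have nT q : nice (T q).
  rewrite /T; under eq_fun do rewrite wave_cos_cos.
  by apply: niceZ; repeat first [exact: nice_wave | apply: niceD].
have MT q : (`|q.1| <= N1)%N -> (`|q.2| <= N2)%N ->
    M (T q) = hit k.1 q.1 * hit k.2 q.2 * (C * wave k c x).
  move=> q1 q2; rewrite /T; under eq_fun do rewrite wave_cos_cos.
  have nw l d := nice_wave l d : nice (wave l d : plane -> R).
  rewrite MZ ?MD ?Mw //=; try (by lia).
  - by rewrite four_hits; field.
  all: repeat first [exact: nice_wave | apply: niceD].
transitivity (M (fun y => \sum_(i < (2 * N1).+1) \sum_(j < (2 * N2).+1)
    (a1 (i%:Z - N1%:Z) * a2 (j%:Z - N2%:Z)) * T (i%:Z - N1%:Z, j%:Z - N2%:Z) y)).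
  congr M; apply/funext => y; rewrite /ker /csum mulr_suml mulr_sumr; apply: eq_bigr => i _.
  rewrite mulr_sumr mulr_sumr; apply: eq_bigr => j _.
  by rewrite /T /= !mulrBr; ring.
rewrite Msum; last by move=> i; apply: nice_sum => j _; exact: niceZ.
transitivity (\sum_(i < (2 * N1).+1) \sum_(j < (2 * N2).+1)
    (a1 (i%:Z - N1%:Z) * hit k.1 (i%:Z - N1%:Z)) *
    (a2 (j%:Z - N2%:Z) * hit k.2 (j%:Z - N2%:Z)) * (C * wave k c x)).
  apply: eq_bigr => i _; rewrite Msum; last by move=> j; exact: niceZ.
  apply: eq_bigr => j _; rewrite MZ // MT /=; first by ring.
  - by have := ltn_ord i; lia.
  - by have := ltn_ord j; lia.
rewrite -[a1 k.1](csum_hit k.1 e1 v1) -[a2 k.2](csum_hit k.2 e2 v2) /csum mulrCA.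
by rewrite big_distrlr /= mulr_suml; apply: eq_bigr => i _; rewrite mulr_suml.
Qed.

(* [acoef s] is 1 on the frequencies of the dyadic block s (with the convention that the kernel
   of order 0 vanishes, which covers s = 0), and [bcoef s] is 1 on the support of [acoef s]. *)
Definition acoef (s : nat) (q : int) : R := vcoef R (2 ^ s) q - vcoef R (2 ^ s %/ 2) q.
Definition bcoef (s : nat) (q : int) : R := vcoef R (4 * 2 ^ s) q - vcoef R (2 ^ s %/ 8) q.
Definition Aker s : R -> R := ker (3 * 2 ^ s) (acoef s).
Definition Bker s : R -> R := ker (12 * 2 ^ s) (bcoef s).

Lemma acoefN s q : acoef s (- q) = acoef s q.
Proof. by rewrite /acoef !vcoefN. Qed.

Lemma bcoefN s q : bcoef s (- q) = bcoef s q.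
Proof. by rewrite /bcoef !vcoefN. Qed.

Lemma acoef_high s q : (3 * 2 ^ s < `|q|)%N -> acoef s q = 0.
Proof. by move=> h; rewrite /acoef !vcoef0 ?subrr //; lia. Qed.

Lemma bcoef_high s q : (12 * 2 ^ s < `|q|)%N -> bcoef s q = 0.
Proof. by move=> h; rewrite /bcoef !vcoef0 ?subrr //; lia. Qed.

Lemma acoef_low s q : (0 < s)%N -> (2 * `|q| <= 2 ^ s)%N -> acoef s q = 0.
Proof.
case: s => // s _; rewrite expnS => h.
have s0 : (0 < 2 ^ s)%N by rewrite expn_gt0.
by rewrite /acoef expnS !vcoef1 ?subrr //; lia.
Qed.

Lemma bcoef_low s q : (2 < s)%N -> (8 * `|q| <= 2 ^ s)%N -> bcoef s q = 0.
Proof.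
case: s => [|[|[|s]]] // _; rewrite !expnS => h.
have s0 : (0 < 2 ^ s)%N by rewrite expn_gt0.
by rewrite /bcoef !expnS !vcoef1 ?subrr //; lia.
Qed.

Lemma acoef_bcoef s q : acoef s q * bcoef s q = acoef s q.
Proof.
have [|h] := leqP `|q| (3 * 2 ^ s); last by rewrite acoef_high // mul0r.
move=> h1; have s0 : (0 < 2 ^ s)%N by rewrite expn_gt0.
have [/andP[p1 p2]|] := boolP ((0 < s) && (2 * `|q| <= 2 ^ s))%N; first by rewrite acoef_low ?mul0r.
move=> h2.
suff -> : bcoef s q = 1 by rewrite mulr1.
rewrite /bcoef vcoef1; [|lia|lia].
have [s3|s3] := ltnP s 3.
  by rewrite (_ : _ %/ 8 = 0)%N ?/vcoef ?eqxx ?subr0 //; case: s s3 {h1 h2 s0} => [|[|[|]]].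
by rewrite vcoef0 ?subr0 //; lia.
Qed.

Lemma sum_acoef n q : (`|q| < 2 ^ n)%N -> \sum_(s < n.+1) acoef s q = 1.
Proof.
move=> qn; have -> : \sum_(s < n.+1) acoef s q = vcoef R (2 ^ n) q.
  elim: n {qn} => [|n ih].
    by rewrite big_ord1 /acoef expn0 /= {2}/vcoef subr0.
  by rewrite big_ord_recr /= ih /acoef expnS mulKn // addrC subrK.
by apply: vcoef1; [rewrite expn_gt0|exact: ltnW].
Qed.

Lemma acoef_dyadic s t q : (`|q| < 2 ^ t)%N -> (t < s)%N -> acoef s q = 0.
Proof.
move=> qt ts; apply: acoef_low; first lia.
rewrite -(prednK (leq_ltn_trans (leq0n t) ts)) expnS leq_pmul2l // ltnW //.
by apply: leq_trans qt _; rewrite leq_exp2l //; lia.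
Qed.

(** If k lies in the block (t1, t2), the factor in k.1 vanishes for s > t1; for s <= t1 the other
    index still runs up to n - s >= t2, far enough for its sum to be 1. *)
Lemma sum_acoef2 n (k : int * int) : Q n k ->
  \sum_(l < n.+1) \sum_(s < l.+1) acoef s k.1 * acoef (l - s) k.2 = 1.
Proof.
case=> -[t1 t2] /= t12 [/andP[_ k1] /andP[_ k2]].
have {}t12 : (t1 + t2 <= n)%N by [].
transitivity (\sum_(l < n.+1) \sum_(s < n.+1 | (s <= l)%N) acoef s k.1 * acoef (l - s) k.2).
  apply: eq_bigr => l _.
  by rewrite (big_ord_widen_cond n.+1 xpredT (fun s => acoef s k.1 * acoef (l - s) k.2)).
rewrite (exchange_big_dep xpredT) //=.
rewrite -[RHS](@sum_acoef n k.1); last first.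
  by apply: leq_trans k1 _; rewrite leq_exp2l //=; lia.
apply: eq_bigr => s _; rewrite -mulr_sumr.
have [st|st] := leqP s t1; last by rewrite (acoef_dyadic k1 st) mul0r.
rewrite -[RHS]mulr1; congr (_ * _); rewrite -(@sum_acoef (n - s) k.2); last first.
  by apply: leq_trans k2 _; rewrite leq_exp2l //=; lia.
rewrite -(big_mkord (fun l => s <= l)%N (fun l => acoef (l - s) k.2)).
rewrite -(big_mkord xpredT (fun l => acoef l k.2)).
have sn := ltn_ord s; rewrite (big_cat_nat (n := s)) /=; [|lia|lia].
rewrite big_nat_cond big1 ?add0r; last by move=> i; lia.
rewrite -{1}[s : nat]add0n big_addn (_ : n.+1 - s = (n - s).+1)%N; last lia.
by apply: eq_big => i; [rewrite leq_addl|rewrite addnK].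
Qed.

End Sampling.

(** * Reconstruction from samples *)

Section SampleOperators.
Variable R : realType.
Local Notation plane := (measurableTypeR R * measurableTypeR R)%type.

Lemma tp_ker (N1 N2 : nat) (a1 a2 : int -> R) (x : plane) :
  (forall q, a1 (- q) = a1 q) -> (forall q, a2 (- q) = a2 q) ->
  tp [set k | a1 k.1 != 0 /\ a2 k.2 != 0]
    (fun y : plane => ker N1 a1 (x.1 - y.1) * ker N2 a2 (x.2 - y.2)).
Proof.
move=> e1 e2.
have T1 : tp [set k | a1 k.1 != 0 /\ k.2 = 0] (fun y : plane => ker N1 a1 (x.1 - y.1)).
  apply: tp_sum => i _ /=; have [->|a0] := eqVneq (a1 (i%:Z - N1%:Z)) 0.
    by apply: tp_eq0 => y; rewrite mul0r.
  apply: tpZ; set q := i%:Z - _.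
  have -> : (fun y : plane => cos (q%:~R * (x.1 - y.1))) = wave (- q, 0) (q%:~R * x.1).
    by apply/funext => y; rewrite /wave /dot /= rmorphN; congr cos; ring.
  by apply: tp_wave; rewrite /= e1.
have T2 : tp [set k | k.1 = 0 /\ a2 k.2 != 0] (fun y : plane => ker N2 a2 (x.2 - y.2)).
  apply: tp_sum => i _ /=; have [->|a0] := eqVneq (a2 (i%:Z - N2%:Z)) 0.
    by apply: tp_eq0 => y; rewrite mul0r.
  apply: tpZ; set q := i%:Z - _.
  have -> : (fun y : plane => cos (q%:~R * (x.2 - y.2))) = wave (0, - q) (q%:~R * x.2).
    by apply/funext => y; rewrite /wave /dot /= rmorphN; congr cos; ring.
  by apply: tp_wave; rewrite /= e2.
apply: tpM T1 T2 => k l [/= k1 k2] [l1 l2].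
by split; rewrite /= k2 l1 ?addr0 ?subr0 ?add0r ?sub0r ?e2.
Qed.

Lemma ker_opp N (a : int -> R) t : ker N a (- t) = ker N a t.
Proof. by apply: eq_csum => q; rewrite mulrN cosN. Qed.

Lemma ker_widen N M a (t : R) : (N <= M)%N -> (forall q, (N < `|q|)%N -> a q = 0) ->
  ker N a t = ker M a t.
Proof.
move=> NM v; rewrite /ker (csum_widen _ NM); apply: eq_csum => q.
by case: leqP => // /v ->; rewrite mul0r.
Qed.

Lemma ker_vcoefB N m m' (t : R) : (3 * m <= N)%N -> (m' <= m)%N ->
  ker N (fun q => vcoef R m q - vcoef R m' q) t = Vker m t - Vker m' t.
Proof.
move=> mN mm'; rewrite /Vker (@ker_widen (3 * m) N) //; last by move=> q; exact: vcoef0.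
rewrite (@ker_widen (3 * m') N) //; [|lia|by move=> q; exact: vcoef0].
by rewrite /ker -csumB; apply: eq_csum => q; rewrite mulrBl.
Qed.

(** The 32 * 2^s points exceed 3 * 2^s + 12 * 2^s, the largest frequency in the quadrature of
    [reconstruct], and 4 * (4 * 2^s), as [gsum_Wker] needs for the kernels of order 4 * 2^s. *)
Definition grid s : nat := (2 ^ (s + 5))%N.

Lemma grid_gt0 s : (0 < grid s)%N.
Proof. by rewrite expn_gt0. Qed.

Lemma gsum_Vker_le (G m m' : nat) (t : R) : (4 * m < G)%N -> (m' <= m)%N ->
  \sum_(i < G) `|Vker m (gpt R G i - t) - Vker m' (gpt R G i - t)| <= 4 * G%:R.
Proof.
move=> mG mm'.
apply: (@le_trans _ _ (\sum_(i < G) (Wker m (gpt R G i - t) + Wker m' (gpt R G i - t)))).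
  apply: ler_sum => i _; apply: le_trans (ler_normB _ _) _; apply: lerD; exact: Vker_le.
rewrite big_split /=; have := gsum_Wker t mG.
have : (4 * m' < G)%N by lia.
by move=> /(gsum_Wker t); lra.
Qed.

Lemma gsum_Aker s (t : R) : \sum_(i < grid s) `|Aker s (gpt R (grid s) i - t)| <= 4 * (grid s)%:R.
Proof.
have s0 : (0 < 2 ^ s)%N by rewrite expn_gt0.
rewrite (eq_bigr (fun i : 'I_(grid s) => `|Vker (2 ^ s) (gpt R (grid s) i - t) -
  Vker (2 ^ s %/ 2) (gpt R (grid s) i - t)|)).
  apply: gsum_Vker_le; last by lia.
  by rewrite /grid expnD; lia.
by move=> i _; rewrite /Aker ker_vcoefB //; lia.
Qed.

Lemma gsum_Bker s (t : R) : \sum_(i < grid s) `|Bker s (gpt R (grid s) i - t)| <= 4 * (grid s)%:R.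
Proof.
have s0 : (0 < 2 ^ s)%N by rewrite expn_gt0.
rewrite (eq_bigr (fun i : 'I_(grid s) => `|Vker (4 * 2 ^ s) (gpt R (grid s) i - t) -
  Vker (2 ^ s %/ 8) (gpt R (grid s) i - t)|)).
  apply: gsum_Vker_le; last by lia.
  by rewrite /grid expnD; lia.
by move=> i _; rewrite /Bker ker_vcoefB //; lia.
Qed.

Definition grid2 (s : nat * nat) : nat * nat := (grid s.1, grid s.2).
Definition npts (s : nat * nat) : R := (grid s.1 * grid s.2)%:R.

Lemma npts_gt0 s : 0 < npts s.
Proof. by rewrite ltr0n muln_gt0 !grid_gt0. Qed.

Lemma gsum_prod (G : nat * nat) (f g : nat -> R) :
  gsum G (fun i => f i.1 * g i.2) = (\sum_(i < G.1) f i) * (\sum_(i < G.2) g i).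
Proof. by rewrite /gsum big_distrlr. Qed.

Definition Asample (s i : nat * nat) : plane -> R := fun y =>
  Aker s.1 (gpt R (grid s.1) i.1 - y.1) * Aker s.2 (gpt R (grid s.2) i.2 - y.2).

Definition Bsample (s i : nat * nat) : plane -> R := fun y =>
  Bker s.1 (gpt R (grid s.1) i.1 - y.1) * Bker s.2 (gpt R (grid s.2) i.2 - y.2).

Lemma gsum_Asample s y : gsum (grid2 s) (fun i => `|Asample s i y|) <= 16 * npts s.
Proof.
rewrite /Asample.
have -> : gsum (grid2 s) (fun i => `|Asample s i y|) =
   (\sum_(i < grid s.1) `|Aker s.1 (gpt R (grid s.1) i - y.1)|) *
   (\sum_(i < grid s.2) `|Aker s.2 (gpt R (grid s.2) i - y.2)|).
  rewrite -(gsum_prod (grid2 s) (fun i => `|Aker s.1 (gpt R (grid s.1) i - y.1)|)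
    (fun i => `|Aker s.2 (gpt R (grid s.2) i - y.2)|)); apply: eq_bigr => i _; apply: eq_bigr => j _.
  by rewrite /Asample normrM.
rewrite (_ : 16 * npts s = (4 * (grid s.1)%:R) * (4 * (grid s.2)%:R)); last first.
  by rewrite /npts natrM; ring.
by apply: ler_pM; rewrite ?sumr_ge0 // gsum_Aker.
Qed.

Lemma gsum_Bsample s y : gsum (grid2 s) (fun i => `|Bsample s i y|) <= 16 * npts s.
Proof.
have -> : gsum (grid2 s) (fun i => `|Bsample s i y|) =
   (\sum_(i < grid s.1) `|Bker s.1 (gpt R (grid s.1) i - y.1)|) *
   (\sum_(i < grid s.2) `|Bker s.2 (gpt R (grid s.2) i - y.2)|).
  rewrite -(gsum_prod (grid2 s) (fun i => `|Bker s.1 (gpt R (grid s.1) i - y.1)|)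
    (fun i => `|Bker s.2 (gpt R (grid s.2) i - y.2)|)); apply: eq_bigr => i _; apply: eq_bigr => j _.
  by rewrite /Bsample normrM.
rewrite (_ : 16 * npts s = (4 * (grid s.1)%:R) * (4 * (grid s.2)%:R)); last first.
  by rewrite /npts natrM; ring.
by apply: ler_pM; rewrite ?sumr_ge0 // gsum_Bker.
Qed.

Definition aband (s : nat * nat) : set (int * int) := [set k |
  [/\ (`|k.1| <= 3 * 2 ^ s.1)%N, (`|k.2| <= 3 * 2 ^ s.2)%N,
   (0 < s.1)%N -> (2 ^ s.1 <= 2 * `|k.1|)%N & (0 < s.2)%N -> (2 ^ s.2 <= 2 * `|k.2|)%N]].

(** Only the first coordinate is recorded: lacunarity in that variable alone yields the moment
    bound. *)
Definition bband (s : nat * nat) : set (int * int) := [set k |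
  (`|k.1| <= 12 * 2 ^ s.1)%N /\ ((2 < s.1)%N -> (2 ^ s.1 <= 8 * `|k.1|)%N)].

Lemma tp_Asample s i : tp (aband s) (Asample s i).
Proof.
apply: tp_sub (@tp_ker _ _ (@acoef R s.1) (@acoef R s.2) (gpt R (grid s.1) i.1, gpt R (grid s.2) i.2) _ _).
- move=> k [/= k1 k2]; split.
  + by rewrite leqNgt; apply: contra k1 => /acoef_high ->.
  + by rewrite leqNgt; apply: contra k2 => /acoef_high ->.
  + by move=> s0; rewrite leqNgt; apply: contra k1 => /ltnW /acoef_low ->.
  + by move=> s0; rewrite leqNgt; apply: contra k2 => /ltnW /acoef_low ->.
- exact: acoefN.
- exact: acoefN.
Qed.

Lemma tp_Bsample s i : tp (bband s) (Bsample s i).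
Proof.
apply: tp_sub (@tp_ker _ _ (@bcoef R s.1) (@bcoef R s.2) (gpt R (grid s.1) i.1, gpt R (grid s.2) i.2) _ _).
- move=> k [/= k1 k2]; split.
  + by rewrite leqNgt; apply: contra k1 => /bcoef_high ->.
  + by move=> s0; rewrite leqNgt; apply: contra k1 => /ltnW /bcoef_low ->.
- exact: bcoefN.
- exact: bcoefN.
Qed.

(** The value at grid point i of the convolution of u with the kernel of block s, divided by the
    number of points, so that a grid sum of |lam| is an average. *)
Definition lam (s i : nat * nat) (u : plane -> R) : R :=
  (npts s)^-1 * mean (fun y => u y * Asample s i y).

Lemma nice_Asample s i : nice (Asample s i).
Proof. exact: tp_nice (tp_Asample s i). Qed.

Lemma lamB s i u v : nice u -> nice v -> lam s i (fun x => u x - v x) = lam s i u - lam s i v.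
Proof.
move=> nu nv; have nA := nice_Asample s i; rewrite /lam -mulrBr -meanB; [|exact: niceM..].
by congr (_ * mean _); apply/funext => y; rewrite mulrBl.
Qed.

Lemma lam_wave s i k c : lam s i (wave k c) =
  (npts s)^-1 * (acoef R s.1 k.1 * acoef R s.2 k.2 * wave k c (gpair R (grid2 s) i)).
Proof.
rewrite /lam /Asample; congr (_ * _).
rewrite (@conv_kernel R (@mean R) k c 1 (gpair R (grid2 s) i)) ?mul1r //.
- exact: meanD.
- by move=> d f nf; exact: meanZ.
- by move=> l d _ _; rewrite mean_wave mul1r.
- exact: acoefN.
- by move=> q; exact: acoef_high.
- exact: acoefN.
- by move=> q; exact: acoef_high.
Qed.

Definition layer_sum n (F : nat * nat -> R) : R :=
  \sum_(l < n.+1) \sum_(s < l.+1) F (s : nat, (l - s)%N).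

(** The kernel B reproduces the convolution of u with the kernel A, because [bcoef] is 1 on the
    support of [acoef], and the grid quadrature of this second convolution is exact. The blocks then
    add up to u by [sum_acoef2]. *)
Lemma reconstruct n (u : plane -> R) x : tp (Q n) u ->
  u x = layer_sum n (fun s => gsum (grid2 s) (fun i => lam s i u * Bsample s i x)).
Proof.
move=> tu; suff [] : nice u /\ u x = layer_sum n (fun s => gsum (grid2 s) (fun i => lam s i u * Bsample s i x)) by [].
move: u tu; apply: tp_ind => [|c k d u Qk tu [nu ih]].
  split; first exact: nice_cst.
  have l0 s i : lam s i (fun=> 0) = 0.
    rewrite /lam (_ : (fun y => _) = fun=> 0) ?mean_cst ?mulr0 //.
    by apply/funext => y; rewrite mul0r.
  rewrite /layer_sum /gsum big1 // => l _; rewrite big1 // => s _.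
  by rewrite big1 // => i _; rewrite big1 // => j _; rewrite l0 mul0r.
have nw := nice_wave k d : nice (wave k d : plane -> R).
split; first by apply: niceD => //; exact: niceZ.
have lin s i : lam s i (fun x => c * wave k d x + u x) = c * lam s i (wave k d) + lam s i u.
  have nA := nice_Asample s i.
  rewrite /lam mulrCA -mulrDr -[c * mean _]meanZ; last exact: niceM.
  rewrite -meanD; [|by apply: niceZ; exact: niceM|exact: niceM].
  by congr (_ * mean _); apply/funext => y; rewrite mulrDl mulrA.
have G s : gsum (grid2 s) (fun i => lam s i (wave k d) * Bsample s i x) =
    acoef R s.1 k.1 * acoef R s.2 k.2 * wave k d x.
  (* Either k is low enough for the quadrature on this grid to be exact, or the block does not see k
     and both sides vanish. *)
  have [[a1 a2]|a0] : ((`|k.1| <= 3 * 2 ^ s.1)%N /\ (`|k.2| <= 3 * 2 ^ s.2)%N) \/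
      acoef R s.1 k.1 * acoef R s.2 k.2 = 0.
  - have [h1|/acoef_high ->] := leqP `|k.1| (3 * 2 ^ s.1); last by right; rewrite mul0r.
    by have [h2|/acoef_high ->] := leqP `|k.2| (3 * 2 ^ s.2); [left|right; rewrite mulr0].
  - have := @conv_kernel R (fun f => gsum (grid2 s) (fun i => f (gpair R (grid2 s) i)))
      k d (npts s) x (12 * 2 ^ s.1) (12 * 2 ^ s.2) (bcoef R s.1) (bcoef R s.2).
    move=> C0; have {C0} C := fun h1 h2 h3 =>
      C0 h1 h2 h3 (bcoefN R s.1) (@bcoef_high R s.1) (bcoefN R s.2) (@bcoef_high R s.2).
    transitivity ((npts s)^-1 * (acoef R s.1 k.1 * acoef R s.2 k.2) *
      (npts s * (bcoef R s.1 k.1 * bcoef R s.2 k.2 * wave k d x))); last first.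
      rewrite -[in RHS](acoef_bcoef R s.1) -[in RHS](acoef_bcoef R s.2).
      by field; rewrite !pnatr_eq0 -!lt0n !grid_gt0.
    rewrite -C.
    + rewrite /gsum mulr_sumr; apply: eq_bigr => i _; rewrite mulr_sumr; apply: eq_bigr => j _.
      rewrite lam_wave /Bsample /gpair /=.
      by rewrite /Bker -(opprB x.1) -(opprB x.2) !ker_opp; ring.
    + move=> f g _ _; rewrite /gsum -big_split; apply: eq_bigr => i _ /=.
      by rewrite -big_split.
    + by move=> e f _; rewrite /gsum mulr_sumr; apply: eq_bigr => i _ /=; rewrite mulr_sumr.
    + move=> l e l1 l2; rewrite gsum_wave //.
      * by rewrite /grid2 /grid /= expnD; have := expn_gt0 2 s.1; lia.
      * by rewrite /grid2 /grid /= expnD; have := expn_gt0 2 s.2; lia.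
  - rewrite a0 mul0r /gsum big1 // => i _; rewrite big1 // => j _.
    by rewrite lam_wave a0 mul0r mulr0 mul0r.
rewrite ih; have -> : wave k d x = \sum_(l < n.+1) \sum_(s < l.+1)
    gsum (grid2 (s : nat, (l - s)%N)) (fun i => lam (s : nat, (l - s)%N) i (wave k d) * Bsample (s : nat, (l - s)%N) i x).
  rewrite -[LHS]mul1r -(sum_acoef2 R Qk) mulr_suml; apply: eq_bigr => l _.
  by rewrite mulr_suml; apply: eq_bigr => s _; rewrite G.
rewrite mulr_sumr /layer_sum -big_split; apply: eq_bigr => l _ /=.
rewrite mulr_sumr -big_split; apply: eq_bigr => s _ /=.
rewrite /gsum mulr_sumr -big_split; apply: eq_bigr => i _ /=.
by rewrite mulr_sumr -big_split; apply: eq_bigr => j _ /=; rewrite lin; ring.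
Qed.

End SampleOperators.

(** * Riesz products *)

Section Riesz.
Variable R : realType.
Local Notation plane := (measurableTypeR R * measurableTypeR R)%type.

(** Bands along a residue class of a layer: a grows and b decays with v. The lower bounds are
    dropped at the two ends, where the dyadic index may be 0 and the block may contain the frequency
    0. *)
Definition rband (N : nat) (a b : nat -> nat) (v : nat) : set (int * int) := [set k |
  [/\ (`|k.1| <= 3 * a v)%N, (`|k.2| <= 3 * b v)%N,
   (0 < v)%N -> (a v <= 2 * `|k.1|)%N & (v.+1 < N)%N -> (b v <= 2 * `|k.2|)%N]].

(* Real and imaginary parts of [\prod_(w < v) (1 + i c t_w)]. *)
Fixpoint rieszXY (c : R) (t : nat -> plane -> R) (v : nat) (x : plane) : R * R :=
  if v is w.+1 then
    let p := rieszXY c t w x in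
    (p.1 - c * (t w x * p.2), p.2 + c * (t w x * p.1))
  else (1, 0).

(** The factor 1 + i c t has squared modulus 1 + c^2 t^2. *)
Lemma riesz_norm c t N v x : (forall w, (w < N)%N -> `|t w x| <= 1) -> (v <= N)%N ->
  let p := rieszXY c t v x in p.1 ^+ 2 + p.2 ^+ 2 <= (1 + c ^+ 2) ^+ v.
Proof.
move=> t1; elim: v => [|v ih] vN /=; first by rewrite expr0; lra.
have {ih} := ih (ltnW vN); set p := rieszXY _ _ _ _ => /= ih.
have -> : (p.1 - c * (t v x * p.2)) ^+ 2 + (p.2 + c * (t v x * p.1)) ^+ 2 =
    (1 + c ^+ 2 * t v x ^+ 2) * (p.1 ^+ 2 + p.2 ^+ 2) by ring.
rewrite (exprS _ v); apply: ler_pM => //.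
- by rewrite addr_ge0 // mulr_ge0 // sqr_ge0.
- by rewrite addr_ge0 // sqr_ge0.
- rewrite lerD2l -[leRHS]mulr1 ler_wpM2l ?sqr_ge0 //.
  by rewrite -real_normK ?num_real // expr_le1 // t1.
Qed.

Lemma Bernoulli_rev (d : R) v : 0 <= d -> 2 * v%:R * d <= 1 -> (1 + d) ^+ v <= 1 + 2 * v%:R * d.
Proof.
move=> d0; elim: v => [|v ih] h; first by rewrite expr0 mulr0 mul0r addr0.
rewrite -natr1 in h *.
have v0 : 0 <= v%:R :> R by [].
have h' : 2 * v%:R * d <= 1 by apply: le_trans h; rewrite ler_wpM2r //; lra.
rewrite (exprS _ v); apply: (@le_trans _ _ ((1 + d) * (1 + 2 * v%:R * d))).
  by rewrite ler_wpM2l ?ih //; lra.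
have : d * (2 * v%:R * d) <= d * 1 by rewrite ler_wpM2l.
nra.
Qed.

Variables (N X : nat) (a b : nat -> nat).
Hypothesis a_grow : forall v, (v.+1 < N)%N -> (32 * a v <= a v.+1)%N.
Hypothesis b_grow : forall v, (v.+1 < N)%N -> (32 * b v.+1 <= b v)%N.
Hypothesis ab_large : forall v, (v.+1 < N)%N -> (16 * X <= a v.+1 * b v)%N.

Let a_mono w v : (w < v)%N -> (v < N)%N -> (32 * a w <= a v)%N.
Proof.
elim: v => // v ih; rewrite ltnS leq_eqVlt => /orP[/eqP->|wv] vN; first exact: a_grow.
by have := ih wv (ltnW vN); have := a_grow vN; lia.
Qed.

Let b_mono w v : (w < v)%N -> (v < N)%N -> (32 * b v <= b w)%N.
Proof.
elim: v => // v ih; rewrite ltnS leq_eqVlt => /orP[/eqP->|wv] vN; first exact: b_grow.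
by have := ih wv (ltnW vN); have := b_grow vN; lia.
Qed.

(** Invariant of products of at least two bands with indices below v: the largest index governs the
    first coordinate and the smallest one, w, the second. By [ab_large] such a frequency lies above
    the hyperbola. The summand 12 b_(v-1) is slack for later factors, since the factor v moves 4
    |k.2| by at most 12 b_v and b drops by 32. *)
Let high (v : nat) : set (int * int) := [set k |
  (`|k.1| <= 6 * a v.-1)%N /\ exists w, [/\ (w.+1 < v)%N,
    (a w.+1 <= 4 * `|k.1|)%N & (b w + 12 * b v.-1 <= 4 * `|k.2|)%N]].

Let high_sub v : (v < N)%N -> high v `<=` high v.+1.
Proof.
move=> vN k [k1 [w [wv kw1 kw2]]].
have v0 : (v.-1 < v)%N by lia.
have := a_mono v0 vN; have := b_mono v0 vN => hb ha.
by split => /=; [lia|exists w; split; [lia|lia|lia]].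
Qed.

Let high_band v k l : (v < N)%N -> rband N a b v k -> high v l -> high v.+1 (k + l).
Proof.
move=> vN [k1 k2 k3 k4] [l1 [w [wv lw1 lw2]]].
have v0 : (v.-1 < v)%N by lia.
have ha := a_mono v0 vN; have hb := b_mono v0 vN.
have vp : (0 < v)%N by lia.
have haw : (a w.+1 <= a v)%N.
  case: (ltngtP w.+1 v) wv => // h _; have := a_mono h vN; lia.
have {}k3 := k3 vp.
have E1 : (k + l).1 = k.1 + l.1 by [].
have E2 : (k + l).2 = k.2 + l.2 by [].
by split; [rewrite E1 /=; lia|exists w; rewrite E1 E2 /=; split; lia].
Qed.

Let band_band v w k l : (w < v)%N -> (v < N)%N -> rband N a b v k -> rband N a b w l ->
  high v.+1 (k + l).
Proof.
move=> wv vN [k1 k2 k3 k4] [l1 l2 l3 l4].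
have ha := a_mono wv vN; have hb := b_mono wv vN.
have vp : (0 < v)%N by lia.
have haw : (a w.+1 <= a v)%N.
  move: (wv); rewrite leq_eqVlt => /orP[/eqP->//|h]; have := a_mono h vN; lia.
have {}k3 := k3 vp; have wN : (w.+1 < N)%N by lia.
have {}l4 := l4 wN.
have E1 : (k + l).1 = k.1 + l.1 by [].
have E2 : (k + l).2 = k.2 + l.2 by [].
by split; [rewrite E1 /=; lia|exists w; rewrite E1 E2 /=; split; lia].
Qed.

Let bandN v k : rband N a b v k -> rband N a b v (- k).
Proof. by case: k => k1 k2 [/= h1 h2 h3 h4]; split; rewrite /= abszN. Qed.

Let highN v k : high v k -> high v (- k).
Proof. by case: k => k1 k2 [/= h1 [w [h2 h3 h4]]]; split; [|exists w; split]; rewrite /= ?abszN. Qed.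

Variables (t : nat -> plane -> R) (u : plane -> R).
Hypothesis t_band : forall v, (v < N)%N -> tp (rband N a b v) (t v).
Hypothesis t_le1 : forall v x, (v < N)%N -> `|t v x| <= 1.
Hypothesis u_low : tp [set k | (`|k.1| * `|k.2| < X)%N] u.

(** Once the constant 1 and the linear terms are removed, every term of the expanded product has at
    least two factors. *)
Let riesz_spec c v : (v <= N)%N ->
  tp (high v) (fun x => (rieszXY c t v x).1 - 1) /\
  tp (high v) (fun x => (rieszXY c t v x).2 - c * \sum_(w < v) t w x).
Proof.
elim: v => [|v ih] vN /=.
  by split; apply: tp_eq0 => x; rewrite ?big_ord0; ring.
have [ihX ihY] := ih (ltnW vN).
have tv u' : tp (high v) u' -> tp (high v.+1) (fun x => t v x * u' x).
  apply: tpM (t_band vN) => k l kb lh; split; first exact: high_band.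
  by apply: high_band => //; exact: highN.
split.
- have -> : (fun x => (rieszXY c t v x).1 - c * (t v x * (rieszXY c t v x).2) - 1) =
    (fun x => ((rieszXY c t v x).1 - 1) -
      c * (t v x * ((rieszXY c t v x).2 - c * \sum_(w < v) t w x) +
           c * \sum_(w < v) (t v x * t w x))).
    by apply/funext => x; rewrite -mulr_sumr; ring.
  apply: tpB; first exact: tp_sub (high_sub vN) ihX.
  apply: tpZ; apply: tpD; first exact: tv.
  apply: tpZ; apply: tp_sum => w _; have wv := ltn_ord w.
  apply: tpM (t_band vN) (t_band (ltn_trans wv vN)) => k l kb lb.
  by split; apply: (band_band wv vN kb) => //; exact: bandN.
- have -> : (fun x => (rieszXY c t v x).2 + c * (t v x * (rieszXY c t v x).1) -
      c * \sum_(w < v.+1) t w x) =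
    (fun x => ((rieszXY c t v x).2 - c * \sum_(w < v) t w x) +
      c * (t v x * ((rieszXY c t v x).1 - 1))).
    by apply/funext => x; rewrite big_ord_recr /=; ring.
  by apply: tpD; [exact: tp_sub (high_sub vN) ihY|apply: tpZ; exact: tv].
Qed.

(* The imaginary part of the Riesz product [\prod_v (1 + i c t_v)] is
   [c \sum_v t_v] plus terms whose frequencies lie above the hyperbola; its
   modulus stays bounded when [c] is of order [N^(-1/2)]. *)
Lemma riesz_bound :
  `|mean (fun x => u x * \sum_(v < N) t v x)| <=
  2 * Num.sqrt (2 * N%:R) * mean (fun x => `|u x|).
Proof.
have nu := tp_nice u_low.
have [N0|N0] := posnP N.
  rewrite N0; under eq_fun do rewrite big_ord0 mulr0.
  rewrite mean_cst normr0 mulr_ge0 ?mean_ge0 // mulr_ge0 // sqrtr_ge0.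
have N0' : 0 < N%:R :> R by rewrite ltr0n.
set s := Num.sqrt (2 * N%:R); have s0 : 0 < s by rewrite sqrtr_gt0 mulr_gt0.
have s2 : s ^+ 2 = 2 * N%:R by rewrite sqr_sqrtr // mulr_ge0.
(* With c^2 = 1 / (2N) the squared modulus (1 + c^2)^N stays below 2; dividing by c at the end costs
   sqrt(2N). *)
pose c : R := s^-1.
have c0 : 0 < c by rewrite invr_gt0.
have [_ tY] := riesz_spec c (leqnn N).
pose Y x := (rieszXY c t N x).2.
have tS : nice (fun x => \sum_(v < N) t v x).
  by apply: nice_sum => v _; exact: tp_nice (t_band (ltn_ord v)).
have nY : nice Y.
  have := niceD (tp_nice tY) (niceZ c tS).
  by congr nice; apply/funext => x; rewrite subrK.
have E : mean (fun x => u x * Y x) = c * mean (fun x => u x * \sum_(v < N) t v x).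
  rewrite -meanZ; last exact: niceM.
  have nS := niceZ c (niceM nu tS).
  apply/eqP; rewrite -subr_eq0 -meanB //; last exact: niceM.
  apply/eqP; transitivity (mean (fun x => u x * ((rieszXY c t N x).2 - c * \sum_(w < N) t w x))).
    by congr mean; apply/funext => x; rewrite /Y; ring.
  (* A frequency k of u and a frequency l of the remainder satisfy |k.1 k.2| < X <= |l.1 l.2|, so
     neither k + l nor k - l is 0. *)
  apply: (@mean_tp0 _ [set k | k != 0]); last by [].
  apply: tpM u_low tY => k l /= kX [l1 [w [wN lw1 lw2]]].
  have h := ab_large wN.
  have lX : (X <= `|l.1| * `|l.2|)%N.
    suff : (a w.+1 * b w <= (4 * `|l.1|) * (4 * `|l.2|))%N by lia.
    by apply: leq_mul => //; lia.
  split; apply/eqP => kl.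
    have kE : k = - l by apply/eqP; rewrite -addr_eq0 kl.
    move: kX; rewrite kE -[(- l).1]/(- l.1) -[(- l).2]/(- l.2) !abszN.
    by rewrite ltnNge lX.
  have kE : k = l by apply/eqP; rewrite -subr_eq0 kl.
  by move: kX; rewrite kE ltnNge lX.
have Yb x : `|Y x| <= 2.
  rewrite -ler_sqr ?nnegrE // real_normK ?num_real //.
  have := @riesz_norm c t N N x (fun w wN => t_le1 x wN) (leqnn N) => /= h.
  have : (1 + c ^+ 2) ^+ N <= 2.
    have hc : 2 * N%:R * c ^+ 2 = 1 by rewrite /c exprVn s2 divff // gt_eqF // mulr_gt0.
    by have := @Bernoulli_rev (c ^+ 2) N (sqr_ge0 _); rewrite hc; apply; rewrite lexx.
  have := sqr_ge0 (rieszXY c t N x).1; rewrite -/(Y x) in h *; lra.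
have : `|mean (fun x => u x * Y x)| <= 2 * mean (fun x => `|u x|).
  apply: le_trans (norm_mean (niceM nu nY)) _; rewrite -meanZ; last exact: nice_norm.
  apply: le_mean; [by apply: nice_norm; exact: niceM|by apply: niceZ; exact: nice_norm|].
  by move=> x; rewrite normrM mulrC ler_wpM2r.
rewrite E normrM (gtr0_norm c0) /c ler_pdivrMl // => h.
by apply: le_trans h _; rewrite mulrCA mulrA.
Qed.

End Riesz.

(** * Lacunary sums *)

Section Moments.
Variable R : realType.
Local Notation plane := (measurableTypeR R * measurableTypeR R)%type.

(** The linear term is isolated because its mean will vanish. Every later term of the binomial
    expansion is at most its coefficient times k^2 F^(2q) or k^(2q+2), according to whether |F|
    exceeds k, and these coefficients sum to at most 2^(2q+2). *)
Lemma even_power_increment (F e k : R) (q : nat) : `|e| <= k ->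
  (F + e) ^+ (2 * q.+1) <= F ^+ (2 * q.+1) + (2 * q.+1)%:R * (F ^+ (2 * q).+1 * e) +
    4 ^+ q.+1 * (k ^+ 2 * F ^+ (2 * q) + k ^+ (2 * q.+1)).
Proof.
move=> ek; have k0 : 0 <= k := le_trans (normr_ge0 e) ek.
have Fe n : F ^+ (2 * n) = `|F| ^+ (2 * n).
  by rewrite !exprM real_normK ?num_real.
have -> : 4 ^+ q.+1 = (2 ^ (2 * q.+1))%:R :> R.
  rewrite natrX exprM; congr (_ ^+ _); lra.
have -> : (2 * q.+1 = (2 * q).+2)%N by lia.
set n := (2 * q)%N; set B := k ^+ 2 * F ^+ n + k ^+ n.+2.
have Fn : F ^+ n = `|F| ^+ n by exact: Fe.
rewrite exprDn 2!big_ord_recl /= expr0 expr1 mulr1 subn0 bin0 mulr1n bin1 addrA.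
rewrite -[X in _ + X + _ <= _]mulr_natl lerD2l.
apply: (@le_trans _ _ (\sum_(i < n.+1) B *+ 'C(n.+2, i.+2))).
  apply: ler_sum => i _; rewrite -[bump 0 (bump 0 i)]/(i.+2).
  apply: ler_wMn2r; have iq := ltn_ord i.
  apply: le_trans (ler_norm _) _; rewrite normrM !normrX.
  apply: (@le_trans _ _ (`|F| ^+ (n.+2 - i.+2) * k ^+ i.+2)).
    by rewrite ler_wpM2l ?exprn_ge0 // lerXn2r // nnegrE.
  have [Fk|kF] := leP `|F| k.
    apply: (@le_trans _ _ (k ^+ (n.+2 - i.+2) * k ^+ i.+2)).
      by rewrite ler_wpM2r ?exprn_ge0 // lerXn2r // nnegrE.
    rewrite -exprD (_ : n.+2 - i.+2 + i.+2 = n.+2)%N; last lia.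
    by rewrite /B lerDr Fn mulr_ge0 // exprn_ge0.
  apply: (@le_trans _ _ (k ^+ 2 * `|F| ^+ n)); last first.
    by rewrite /B Fn lerDl exprn_ge0.
  rewrite -(addn2 i) addnC exprD mulrCA ler_wpM2l ?exprn_ge0 //.
  have -> : `|F| ^+ n = `|F| ^+ (n.+2 - (2 + i)) * `|F| ^+ i by rewrite -exprD; congr (_ ^+ _); lia.
  by rewrite ler_wpM2l ?exprn_ge0 // lerXn2r ?nnegrE // ltW.
have B0 : 0 <= B.
  by rewrite /B Fn; apply: addr_ge0; [apply: mulr_ge0|]; apply: exprn_ge0.
rewrite sumrMnr mulr_natl; apply: ler_wpMn2l => //.
rewrite (expnDn 1 1) 2!big_ord_recl addnA; apply: leq_trans (leq_addl _ _).
by apply: leq_sum => i _; rewrite !exp1n !muln1.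
Qed.

Fixpoint mom_const (q : nat) : R :=
  if q is p.+1 then 4 ^+ p.+1 * (mom_const p + 1) else 1.

Lemma mom_const_ge0 q : 0 <= mom_const q.
Proof. by elim: q => //= q ih; rewrite mulr_ge0 ?exprn_ge0 // addr_ge0. Qed.

Lemma tpX (a n : nat) (u : plane -> R) : tp [set k | (`|k.1| <= a)%N] u ->
  tp [set k | (`|k.1| <= n * a)%N] (fun x => u x ^+ n).
Proof.
move=> tu; elim: n => [|n ih].
  have -> : (fun x => u x ^+ 0) = wave 0 0.
    by apply/funext => x; rewrite expr0 /wave /dot /= !mul0r !add0r cos0.
  exact: tp_wave.
have -> : (fun x => u x ^+ n.+1) = (fun x => u x * u x ^+ n) by apply/funext => x; rewrite exprS.
apply: tpM tu ih => -[k1 k2] [l1 l2] /= hk hl.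
by split; rewrite /= mulSn; lia.
Qed.

Variables (r N : nat) (a : nat -> nat) (e : nat -> plane -> R) (k : R).
Hypothesis e_band : forall v, (v < N)%N ->
  tp [set l | (`|l.1| <= 12 * a v)%N /\ ((0 < v)%N -> (a v <= 8 * `|l.1|)%N)] (e v).
Hypothesis e_le : forall v x, (v < N)%N -> `|e v x| <= k.
Hypothesis k0 : 0 <= k.
Hypothesis a_lac : forall v, (v.+1 < N)%N -> (192 * r.+1 * a v < a v.+1)%N.

Let a_mono w v : (w <= v)%N -> (v < N)%N -> (a w <= a v)%N.
Proof.
elim: v => [|v ih]; first by rewrite leqn0 => /eqP ->.
rewrite leq_eqVlt => /orP[/eqP-> //|wv] vN.
by have := ih wv (ltnW vN); have := a_lac vN; lia.
Qed.

(** A Khinchine-type inequality, by adding one term at a time: the linear increment has mean 0, so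
    by induction on q the moment of order 2(q+1) grows by a multiple of M^q k^(2q+2), and these
    increments sum to the order M^(q+1). *)
Lemma lacunary_moment q M : (q <= r)%N -> (M <= N)%N ->
  mean (fun x => (\sum_(v < M) e v x) ^+ (2 * q)) <= mom_const q * (M%:R ^+ q * k ^+ (2 * q)).
Proof.
elim: q M => [|q ihq] M qr.
  by move=> _; under eq_fun do rewrite muln0 expr0; rewrite mean_cst /= !expr0 !mulr1.
have nF L : (L <= N)%N -> nice (fun x => \sum_(v < L) e v x).
  by move=> LN; apply: nice_sum => v _; apply: tp_nice (e_band (leq_trans (ltn_ord v) LN)).
elim: M => [|M ihM] MN.
  under eq_fun do rewrite big_ord0 expr0n /=.
  by rewrite mean_cst mulr_ge0 ?mom_const_ge0 // mulr_ge0 ?exprn_ge0.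
have {}ihM := ihM (ltnW MN); have nFM := nF M (ltnW MN).
have ne := tp_nice (e_band MN).
set F := fun x => \sum_(v < M) e v x in nFM ihM.
(* The first coordinates in F^(2q+1) are at most (2q+1) * 12 a_(M-1), below the least one a_M / 8 of
   e_M; since 8 * 12 * (2q+1) <= 192 (r+1), this is what [a_lac] provides. *)
have lin0 : mean (fun x => F x ^+ (2 * q).+1 * e M x) = 0.
  have [M0|M0] := posnP M.
    rewrite -[RHS](mean_cst 0); congr mean; apply/funext => x.
    by rewrite /F M0 big_ord0 expr0n mul0r.
  apply: (@mean_tp0 _ [set l | l != 0]); last by [].
  have tF : tp [set l | (`|l.1| <= 12 * a M.-1)%N] F.
    apply: tp_sum => v _; have vM := ltn_ord v.
    apply: tp_sub (e_band (ltn_trans vM MN)) => l [l1 _] /=.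
    have vM1 : (v <= M.-1)%N by lia.
    have M1N : (M.-1 < N)%N by lia.
    by have := a_mono vM1 M1N; lia.
  apply: tpM (tpX (2 * q).+1 tF) (e_band MN) => -[l1 l2] [m1 m2] /= hl [hm1 /(_ M0) hm2].
  have lac : (192 * r.+1 * a M.-1 < a M)%N by have := @a_lac M.-1; rewrite prednK //; apply.
  have hq : ((2 * q).+1 * (12 * a M.-1) * 8 <= 192 * r.+1 * a M.-1)%N.
    rewrite mulnA mulnAC leq_mul2r; apply/orP; right; lia.
  have ml : (`|l1| < `|m1|)%N by lia.
  by split; apply/eqP => -[lm _]; lia.
have n1 : nice (fun x => F x ^+ (2 * q.+1)) by exact: niceX.
have n2 : nice (fun x => (2 * q.+1)%:R * (F x ^+ (2 * q).+1 * e M x)).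
  by apply: niceZ; apply: niceM => //; exact: niceX.
have n3 : nice (fun x => k ^+ 2 * F x ^+ (2 * q)) by apply: niceZ; exact: niceX.
have n4 : nice (fun x => 4 ^+ q.+1 * (k ^+ 2 * F x ^+ (2 * q) + k ^+ (2 * q.+1))).
  by apply: niceZ; apply: niceD => //; exact: nice_cst.
apply: (@le_trans _ _ (mean (fun x => F x ^+ (2 * q.+1) + (2 * q.+1)%:R * (F x ^+ (2 * q).+1 * e M x) +
    4 ^+ q.+1 * (k ^+ 2 * F x ^+ (2 * q) + k ^+ (2 * q.+1))))).
  apply: le_mean; [by apply: niceX; exact: nF|exact: (niceD (niceD n1 n2) n4)|].
  by move=> x; rewrite big_ord_recr /=; apply: even_power_increment; exact: e_le.
rewrite meanD ?meanD //; last by apply: niceD.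
rewrite meanZ; last by apply: niceM => //; exact: niceX.
rewrite lin0 mulr0 addr0 meanZ; last by apply: niceD => //; exact: nice_cst.
rewrite meanD //; last exact: nice_cst.
rewrite meanZ; last exact: niceX.
rewrite mean_cst.
have hq := ihq M (ltnW qr) (ltnW MN).
have M0 : (0 : R) <= M%:R by [].
have C0 := mom_const_ge0 q.
set K : R := k ^+ (2 * q.+1).
have K0 : 0 <= K by rewrite exprn_ge0.
have h2 : k ^+ 2 * mean (fun x => F x ^+ (2 * q)) <= mom_const q * (M%:R ^+ q * K).
  apply: le_trans (ler_wpM2l (exprn_ge0 2 k0) hq) _.
  by rewrite /K (_ : 2 * q.+1 = 2 + 2 * q)%N ?exprD; [rewrite le_eqVlt; apply/orP; left; apply/eqP; ring|lia].
apply: (@le_trans _ _ (mom_const q.+1 * (M%:R ^+ q.+1 * K) + 4 ^+ q.+1 * (mom_const q * (M%:R ^+ q * K) + K))).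
  apply: lerD ihM _; rewrite ler_wpM2l ?exprn_ge0 // lerD2r; exact: h2.
have h3 : M%:R ^+ q <= M.+1%:R ^+ q :> R by rewrite lerXn2r ?nnegrE // ler_nat.
have h4 : 1 <= M.+1%:R ^+ q :> R by rewrite exprn_ege1 // ler1n.
(* The decomposition (M+1)^(q+1) = M (M+1)^q + (M+1)^q leaves room for one increment. *)
have key : (mom_const q + 1) * M%:R ^+ q.+1 + (mom_const q * M%:R ^+ q + 1) <=
    (mom_const q + 1) * M.+1%:R ^+ q.+1.
  have -> : M.+1%:R ^+ q.+1 = M%:R * M.+1%:R ^+ q + M.+1%:R ^+ q :> R by rewrite exprS -natr1; ring.
  rewrite [leRHS]mulrDr; apply: lerD.
    by rewrite ler_wpM2l ?addr_ge0 // exprS ler_wpM2l.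
  by rewrite [leRHS]mulrDl mul1r; apply: lerD => //; rewrite ler_wpM2l.
have A0 : 0 <= 4 ^+ q.+1 * K by rewrite mulr_ge0 // exprn_ge0.
have := ler_wpM2l A0 key; rewrite /=; set A : R := 4 ^+ q.+1.
set x := M%:R ^+ q.+1; set y := M.+1%:R ^+ q.+1; set z := M%:R ^+ q; lra.
Qed.

End Moments.

(** * The l_1 norm of the samples on one hyperbolic layer *)

Section LayerBounds.
Variable R : realType.
Local Notation plane := (measurableTypeR R * measurableTypeR R)%type.

(** The ceiling of (L - o) / J, which for o < J is the size of the residue class of o below L. *)
Definition class_size (L J o : nat) : nat := ((L + J).-1 - o) %/ J.

Lemma class_sizeP L J o v : (o < J)%N -> (v < class_size L J o)%N = (o + v * J < L)%N.
Proof.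
move=> oJ; rewrite /class_size leq_divRL; last by lia.
by rewrite mulSn; lia.
Qed.

Lemma sum_residues (x : nat -> R) (L J : nat) : (0 < J)%N ->
  \sum_(s < L) x s = \sum_(o < J) \sum_(v < class_size L J o) x (o + v * J)%N.
Proof.
move=> J0; pose y s := if (s < L)%N then x s else 0.
transitivity (\sum_(0 <= s < L * J) y s).
  rewrite (big_cat_nat (n := L)) //=; last by rewrite leq_pmulr.
  rewrite [X in _ + X]big_nat_cond [X in _ + X]big1 ?addr0.
    by rewrite big_mkord; apply: eq_bigr => s _; rewrite /y ltn_ord.
  by move=> s /andP[/andP[Ls _] _]; rewrite /y ltnNge Ls.
rewrite big_nat_mul.
transitivity (\sum_(0 <= v < L) \sum_(0 <= o < J) y (o + v * J)%N).
  apply: eq_bigr => v _; rewrite -{1}[(v * J)%N]add0n big_addn.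
  by rewrite mulSn addnK.
rewrite exchange_big /= big_mkord; apply: eq_bigr => o _; have oJ := ltn_ord o.
have NL : (class_size L J o <= L)%N.
  by rewrite leqNgt class_sizeP // -leqNgt; have := leq_pmulr L J0; lia.
rewrite big_mkord (big_ord_widen L (fun v => x (o + v * J)%N) NL) [RHS]big_mkcond /=.
by apply: eq_bigr => v _; rewrite class_sizeP //.
Qed.

Lemma Q_hyperbola n : Q n `<=` [set k : int * int | (`|k.1| * `|k.2| < 2 ^ n)%N].
Proof.
move=> k [[s1 s2] s12 [/andP[_ k1] /andP[_ k2]]] /=; have {}s12 : (s1 + s2 <= n)%N by [].
apply: leq_trans (_ : 2 ^ s1 * 2 ^ s2 <= _)%N; last by rewrite -expnD leq_exp2l.
by apply: ltn_mul.
Qed.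

Lemma le_gsum G (f g : nat * nat -> R) :
  (forall i, (i.1 < G.1)%N -> (i.2 < G.2)%N -> f i <= g i) -> gsum G f <= gsum G g.
Proof. by move=> fg; apply: ler_sum => i _; apply: ler_sum => j _; apply: fg => /=. Qed.

Lemma gsumZ G c (f : nat * nat -> R) : gsum G (fun i => c * f i) = c * gsum G f.
Proof. by rewrite /gsum mulr_sumr; apply: eq_bigr => i _; rewrite mulr_sumr. Qed.

Lemma norm_gsum G (f : nat * nat -> R) : `|gsum G f| <= gsum G (fun i => `|f i|).
Proof.
by apply: le_trans (ler_norm_sum _ _ _) _; apply: ler_sum => i _; exact: ler_norm_sum.
Qed.

Lemma tp_gsum K G (c : nat * nat -> R) (F : nat * nat -> plane -> R) :
  (forall i, tp K (F i)) -> tp K (fun x => gsum G (fun i => c i * F i x)).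
Proof. by move=> tF; apply: tp_sum => i _; apply: tp_sum => j _; exact: tpZ. Qed.

Definition lpair (l s : nat) : nat * nat := (s, (l - s)%N).

(** Test function dual to the l_1 norm of the samples of block s: by [gsum_Asample] it is bounded by
    1, and its pairing with u is that norm divided by 16. *)
Definition sgn_sample (s : nat * nat) (u : plane -> R) : plane -> R :=
  fun y => gsum (grid2 s) (fun i => (16^-1 * (npts R s)^-1 * Num.sg (lam s i u)) * Asample s i y).

Lemma sgn_sample_le s u y : `|sgn_sample s u y| <= 1.
Proof.
apply: le_trans (norm_gsum _ _) _.
apply: (@le_trans _ _ (gsum (grid2 s) (fun i => (16^-1 * (npts R s)^-1) * `|Asample s i y|))).
  apply: le_gsum => i _ _; rewrite normrM ler_wpM2r // normrM.
  have n0 := npts_gt0 R s.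
  rewrite ger0_norm ?mulr_ge0 ?invr_ge0 ?(ltW n0) // -[leRHS]mulr1 ler_wpM2l //.
    by rewrite mulr_ge0 ?invr_ge0 ?(ltW n0).
  by rewrite normr_sg; case: (_ != 0).
rewrite gsumZ -invfM mulrC ler_pdivrMr ?mul1r ?gsum_Asample //.
by rewrite mulr_gt0 ?npts_gt0.
Qed.

Lemma mean_sgn_sample s u : nice u ->
  mean (fun x => u x * sgn_sample s u x) = 16^-1 * gsum (grid2 s) (fun i => `|lam s i u|).
Proof.
move=> nu; have nA i := nice_Asample R s i.
transitivity (mean (fun x => gsum (grid2 s) (fun i =>
    (16^-1 * (npts R s)^-1 * Num.sg (lam s i u)) * (u x * Asample s i x)))).
  congr mean; apply/funext => x; rewrite /sgn_sample -gsumZ.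
  by apply: eq_bigr => i _; apply: eq_bigr => j _; ring.
rewrite -gsumZ /gsum mean_sum => [|i _]; last first.
  by apply: nice_sum => j _; apply: niceZ; exact: niceM.
apply: eq_bigr => i _; rewrite mean_sum => [|j _]; last by apply: niceZ; exact: niceM.
apply: eq_bigr => j _; rewrite meanZ; last exact: niceM.
by rewrite normrEsg /lam; ring.
Qed.

(** A Riesz product of the functions [sgn_sample], with a_v = 2^(o+vJ) and b_v = 2^(l-o-vJ).
    Neighbours satisfy a_(v+1) b_v = 2^(l+J), which must reach 16 * 2^n for the products to leave
    the cross; hence a spacing that grows with n - l. *)
Lemma class_lam_sum n l J o (u : plane -> R) : (l <= n)%N -> (n - l + 5 <= J)%N -> (o < J)%N ->
  tp (Q n) u -> \sum_(v < class_size l.+1 J o)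
    gsum (grid2 (lpair l (o + v * J))) (fun i => `|lam (lpair l (o + v * J)) i u|) <=
  32 * Num.sqrt (2 * n.+1%:R) * mean (fun x => `|u x|).
Proof.
move=> ln nJ oJ tu; have nu := tp_nice tu.
set N := class_size _ _ _; pose s v := lpair l (o + v * J).
have sl v : (v < N)%N -> (o + v * J <= l)%N by rewrite class_sizeP.
have J1 : (32 <= 2 ^ J)%N by rewrite -[32%N]/(2 ^ 5)%N leq_exp2l //; lia.
have := @riesz_bound R N (2 ^ n) (fun v => 2 ^ (o + v * J))%N (fun v => 2 ^ (l - (o + v * J)))%N.
move=> /(_ _ _ _ (fun v => sgn_sample (s v) u) u) B.
have {B} : `|mean (fun x => u x * \sum_(v < N) sgn_sample (s v) u x)| <=
    2 * Num.sqrt (2 * N%:R) * mean (fun x => `|u x|).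
  apply: B.
  - move=> v _; change (32 * 2 ^ (o + v * J) <= 2 ^ (o + v.+1 * J))%N.
    by rewrite (mulSn v) addnCA (expnD 2 J) leq_mul2r J1 orbT.
  - move=> v /sl; change ((o + v.+1 * J <= l)%N ->
      (32 * 2 ^ (l - (o + v.+1 * J)) <= 2 ^ (l - (o + v * J)))%N); rewrite (mulSn v) => h.
    have -> : (l - (o + v * J) = (l - (o + (J + v * J))) + J)%N by lia.
    by rewrite (expnD 2 _ J) [(_ * 2 ^ J)%N]mulnC leq_mul2r J1 orbT.
  - move=> v /sl; change ((o + v.+1 * J <= l)%N ->
      (16 * 2 ^ n <= 2 ^ (o + v.+1 * J) * 2 ^ (l - (o + v * J)))%N); rewrite (mulSn v) => h.
    rewrite -expnD -[16%N]/(2 ^ 4)%N -expnD leq_exp2l //; lia.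
  - move=> v vN; apply: tp_sub (@tp_gsum (aband (s v)) _ _ _ _) => [k [k1 k2 k3 k4]|i]; last exact: tp_Asample.
    split => //.
    + by move=> v0; apply: k3 => /=; rewrite addn_gt0 muln_gt0 v0; lia.
    + by move=> /sl; rewrite (mulSn v) => h; apply: k4 => /=; lia.
  - by move=> v x _; exact: sgn_sample_le.
  - exact: tp_sub (@Q_hyperbola n) tu.
have E : mean (fun x => u x * \sum_(v < N) sgn_sample (s v) u x) =
    16^-1 * \sum_(v < N) gsum (grid2 (s v)) (fun i => `|lam (s v) i u|).
  rewrite mulr_sumr; under eq_bigr do rewrite -mean_sgn_sample //.
  rewrite -mean_sum => [|v _].
    by congr mean; apply/funext => x; rewrite mulr_sumr.
  apply: niceM => //; apply: (@tp_nice _ (aband (s v))); apply: tp_gsum => i; exact: tp_Asample.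
have S0 : 0 <= \sum_(v < N) gsum (grid2 (s v)) (fun i => `|lam (s v) i u|).
  by rewrite sumr_ge0 // => v _; rewrite sumr_ge0 // => i _; rewrite sumr_ge0.
rewrite E ger0_norm ?mulr_ge0 // => h.
have NL : (N <= n.+1)%N.
  by rewrite leqNgt class_sizeP // -leqNgt; have J0 : (0 < J)%N; [lia|have := leq_pmulr n.+1 J0; lia].
have sq : Num.sqrt (2 * N%:R) <= Num.sqrt (2 * n.+1%:R) :> R.
  by rewrite ler_sqrt ?mulr_ge0 // ler_wpM2l // ler_nat.
have m0 : 0 <= mean (fun x => `|u x|) by exact: mean_ge0.
have := ler_wpM2r m0 sq; lra.
Qed.

Lemma layer_lam_sum n l J (u : plane -> R) : (l <= n)%N -> (n - l + 5 <= J)%N ->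
  tp (Q n) u -> \sum_(s < l.+1) gsum (grid2 (lpair l s)) (fun i => `|lam (lpair l s) i u|) <=
  J%:R * (32 * Num.sqrt (2 * n.+1%:R) * mean (fun x => `|u x|)).
Proof.
move=> ln nJ tu.
rewrite (sum_residues (fun s => gsum (grid2 (lpair l s)) (fun i => `|lam (lpair l s) i u|)) _ (J := J));
  last by lia.
rewrite mulr_natl -[X in _ <= _ *+ X](card_ord J) -sumr_const.
by apply: ler_sum => o _; exact: class_lam_sum.
Qed.

End LayerBounds.

(** * Moments of one synthesized layer *)

Section MomentBound.
Variable R : realType.
Local Notation plane := (measurableTypeR R * measurableTypeR R)%type.

(** The power lies above its tangent at A; averaged over the weights with A their mean, this gives
    [weighted_power_mean]. *)
Lemma power_tangent (x A : R) m : 0 <= x -> 0 <= A ->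
  A ^+ m + m%:R * A ^+ m.-1 * (x - A) <= x ^+ m.
Proof.
move=> x0 A0; elim: m => [|m ih]; first by rewrite !expr0 !mul0r addr0.
rewrite [leRHS]exprS; apply: le_trans (ler_wpM2l x0 ih); rewrite /= -natr1.
case: m {ih} => [|m] /=; first by rewrite !expr0 expr1; lra.
rewrite -subr_ge0.
have -> : x * (A ^+ m.+1 + m.+1%:R * A ^+ m * (x - A)) -
    (A ^+ m.+2 + (m.+1%:R + 1) * A ^+ m.+1 * (x - A)) = m.+1%:R * A ^+ m * (x - A) ^+ 2.
  by rewrite !exprS; ring.
by rewrite mulr_ge0 ?sqr_ge0 // mulr_ge0 // exprn_ge0.
Qed.

Lemma weighted_power_mean (I : finType) (p G : I -> R) q : (forall i, 0 <= p i) ->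
  (\sum_i p i * G i) ^+ (2 * q.+1) <=
  (\sum_i p i) ^+ (2 * q.+1).-1 * \sum_i p i * G i ^+ (2 * q.+1).
Proof.
move=> p0; set P := \sum_i p i; have P0 : 0 <= P by exact: sumr_ge0.
have [m Em] : exists m, (2 * q.+1 = m.+1)%N by exists (2 * q).+1; lia.
pose x i := `|G i|.
have Gx i : G i ^+ (2 * q.+1) = x i ^+ m.+1 by rewrite -Em !exprM /x real_normK ?num_real.
pose S := \sum_i p i * x i.
have S0 : 0 <= S by apply: sumr_ge0 => i _; rewrite mulr_ge0 // /x.
apply: (@le_trans _ _ (S ^+ m.+1)).
  rewrite Em -Em !exprM lerXn2r ?nnegrE ?sqr_ge0 // -[leLHS]real_normK ?num_real //.
  rewrite lerXn2r ?nnegrE //; apply: le_trans (ler_norm_sum _ _ _) _.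
  by apply: ler_sum => i _; rewrite normrM ger0_norm.
rewrite Em /= (eq_bigr (fun i => p i * x i ^+ m.+1)); last by move=> i _; rewrite -Em Gx Em.
have [Pz|Pz] := eqVneq P 0.
  have pz i : p i = 0.
    have : p i <= P by rewrite /P (bigD1 i) //= lerDl; exact: sumr_ge0.
    by rewrite Pz => pi0; apply/eqP; rewrite eq_le pi0 p0.
  rewrite /S big1 ?expr0n => [|i _]; last by rewrite pz mul0r.
  by rewrite mulr_ge0 ?exprn_ge0 // sumr_ge0 // => i _; rewrite pz mul0r.
have Pp : 0 < P by rewrite lt0r Pz.
pose A := S / P; have A0 : 0 <= A by rewrite divr_ge0.
have : P * A ^+ m.+1 <= \sum_i p i * x i ^+ m.+1.
  have : \sum_i p i * (A ^+ m.+1 + m.+1%:R * A ^+ m * (x i - A)) <= \sum_i p i * x i ^+ m.+1.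
    by apply: ler_sum => i _; rewrite ler_wpM2l //; apply: power_tangent => //; exact: normr_ge0.
  have -> // : \sum_i p i * (A ^+ m.+1 + m.+1%:R * A ^+ m * (x i - A)) = P * A ^+ m.+1.
  rewrite (eq_bigr (fun i => p i * (A ^+ m.+1 - m.+1%:R * A ^+ m * A) +
    (p i * x i) * (m.+1%:R * A ^+ m))); last by move=> i _; ring.
  rewrite big_split /= -!mulr_suml -/P -/S.
  have -> : S = P * A by rewrite /A mulrCA divff // mulr1.
  ring.
move=> /(ler_wpM2l (exprn_ge0 m P0)); apply: le_trans.
by rewrite mulrA -exprSr /A -exprMn mulrCA divff // mulr1.
Qed.

Lemma nptsE l s : (s <= l)%N -> npts R (lpair l s) = 2 ^+ (l + 10).
Proof.
move=> sl; rewrite /npts /grid /= -expnD natrX; congr (_ ^+ _); lia.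
Qed.

(** The contribution of block s to the formula of [reconstruct]. *)
Definition synth (s : nat * nat) (u : plane -> R) : plane -> R :=
  fun x => gsum (grid2 s) (fun i => lam s i u * Bsample s i x).

Lemma synth_le s u H x : 0 <= H ->
  (forall i, (i.1 < grid s.1)%N -> (i.2 < grid s.2)%N -> `|lam s i u| <= H) -> `|synth s u x| <= H * (16 * npts R s).
Proof.
move=> H0 lH; apply: le_trans (norm_gsum _ _) _.
apply: (@le_trans _ _ (gsum (grid2 s) (fun i => H * `|Bsample s i x|))).
  by apply: le_gsum => i i1 i2; rewrite normrM ler_wpM2r // lH.
by rewrite gsumZ ler_wpM2l ?gsum_Bsample.
Qed.

Lemma tp_synth s u : tp (bband s) (synth s u).
Proof. by apply: tp_gsum => i; exact: tp_Bsample. Qed.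

Lemma class_moment r l J o H (u : plane -> R) : (192 * r.+1 < 2 ^ J)%N -> (o < J)%N -> 0 <= H ->
  (forall s i, (s <= l)%N -> (i.1 < grid s)%N -> (i.2 < grid (l - s))%N -> `|lam (lpair l s) i u| <= H) ->
  mean (fun x => (\sum_(v < class_size l.+1 J o) synth (lpair l (o + v * J)) u x) ^+ (2 * r)) <=
  mom_const R r * ((class_size l.+1 J o)%:R ^+ r * (H * (16 * 2 ^+ (l + 10))) ^+ (2 * r)).
Proof.
move=> rJ oJ H0 lH; set N := class_size _ _ _.
have sl v : (v < N)%N -> (o + v * J <= l)%N by rewrite class_sizeP.
have J3 : (2 < J)%N by rewrite -(@ltn_exp2l 2) //; apply: leq_ltn_trans rJ; lia.
apply: (@lacunary_moment R r N (fun v => 2 ^ (o + v * J))%N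
  (fun v => synth (lpair l (o + v * J)) u) (H * (16 * 2 ^+ (l + 10)))) => //.
- move=> v vN; apply: tp_sub (tp_synth _ _) => k [k1 k2]; split => // v0; apply: k2 => /=.
  by rewrite -(prednK v0) mulSn; lia.
- move=> v x vN; have h := sl v vN; rewrite -(nptsE h); apply: synth_le => // i; exact: lH.
- by rewrite mulr_ge0 // mulr_ge0 // exprn_ge0.
- move=> v vN; change (192 * r.+1 * 2 ^ (o + v * J) < 2 ^ (o + v.+1 * J))%N.
  by rewrite (mulSn v) addnCA (expnD 2 J) ltn_pmul2r ?expn_gt0.
Qed.

(** The constant makes 2^J exceed the ratio 192 (r+2) that [class_moment] asks for moments of order
    2 (r+1). *)
Definition spacing (r n l : nat) : nat := (n - l + (192 * r.+2 + 5))%N.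

(** A block has 2^(l+10) points, so samples of size w / (2^l sqrt(n+1)) synthesize a function of
    size at most 16 * 2^10 w / sqrt(n+1). The at most n + 1 lacunary terms of a class bring back
    only the factor sqrt(n+1), and the J classes are added by the power mean inequality. *)
Lemma layer_moment r n l (w : R) (u : plane -> R) : (l <= n)%N -> 0 <= w ->
  (forall s i, (s <= l)%N -> (i.1 < grid s)%N -> (i.2 < grid (l - s))%N -> `|lam (lpair l s) i u| <=
     w / (2 ^+ l * Num.sqrt n.+1%:R)) ->
  mean (fun x => (\sum_(s < l.+1) synth (lpair l s) u x) ^+ (2 * r.+1)) <=
  mom_const R r.+1 * ((spacing r n l)%:R * 2 ^+ 14 * w) ^+ (2 * r.+1).
Proof.
move=> ln w0 lH; set J := spacing r n l; set q := r.+1; set C := mom_const R q.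
have J0 : (0 < J)%N by rewrite /J /spacing; lia.
have rJ : (192 * q.+1 < 2 ^ J)%N.
  by apply: leq_ltn_trans (ltn_expl J (isT : 1 < 2)%N); rewrite /J /spacing /q; lia.
have sn0 : 0 < Num.sqrt n.+1%:R :> R by rewrite sqrtr_gt0.
have C0 : 0 <= C by exact: mom_const_ge0.
set H := w / _ in lH; have H0 : 0 <= H by rewrite divr_ge0 // mulr_ge0 // ?exprn_ge0 // ltW.
pose F (o : 'I_J) x := \sum_(v < class_size l.+1 J o) synth (lpair l (o + v * J)) u x.
have nF o : nice (F o) by apply: nice_sum => v _; exact: tp_nice (tp_synth _ _).
have mF o : mean (fun x => F o x ^+ (2 * q)) <= C * (2 ^+ 14 * w) ^+ (2 * q).
  apply: le_trans (class_moment rJ (ltn_ord o) H0 lH) _.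
  rewrite ler_wpM2l //; set N := class_size _ _ _.
  have NL : (N <= n.+1)%N.
    by rewrite leqNgt class_sizeP // -leqNgt; have := leq_pmulr n.+1 J0; lia.
  apply: (@le_trans _ _ (n.+1%:R ^+ q * (H * (16 * 2 ^+ (l + 10))) ^+ (2 * q))).
    apply: ler_wpM2r.
      by rewrite exprn_ge0 // mulr_ge0 // mulr_ge0 // exprn_ge0.
    by rewrite lerXn2r ?nnegrE // ler_nat.
  rewrite -[n.+1%:R in leLHS](@sqr_sqrtr R) // -exprM -exprMn le_eqVlt; apply/orP; left; apply/eqP.
  congr (_ ^+ _); rewrite /H exprD.
  have -> : 2 ^+ 14 = 16 * 2 ^+ 10 :> R by rewrite -[16]/(16%:R) -!natrX -natrM.
  by field; rewrite (gt_eqF sn0) /= expf_neq0.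
apply: (@le_trans _ _ (mean (fun x => J%:R ^+ (2 * q).-1 * \sum_(o < J) F o x ^+ (2 * q)))).
  apply: le_mean.
  - by apply: niceX; apply: nice_sum => s _; exact: tp_nice (tp_synth _ _).
  - by apply: niceZ; apply: nice_sum => o _; exact: niceX.
  move=> x; rewrite (sum_residues (fun s => synth (lpair l s) u x) _ J0).
  have := @weighted_power_mean 'I_J (fun=> 1) (fun o => F o x) r (fun=> ler01).
  under eq_bigr do rewrite mul1r; rewrite sumr_const card_ord.
  by under [in leRHS]eq_bigr do rewrite mul1r.
rewrite meanZ; last by apply: nice_sum => o _; exact: niceX.
rewrite mean_sum => [|o _]; last exact: niceX.
apply: (@le_trans _ _ (J%:R ^+ (2 * q).-1 * (J%:R * (C * (2 ^+ 14 * w) ^+ (2 * q))))).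
  rewrite ler_wpM2l ?exprn_ge0 // mulr_natl -[X in _ <= _ *+ X](card_ord J) -sumr_const.
  by apply: ler_sum => o _; exact: mF.
rewrite mulrA -exprSr prednK; last by rewrite /q; lia.
by rewrite mulrCA -exprMn mulrA.
Qed.

End MomentBound.

(** * Coding of one block *)

Section Coding.
Variable R : realType.
Local Notation plane := (measurableTypeR R * measurableTypeR R)%type.

Lemma geometric_le (q : R) K : 0 <= q -> q < 1 -> \sum_(j < K) q ^+ j <= (1 - q)^-1.
Proof.
move=> q0 q1; have d0 : 0 < 1 - q by lra.
rewrite -[leRHS]mul1r ler_pdivlMr //.
suff -> : (\sum_(j < K) q ^+ j) * (1 - q) = 1 - q ^+ K by have := exprn_ge0 K q0; lra.
elim: K => [|K ih]; first by rewrite big_ord0 expr0; ring.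
by rewrite big_ord_recr /= mulrDl ih exprS; ring.
Qed.

(* Chernoff's bound: an integer vector z counts with weight (1 + w)^(-|z|). *)
Lemma card_l1_ball (I : finType) (K : nat) (U w : R) : 0 < w ->
  (#|[set f : {ffun I -> 'I_K} | ((\sum_i f i)%N)%:R <= U]|)%:R <=
  expR (U * ln (1 + w) + #|I|%:R * ln (1 + w^-1)).
Proof.
move=> w0; have w1 : 0 < 1 + w by lra.
pose q : R := (1 + w)^-1.
have q0 : 0 < q by rewrite invr_gt0.
have q1 : q < 1 by rewrite invf_lt1 //; lra.
set S := [set f | _].
have qE : q = expR (- ln (1 + w)) by rewrite expRN lnK.
have iw : 0 < w^-1 by rewrite invr_gt0.
have wE : (1 - q)^-1 = 1 + w^-1 by rewrite /q; field; rewrite gt_eqF ?(gt_eqF w1) //; lra.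
have lb : (#|S|)%:R * expR (- (U * ln (1 + w))) <= \sum_(f : {ffun I -> 'I_K}) \prod_i q ^+ f i.
  rewrite mulr_natl -sumr_const big_mkcond; apply: ler_sum => f _.
  have P0 : 0 <= \prod_i q ^+ f i by apply: prodr_ge0 => i _; rewrite exprn_ge0 // ltW.
  case: ifP => // ; rewrite inE => fU.
  have -> : \prod_i q ^+ f i = q ^+ (\sum_i f i) by rewrite prodrXr.
  rewrite qE -expRM_natl ler_expR mulrN lerN2 ler_wpM2r // ln_ge0; lra.
rewrite expRD -ler_pdivrMl ?expR_gt0 // -expRN mulrC; apply: le_trans lb _.
rewrite -(bigA_distr_bigA (fun (i : I) (j : 'I_K) => q ^+ j)) prodr_const.
have -> : expR (#|I|%:R * ln (1 + w^-1)) = (1 + w^-1) ^+ #|I|.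
  by rewrite mulrC expRM_natr lnK // posrE; lra.
rewrite lerXn2r ?nnegrE //.
- by apply: sumr_ge0 => j _; rewrite exprn_ge0 // ltW.
- lra.
- by rewrite -wE; apply: geometric_le => //; exact: ltW.
Qed.

(** Positive and negative parts of lambda / h are rounded down separately, so that codes are
    nonnegative integer vectors counted by [card_l1_ball]. This doubles the number of coordinates
    and leaves an error of at most 1 in each part. *)
Lemma quantize (T : Type) (A : set T) (I : finType) (lambda : T -> I -> R) (h : I -> R) (U w : R) :
  0 < w -> (forall i, 0 < h i) ->
  (forall x, A x -> \sum_i `|lambda x i| / h i <= U) ->
  exists (M : nat) (code : T -> nat),
  [/\ M%:R <= expR (U * ln (1 + w) + (2 * #|I|)%:R * ln (1 + w^-1)),
      forall x, A x -> (code x < M)%N &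
      forall x y, A x -> A y -> code x = code y -> forall i, `|lambda x i - lambda y i| <= 2 * h i].
Proof.
move=> w0 h0 AU.
pose K := (Num.truncn U).+1.
pose val x (p : I * bool) : R := Num.max ((if p.2 then lambda x p.1 else - lambda x p.1) / h p.1) 0.
pose z x : {ffun I * bool -> 'I_K} := [ffun p => inord (Num.truncn (val x p))].
have val0 x p : 0 <= val x p by rewrite le_max lexx orbT.
have valsum x i : val x (i, true) + val x (i, false) = `|lambda x i| / h i.
  rewrite /val /=; have hi : 0 < (h i)^-1 by rewrite invr_gt0.
  have [l0|l0] := lerP 0 (lambda x i).
    rewrite (max_idPl _) ?(max_idPr _) ?addr0 ?ger0_norm //.
      by rewrite mulNr oppr_le0 mulr_ge0 // ltW.
    by rewrite mulr_ge0 // ltW.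
  rewrite (max_idPr _) ?(max_idPl _) ?add0r ?ltr0_norm //.
    by rewrite mulr_ge0 ?oppr_ge0 // ltW.
  by rewrite pmulr_lle0 // ltW.
have tot x : \sum_p val x p = \sum_i `|lambda x i| / h i.
  rewrite (eq_bigr (fun p => val x (p.1, p.2))); last by case.
  rewrite -(pair_bigA _ (fun i b => val x (i, b))) /=; apply: eq_bigr => i _.
  by rewrite -valsum big_bool.
have zE x p : A x -> (z x p : nat) = Num.truncn (val x p).
  move=> Ax; rewrite ffunE inordK // ltnS le_truncn // -[leLHS]addr0.
  by apply: le_trans (AU x Ax); rewrite -tot (bigD1 p) //= lerD2l; apply: sumr_ge0.
pose S := [set f : {ffun I * bool -> 'I_K} | ((\sum_p f p)%N)%:R <= U].
exists #|S|, (fun x => index (z x) (enum S)); split.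
- by have := @card_l1_ball (I * bool)%type K U w w0; rewrite card_prod card_bool mulnC.
- move=> x Ax; rewrite cardE index_mem mem_enum inE.
  apply: le_trans (AU x Ax); rewrite -tot natr_sum; apply: ler_sum => p _.
  by rewrite zE // truncn_le.
- move=> x y Ax Ay xy i.
  have zS u : A u -> z u \in enum S.
    move=> Au; rewrite mem_enum inE; apply: le_trans (AU u Au); rewrite -tot natr_sum.
    by apply: ler_sum => p _; rewrite zE // truncn_le.
  have zxy : z x = z y by rewrite -(nth_index (z x) (zS x Ax)) xy nth_index // zS.
  have close p : `|val x p - val y p| <= 1.
    have /andP[a1 a2] := truncn_itv (val0 x p); have /andP[a3 a4] := truncn_itv (val0 y p).
    rewrite -(zE x p Ax) zxy -natr1 in a1 a2; rewrite -(zE y p Ay) -natr1 in a3 a4.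
    by rewrite ler_norml; apply/andP; split; lra.
  have vd u : lambda u i = h i * (val u (i, true) - val u (i, false)).
    have hi : 0 < (h i)^-1 by rewrite invr_gt0.
    have hn : h i != 0 by rewrite gt_eqF.
    rewrite /val /=; have [l0|l0] := lerP 0 (lambda u i).
      rewrite (max_idPl _) ?(max_idPr _) ?subr0; first by field.
        by rewrite mulNr oppr_le0 mulr_ge0 // ltW.
      by rewrite mulr_ge0 // ltW.
    rewrite (max_idPr _) ?(max_idPl _) ?sub0r; first by field.
      by rewrite mulr_ge0 ?oppr_ge0 // ltW.
    by rewrite pmulr_lle0 // ltW.
  rewrite !vd -mulrBr normrM gtr0_norm // mulrC ler_wpM2r ?(ltW (h0 i)) //.
  have := close (i, true); have := close (i, false).
  rewrite !ler_norml => /andP[? ?] /andP[? ?]; apply/andP; split; lra.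
Qed.

End Coding.

(** * Coding of the real unit ball on a hyperbolic cross *)

Section CrossCoding.
Variable R : realType.
Local Notation plane := (measurableTypeR R * measurableTypeR R)%type.

Lemma arithgeom_le (c m : nat) :
  \sum_(j < m) (j + c)%:R * (3 / 4 : R) ^+ j <= 12 + 4 * c%:R.
Proof.
suff -> : \sum_(j < m) (j + c)%:R * (3 / 4 : R) ^+ j =
    12 + 4 * c%:R - (4 * m%:R + 12 + 4 * c%:R) * (3 / 4) ^+ m.
  by rewrite gerBl mulr_ge0 ?addr_ge0 ?mulr_ge0 // exprn_ge0.
elim: m => [|m ih]; first by rewrite big_ord0 expr0; ring.
by rewrite big_ord_recr /= ih exprS natrD -natr1; field.
Qed.

(** The value of the infinite series of (j + c) (3/4)^j. *)
Definition weight_const (c : nat) : R := 12 + 4 * c%:R.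

Lemma sum_spacing n c : \sum_(l < n.+1) (n - l + c)%:R * (3 / 4 : R) ^+ (n - l) <= weight_const c.
Proof.
rewrite (reindex_inj rev_ord_inj) /=; apply: le_trans (arithgeom_le c n.+1).
by apply: ler_sum => j _; have := ltn_ord j; rewrite ltnS subSS => jn; rewrite subKn.
Qed.

(** The power mean inequality over the layers, with weights equal to the spacing times (3/4)^(n-l);
    the tolerance shrinking with n - l makes these weights summable uniformly in n. *)
Lemma full_moment r n (w : R) (u : plane -> R) : tp (Q n) u -> 0 <= w ->
  (forall l s i, (l <= n)%N -> (s <= l)%N -> (i.1 < grid s)%N -> (i.2 < grid (l - s))%N ->
     `|lam (lpair l s) i u| <=
     w * (3 / 4) ^+ (n - l) / (2 ^+ l * Num.sqrt n.+1%:R)) ->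
  mean (fun x => u x ^+ (2 * r.+1)) <=
  mom_const R r.+1 * (weight_const (192 * r.+2 + 5) * 2 ^+ 14 * w) ^+ (2 * r.+1).
Proof.
move=> tu w0 lH; set q := r.+1; set C := mom_const R q; set W := weight_const _.
have C0 : 0 <= C by exact: mom_const_ge0.
have ev (y : R) : 0 <= y ^+ (2 * q) by rewrite exprM exprn_ge0 // sqr_ge0.
pose p (l : 'I_n.+1) : R := (spacing r n l)%:R * (3 / 4) ^+ (n - l).
have p0 l : 0 < p l.
  by rewrite mulr_gt0 ?exprn_gt0 ?ltr0n /spacing //; lia.
pose F (l : 'I_n.+1) x := \sum_(s < l.+1) synth (lpair l s) u x.
pose G l x := (p l)^-1 * F l x.
have nF l : nice (F l) by apply: nice_sum => v _; exact: tp_nice (tp_synth _ _).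
have nG l : nice (G l) by exact: niceZ.
have uE x : u x = \sum_l p l * G l x.
  rewrite (reconstruct x tu); apply: eq_bigr => l _.
  by rewrite /G mulVKf // gt_eqF.
have mG l : mean (fun x => G l x ^+ (2 * q)) <= C * (2 ^+ 14 * w) ^+ (2 * q).
  have ln : (l <= n)%N by have := ltn_ord l; rewrite ltnS.
  have th0 : 0 <= (3 / 4 : R) ^+ (n - l) by rewrite exprn_ge0.
  have := @layer_moment R r n l (w * (3 / 4) ^+ (n - l)) u ln (mulr_ge0 w0 th0)
    (fun s i sl => lH l s i ln sl).
  rewrite -/(F l) -/q -/C => h.
  have -> : (fun x => G l x ^+ (2 * q)) = (fun x => (p l) ^- (2 * q) * F l x ^+ (2 * q)).
    by apply/funext => x; rewrite /G exprMn exprVn.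
  rewrite meanZ; last exact: niceX.
  have pe : 0 < p l ^+ (2 * q) by rewrite exprn_gt0.
  rewrite mulrC ler_pdivrMr //; apply: le_trans h _.
  rewrite le_eqVlt; apply/orP; left; apply/eqP.
  by rewrite -[RHS]mulrA -[in RHS]exprMn; congr (_ * _ ^+ _); rewrite /p; ring.
have W0 : 0 <= W by rewrite /W /weight_const addr_ge0 // mulr_ge0.
have pW : \sum_l p l <= W by exact: sum_spacing.
have S0 : 0 <= \sum_l p l by apply: sumr_ge0 => l _; exact: ltW.
apply: (@le_trans _ _ (mean (fun x => (\sum_l p l) ^+ (2 * q).-1 * \sum_l p l * G l x ^+ (2 * q)))).
  apply: le_mean.
  - by apply: niceX; exact: tp_nice tu.
  - by apply: niceZ; apply: nice_sum => l _; apply: niceZ; exact: niceX.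
  move=> x; rewrite uE; apply: weighted_power_mean => l; exact: ltW.
rewrite meanZ; last by apply: nice_sum => l _; apply: niceZ; exact: niceX.
rewrite mean_sum => [|l _]; last by apply: niceZ; exact: niceX.
apply: (@le_trans _ _ (W ^+ (2 * q).-1 * (W * (C * (2 ^+ 14 * w) ^+ (2 * q))))); last first.
  rewrite mulrA -exprSr prednK; last by rewrite /q; lia.
  by rewrite mulrCA -exprMn mulrA.
apply: ler_pM.
- by rewrite exprn_ge0.
- apply: sumr_ge0 => l _; apply: mean_ge0 => x; exact: mulr_ge0 (ltW (p0 l)) (ev _).
- by rewrite lerXn2r ?nnegrE.
- apply: (@le_trans _ _ ((\sum_l p l) * (C * (2 ^+ 14 * w) ^+ (2 * q)))).
    rewrite mulr_suml; apply: ler_sum => l _; rewrite meanZ; last exact: niceX.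
    by rewrite ler_wpM2l // ltW.
  by rewrite ler_wpM2r // mulr_ge0 // ev.
Qed.

(** The order of the dimension of T(Q_n). *)
Definition cross_size (n : nat) : R := n.+1%:R * 2 ^+ n.

(** All sample points of all blocks: [p.1] is the layer l and [p.2] the index s. Pairs with s > l
    contribute nothing, their first factor being empty. *)
Definition idx (n : nat) : finType :=
  {p : 'I_n.+1 * 'I_n.+1 &
   ('I_(if (p.2 <= p.1)%N then grid p.2 else 0) * 'I_(grid (p.1 - p.2)))%type}.

Definition idx_val n (p : idx n) : nat * nat * (nat * nat) :=
  ((tag p).1 : nat, (tag p).2 : nat, ((tagged p).1 : nat, (tagged p).2 : nat)).

Lemma sum_idx n (F : nat -> nat -> nat * nat -> R) :
  \sum_(p : idx n) F (idx_val p).1.1 (idx_val p).1.2 (idx_val p).2 =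
  \sum_(l < n.+1) \sum_(s < l.+1) gsum (grid2 (lpair l s)) (F l s).
Proof.
rewrite -(sig_big_dep (I := ('I_n.+1 * 'I_n.+1)%type)
  (J := fun p => ('I_(if (p.2 <= p.1)%N then grid p.2 else 0) * 'I_(grid (p.1 - p.2)))%type)
  xpredT (fun _ _ => true) (fun p i => F p.1 p.2 (i.1 : nat, i.2 : nat))) /=.
rewrite -(pair_bigA _ (fun l s : 'I_n.+1 =>
  \sum_(j : 'I_(if (s <= l)%N then grid s else 0) * 'I_(grid (l - s))) F l s (j.1 : nat, j.2 : nat))) /=.
apply: eq_bigr => l _.
rewrite (big_ord_widen n.+1 (fun s => gsum (grid2 (lpair l s)) (F l s))) //.
rewrite [RHS]big_mkcond; apply: eq_bigr => s _; rewrite ltnS.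
rewrite -(pair_bigA _ (fun (i : 'I_(if (s <= l)%N then grid s else 0)) (j : 'I_(grid (l - s))) =>
  F l s (i : nat, j : nat))) /=.
by case: ifP => // _; rewrite big_ord0.
Qed.

Lemma card_idx n : (#|idx n|)%:R <= 2 ^+ 11 * cross_size n.
Proof.
rewrite -sum1_card natr_sum (@sum_idx n (fun _ _ _ => 1)).
apply: (@le_trans _ _ (\sum_(l < n.+1) n.+1%:R * 2 ^+ (l + 10))).
  apply: ler_sum => l _; rewrite (eq_bigr (fun=> 2 ^+ (l + 10))).
    rewrite sumr_const card_ord -[leLHS]mulr_natl ler_wpM2r ?exprn_ge0 // ler_nat.
    exact: ltn_ord.
  move=> s _; rewrite -(@nptsE R l s); last by have := ltn_ord s; rewrite ltnS.
  by rewrite /gsum !(sumr_const, card_ord) /npts -mulrnA mulnC.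
rewrite -mulr_sumr /cross_size mulrCA ler_wpM2l // exprS -mulrA.
have -> : 2 * (2 ^+ 10 * 2 ^+ n) = 2 ^+ 10 * 2 ^+ n.+1 :> R by rewrite (exprS _ n); ring.
under eq_bigr do rewrite exprD mulrC.
rewrite -mulr_sumr ler_wpM2l ?exprn_ge0 //.
elim: n => [|n ih]; first by rewrite big_ord1 expr0 expr1; lra.
by rewrite big_ord_recr /= [leRHS]exprS; lra.
Qed.

Definition cross_ball (n : nat) : set (plane -> R) :=
  [set u | tp (Q n) u /\ mean (fun x => `|u x|) <= 1].

Lemma coding r : exists C : R, 0 < C /\ forall n (w : R), 0 < w ->
  exists (M : nat) (code : (plane -> R) -> nat),
  [/\ M%:R <= expR (4096 * cross_size n * (ln (1 + w) / w + ln (1 + w^-1))),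
      forall u, cross_ball n u -> (code u < M)%N &
      forall u v, cross_ball n u -> cross_ball n v -> code u = code v ->
        mean (fun x => (u x - v x) ^+ (2 * r.+1)) <= (C * w) ^+ (2 * r.+1)].
Proof.
have m0 : 0 <= mom_const R r.+1 by exact: mom_const_ge0.
have W0 : 0 < weight_const (192 * r.+2 + 5).
  by rewrite /weight_const ltr_wpDr // ?mulr_ge0.
exists ((mom_const R r.+1 + 1) * (weight_const (192 * r.+2 + 5) * 2 ^+ 14)); split.
  by rewrite mulr_gt0 ?mulr_gt0 ?exprn_gt0 //; lra.
move=> n w w0.
have sn0 : 0 < Num.sqrt n.+1%:R :> R by rewrite sqrtr_gt0.
(* Half the tolerance of [full_moment], since [quantize] determines the samples up to twice the
   step. *)
pose h (l : nat) : R := 2^-1 * (w * (3 / 4) ^+ (n - l) / (2 ^+ l * Num.sqrt n.+1%:R)).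
have h0 l : 0 < h l.
  by rewrite mulr_gt0 ?invr_gt0 // divr_gt0 // mulr_gt0 // exprn_gt0.
pose lambda (u : plane -> R) (p : idx n) : R :=
  lam (lpair (idx_val p).1.1 (idx_val p).1.2) (idx_val p).2 u.
have N0 : 0 < cross_size n by rewrite mulr_gt0 // exprn_gt0.
(* Here 4096 = 128 * 32: the value of [weight_const] at 5 is 32, and 128 collects the constant 32 of
   [layer_lam_sum], the bound sqrt 2 <= 2 and the factor 1/2 in h. *)
have bound u : cross_ball n u ->
    \sum_p `|lambda u p| / h (idx_val p).1.1 <= 4096 * cross_size n / w.
  case=> tu u1; rewrite (@sum_idx n (fun l s i => `|lam (lpair l s) i u| / h l)).
  apply: (@le_trans _ _ (\sum_(l < n.+1) (128 * cross_size n / w) * ((n - l + 5)%:R * (3 / 4) ^+ (n - l)))).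
    apply: ler_sum => l _; have ln : (l <= n)%N by have := ltn_ord l; rewrite ltnS.
    have -> : \sum_(s < l.+1) gsum (grid2 (lpair l s)) (fun i => `|lam (lpair l s) i u| / h l) =
        (h l)^-1 * \sum_(s < l.+1) gsum (grid2 (lpair l s)) (fun i => `|lam (lpair l s) i u|).
      rewrite mulr_sumr; apply: eq_bigr => s _; rewrite -gsumZ.
      by apply: eq_bigr => i _; apply: eq_bigr => j _; rewrite mulrC.
    have := layer_lam_sum ln (leqnn (n - l + 5)) tu; set J : R := (n - l + 5)%:R => hl.
    rewrite mulrC ler_pdivrMr //; apply: le_trans hl _.
    have sq2 : Num.sqrt (2 * n.+1%:R) <= 2 * Num.sqrt n.+1%:R :> R.
      rewrite sqrtrM // ler_wpM2r ?sqrtr_ge0 //.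
      have := @sqr_sqrtr R 2 (ler0n _ 2); have := sqrtr_ge0 (2 : R); nra.
    have J0 : 0 <= J by [].
    apply: (@le_trans _ _ (J * (64 * Num.sqrt n.+1%:R))).
      rewrite ler_wpM2l //; have q0 : 0 <= 32 * Num.sqrt (2 * n.+1%:R) :> R.
        by rewrite mulr_ge0 // sqrtr_ge0.
      have := ler_wpM2l q0 u1; lra.
    have -> : cross_size n = Num.sqrt n.+1%:R ^+ 2 * 2 ^+ n by rewrite sqr_sqrtr.
    rewrite /h.
    (* Since 2 * (3/4)^2 = 9/8 >= 1, the factor 2^(n-l) gained on layer l pays for steps finer by
       (3/4)^(n-l) and leaves another (3/4)^(n-l) for the summation over l. *)
    have t9 : (3 / 4 : R) ^+ (n - l) * (3 / 4) ^+ (n - l) * 2 ^+ n >= 2 ^+ l.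
      have -> : 2 ^+ n = 2 ^+ (n - l) * 2 ^+ l :> R by rewrite -exprD subnK.
      rewrite mulrA -!exprMn -[leLHS]mul1r ler_wpM2r ?exprn_ge0 //.
      by apply: exprn_ege1; lra.
    set s := Num.sqrt n.+1%:R in sn0 *; set t := (3 / 4) ^+ (n - l) in t9 *.
    have -> : 128 * (s ^+ 2 * 2 ^+ n) / w * (J * t) * (2^-1 * (w * t / (2 ^+ l * s))) =
        J * (64 * s) * ((t * t * 2 ^+ n) / 2 ^+ l).
      by field; rewrite (gt_eqF sn0) (gt_eqF w0) expf_neq0.
    rewrite -[leLHS]mulr1 ler_wpM2l // ?mulr_ge0 ?(ltW sn0) //.
    by rewrite ler_pdivlMr ?exprn_gt0 // mul1r.
  rewrite -mulr_sumr; have := sum_spacing n 5; rewrite /weight_const => hs.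
  apply: le_trans (ler_wpM2l _ hs) _; first by rewrite divr_ge0 ?mulr_ge0 // ltW.
  rewrite le_eqVlt; apply/orP; left; apply/eqP.
  by field; rewrite gt_eqF.
have [M [code [hM hc hq]]] := quantize w0 (fun p : idx n => h0 (idx_val p).1.1) bound.
exists M, code; split => //.
  apply: le_trans hM _; rewrite ler_expR mulrDr; apply: lerD.
    by rewrite mulrAC -mulrA.
  have iw : 0 < w^-1 by rewrite invr_gt0.
  rewrite ler_wpM2r ?ln_ge0 //; first lra.
  rewrite natrM; have := card_idx n.
  have -> : 4096 = 2 * 2 ^+ 11 :> R by rewrite -exprS -natrX.
  rewrite -mulrA; lra.
move=> u v bu bv cuv; have [tu _] := bu; have [tv _] := bv.
have nu := tp_nice tu; have nv := tp_nice tv.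
have := @full_moment r n w (fun x => u x - v x) (tpB tu tv) (ltW w0).
have hl l s i : (l <= n)%N -> (s <= l)%N ->
    (i.1 < grid s)%N -> (i.2 < grid (l - s))%N ->
    `|lam (lpair l s) i (fun x => u x - v x)| <=
    w * (3 / 4) ^+ (n - l) / (2 ^+ l * Num.sqrt n.+1%:R).
  move=> ln sl i1 i2; rewrite lamB //.
  have l' : (l < n.+1)%N by []. have s' : (s < n.+1)%N by exact: leq_ltn_trans sl l'.
  have i1' : (i.1 < if (Ordinal s' <= Ordinal l')%N then grid (Ordinal s') else 0)%N by rewrite /= sl.
  have i2' : (i.2 < grid (Ordinal l' - Ordinal s'))%N by [].
  pose p : idx n := @Tagged ('I_n.+1 * 'I_n.+1)%type (Ordinal l', Ordinal s')
    (fun p => ('I_(if (p.2 <= p.1)%N then grid p.2 else 0) * 'I_(grid (p.1 - p.2)))%type)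
    (Ordinal i1', Ordinal i2').
  have := hq u v bu bv cuv p; rewrite /lambda /idx_val /= -surjective_pairing /h.
  by rewrite mulrA divff // mul1r.
move=> /(_ hl) hm; apply: le_trans hm _.
set m := mom_const R r.+1 in m0 *; set W := weight_const _ in W0 *.
have E1 : m <= (m + 1) ^+ (2 * r.+1).
  apply: (@le_trans _ _ (m + 1)); first by rewrite lerDl.
  by rewrite -[leLHS]expr1 ler_weXn2l ?lerDr //; lia.
have := ler_wpM2r (exprn_ge0 (2 * r.+1) (mulr_ge0 (mulr_ge0 (ltW W0) (exprn_ge0 14 (ler0n _ 2))) (ltW w0))) E1.
by rewrite -exprMn (mulrA (m + 1) (W * _)).
Qed.

End CrossCoding.

(** * The seminorms of L_p *)

Section Norms.
Variable R : realType.
Local Notation plane := (measurableTypeR R * measurableTypeR R)%type.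
Local Notation mu := (@torus_measure R).
Local Notation func := (plane -> R[i]).

Definition Np (p : R) (g : plane -> R) : \bar R := Lnorm mu p%:E (EFin \o g).

Lemma NpE p g : Np p g = ((\int[mu]_x (`|g x| `^ p)%:E) `^ p^-1)%E.
Proof.
by rewrite /Np unlock; congr (_ `^ _)%E; apply: eq_integral => x _; rewrite /= poweR_EFin.
Qed.

Lemma measurable_power (p : R) (g : plane -> R) : measurable_fun setT g ->
  measurable_fun setT (fun x => `|g x| `^ p).
Proof.
by move=> mg; apply: (measurableT_comp (measurable_powR p)); exact: measurableT_comp.
Qed.

Lemma Np_le p (g h : plane -> R) : 0 < p -> measurable_fun setT g -> measurable_fun setT h ->
  (forall x, `|g x| <= `|h x|) -> (Np p g <= Np p h)%E.
Proof.
move=> p0 mg mh gh; rewrite !NpE; apply: gt0_ler_poweR; first by rewrite invr_ge0 ltW.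
- by rewrite in_itv /= leey andbT; apply: integral_ge0 => x _; rewrite lee_fin powR_ge0.
- by rewrite in_itv /= leey andbT; apply: integral_ge0 => x _; rewrite lee_fin powR_ge0.
apply: ge0_le_integral => //.
- by apply/measurable_EFinP; exact: measurable_power.
- by apply/measurable_EFinP; exact: measurable_power.
- by move=> x _; rewrite lee_fin; apply: ge0_ler_powR; rewrite ?nnegrE // ltW.
Qed.

Lemma nice_power p g : 0 <= p -> nice g -> nice (fun x : plane => `|g x| `^ p).
Proof.
move=> p0 [mg [C gC]]; split; first exact: measurable_power.
exists (`|C| `^ p) => x; rewrite ger0_norm ?powR_ge0 //.
by apply: ge0_ler_powR; rewrite ?nnegrE //; apply: le_trans (gC x) (ler_norm _).
Qed.

Lemma Np_nice p g : 0 < p -> nice g -> Np p g = (mean (fun x => `|g x| `^ p) `^ p^-1)%:E.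
Proof.
move=> p0 ng; rewrite NpE -poweR_EFin; congr (_ `^ _)%E.
rewrite /mean /Rintegral fineK // .
exact: integrable_fin_num (nice_integrable (nice_power (ltW p0) ng)).
Qed.

Lemma Np1_nice g : nice g -> Np 1 g = (mean (fun x => `|g x|))%:E.
Proof.
move=> ng; rewrite Np_nice //; congr (_%:E); rewrite invr1 powRr1.
  by congr mean; apply/funext => x; rewrite powRr1.
by apply: mean_ge0 => x; rewrite powR_ge0.
Qed.

Lemma NpD p (g h : plane -> R) : 1 <= p -> measurable_fun setT g -> measurable_fun setT h ->
  (Np p (fun x => (g x + h x)%R) <= Np p g + Np p h)%E.
Proof. by move=> p1 mg mh; exact: minkowski_EFin. Qed.

Lemma normc_sqrt (z : R[i]) : ComplexField.Normc.normc z = Num.sqrt (complex.Re z ^+ 2 + complex.Im z ^+ 2).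
Proof. by case: z. Qed.

Lemma normc_ge0 (z : R[i]) : 0 <= ComplexField.Normc.normc z.
Proof. by rewrite normc_sqrt sqrtr_ge0. Qed.

Lemma Re_le_normc (z : R[i]) : `|complex.Re z| <= ComplexField.Normc.normc z.
Proof.
rewrite normc_sqrt -sqrtr_sqr ler_sqrt ?addr_ge0 ?sqr_ge0 //.
by rewrite lerDl sqr_ge0.
Qed.

Lemma Im_le_normc (z : R[i]) : `|complex.Im z| <= ComplexField.Normc.normc z.
Proof.
rewrite normc_sqrt -sqrtr_sqr ler_sqrt ?addr_ge0 ?sqr_ge0 //.
by rewrite lerDr sqr_ge0.
Qed.

Lemma normc_le_ReIm (z : R[i]) : ComplexField.Normc.normc z <= `|complex.Re z| + `|complex.Im z|.
Proof.
rewrite normc_sqrt -[leRHS]ger0_norm ?addr_ge0 // -sqrtr_sqr ler_sqrt ?sqr_ge0 //.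
rewrite -[X in X + _](real_normK (num_real _)) -[X in _ + X <= _](real_normK (num_real _)).
have := mulr_ge0 (normr_ge0 (complex.Re z)) (normr_ge0 (complex.Im z)); nra.
Qed.

Lemma measurable_normc (f : func) : cmeasurable f ->
  measurable_fun setT (fun x => ComplexField.Normc.normc (f x)).
Proof.
move=> [mR mI]; under eq_fun do rewrite normc_sqrt.
apply: (@measurableT_comp _ _ _ _ _ _ (@Num.sqrt R)).
  by apply: continuous_measurable_fun; exact: sqrt_continuous.
by apply: measurable_funD; exact: measurable_funX.
Qed.

Lemma normLE p (f : func) : normL p%:E f = Np p (fun x => ComplexField.Normc.normc (f x)).
Proof. by []. Qed.

Lemma Np_Re p (f : func) : 0 < p -> cmeasurable f -> (Np p (fun x => complex.Re (f x)) <= normL p%:E f)%E.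
Proof.
move=> p0 mf; rewrite normLE; apply: Np_le => //; [by case: mf|exact: measurable_normc|].
by move=> x; rewrite [leRHS]ger0_norm ?normc_ge0 // Re_le_normc.
Qed.

Lemma Np_Im p (f : func) : 0 < p -> cmeasurable f -> (Np p (fun x => complex.Im (f x)) <= normL p%:E f)%E.
Proof.
move=> p0 mf; rewrite normLE; apply: Np_le => //; [by case: mf|exact: measurable_normc|].
by move=> x; rewrite [leRHS]ger0_norm ?normc_ge0 // Im_le_normc.
Qed.

Lemma Np_norm p g : Np p (fun x => `|g x|) = Np p g.
Proof. by rewrite !NpE; under eq_integral do rewrite normr_id. Qed.

Lemma normL_le_ReIm p (f : func) : 1 <= p -> cmeasurable f ->
  (normL p%:E f <= Np p (fun x => complex.Re (f x)) + Np p (fun x => complex.Im (f x)))%E.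
Proof.
move=> p1 mf; have p0 : 0 < p by lra.
have [mR mI] := mf.
rewrite normLE -(Np_norm p (fun x => complex.Re (f x))) -(Np_norm p (fun x => complex.Im (f x))).
apply: le_trans (NpD p1 _ _); [|exact: measurableT_comp..].
apply: Np_le => //; [exact: measurable_normc|by apply: measurable_funD; exact: measurableT_comp|].
move=> x; rewrite ger0_norm ?normc_ge0 // ger0_norm ?addr_ge0 //.
exact: normc_le_ReIm.
Qed.

Lemma normL_le p (f g : func) : 0 < p -> cmeasurable f -> cmeasurable g ->
  (forall x, ComplexField.Normc.normc (f x) <= ComplexField.Normc.normc (g x)) ->
  (normL p%:E f <= normL p%:E g)%E.
Proof.
move=> p0 mf mg fg; rewrite !normLE; apply: Np_le => //; try exact: measurable_normc.
by move=> x; rewrite !ger0_norm ?normc_ge0.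
Qed.

Lemma cmeasurableD (f g : func) : cmeasurable f -> cmeasurable g -> cmeasurable (fun x => f x + g x).
Proof.
move=> [f1 f2] [g1 g2]; split.
  have -> : (fun x => complex.Re (f x + g x)) = (fun x => complex.Re (f x) + complex.Re (g x)).
    by apply/funext => x; case: (f x); case: (g x).
  exact: measurable_funD.
have -> : (fun x => complex.Im (f x + g x)) = (fun x => complex.Im (f x) + complex.Im (g x)).
  by apply/funext => x; case: (f x); case: (g x).
exact: measurable_funD.
Qed.

Lemma cmeasurableN (f : func) : cmeasurable f -> cmeasurable (fun x => - f x).
Proof.
move=> [f1 f2]; split.
  have -> : (fun x => complex.Re (- f x)) = (fun x => - complex.Re (f x)).
    by apply/funext => x; case: (f x).
  exact: measurableT_comp.
have -> : (fun x => complex.Im (- f x)) = (fun x => - complex.Im (f x)).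
  by apply/funext => x; case: (f x).
exact: measurableT_comp.
Qed.

Lemma cmeasurableB (f g : func) : cmeasurable f -> cmeasurable g -> cmeasurable (fun x => f x - g x).
Proof. by move=> mf mg; apply: cmeasurableD => //; exact: cmeasurableN. Qed.

Lemma normLD p (f g : func) : 1 <= p -> cmeasurable f -> cmeasurable g ->
  (normL p%:E (fun x => (f x + g x)%R) <= normL p%:E f + normL p%:E g)%E.
Proof.
move=> p1 mf mg; have p0 : 0 < p by lra.
rewrite !normLE; apply: le_trans (NpD p1 _ _); try exact: measurable_normc.
apply: Np_le => //.
- by apply: measurable_normc; exact: cmeasurableD.
- by apply: measurable_funD; exact: measurable_normc.
move=> x; rewrite !ger0_norm ?addr_ge0 ?normc_ge0 //.
exact: le_normcD.
Qed.

Lemma normLN p (f : func) : normL p%:E (fun x => - f x) = normL p%:E f.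
Proof.
rewrite !normLE; congr (Np p _); apply/funext => x.
by rewrite !normc_sqrt; case: (f x) => u v /=; rewrite !sqrrN.
Qed.

Lemma normLB p (f g : func) : 1 <= p -> cmeasurable f -> cmeasurable g ->
  (normL p%:E (fun x => (f x - g x)%R) <= normL p%:E f + normL p%:E g)%E.
Proof.
move=> p1 mf mg; apply: le_trans (normLD p1 mf (cmeasurableN mg)) _.
by rewrite normLN.
Qed.

Lemma Np1_le p (g : plane -> R) : 1 <= p -> measurable_fun setT g -> (Np 1 g <= Np p g)%E.
Proof.
rewrite le_eqVlt => /predU1P[<- //|p1] mg.
have q0 : 0 < 1 - p^-1 by rewrite subr_gt0 invf_lt1; lra.
have p0 : 0 < p by lra.
have := @hoelder _ plane R mu g (fun=> 1) p (1 - p^-1)^-1 mg (measurable_cst _) p0.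
rewrite invr_gt0 invrK [p^-1 + _]addrC subrK => /(_ q0 erefl).
have -> : EFin \o (g \* (fun=> 1)) = EFin \o g by apply/funext => x /=; rewrite mulr1.
rewrite (_ : (EFin \o (fun=> 1)) = cst 1%E) // Lnorm_cst1 torus_measureT poweR1r mule1.
by [].
Qed.

Lemma normL1_le p (f : func) : 1 <= p -> cmeasurable f -> (normL 1 f <= normL p%:E f)%E.
Proof. by move=> p1 mf; apply: Np1_le => //; exact: measurable_normc. Qed.

(* Chebyshev splitting at height T. *)
Lemma power_interpolation (y T p : R) (m : nat) : 0 <= y -> 0 < T -> 1 <= p -> p <= m%:R ->
  y `^ p <= T `^ (p - 1) * y + T `^ (p - m%:R) * y ^+ m.
Proof.
move=> y0 T0 p1 pm; have p0 : 0 < p by lra.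
have [->|yn] := eqVneq y 0.
  rewrite powR0 ?gt_eqF // mulr0 add0r mulr_ge0 ?powR_ge0 // exprn_ge0 //.
have yp : 0 < y by rewrite lt0r yn.
have [yT|Ty] := leP y T.
  rewrite -[leLHS]addr0; apply: lerD; last by rewrite mulr_ge0 ?powR_ge0 ?exprn_ge0.
  rewrite -(mulr_powRB1 y0 p0) mulrC ler_wpM2r //.
  by apply: ge0_ler_powR; rewrite ?nnegrE ?subr_ge0 // ltW.
rewrite -[leLHS]add0r; apply: lerD; first by rewrite mulr_ge0 ?powR_ge0.
have -> : y `^ p = y `^ (p - m%:R) * y ^+ m.
  by rewrite -powR_mulrn // -powRD ?subrK // yn implybT.
rewrite ler_wpM2r ?exprn_ge0 //.
rewrite -(opprB m%:R p) !powRN lef_pV2 ?posrE ?powR_gt0 //.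
by apply: ge0_ler_powR; rewrite ?nnegrE ?subr_ge0 // ltW.
Qed.

End Norms.

(** * From convergence in L_1 to bounds in L_p *)

Section Limits.
Variable R : realType.
Local Notation plane := (measurableTypeR R * measurableTypeR R)%type.
Local Notation mu := (@torus_measure R).
Local Notation func := (plane -> R[i]).

Lemma poweRVK (x : \bar R) p : 0 < p -> (0 <= x)%E -> ((x `^ p^-1) `^ p = x)%E.
Proof. by move=> p0 x0; rewrite -poweRrM mulVf ?gt_eqF // poweRe1. Qed.

Lemma Np_le_int p (g : plane -> R) e : 0 < p -> 0 <= e ->
  (\int[mu]_x (`|g x| `^ p)%:E <= (e `^ p)%:E)%E -> (Np p g <= e%:E)%E.
Proof.
move=> p0 e0 h; rewrite NpE; set I := (\int[mu]_x _)%E in h *.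
have I0 : (0 <= I)%E by apply: integral_ge0 => x _; rewrite lee_fin powR_ge0.
have iv (y : \bar R) : (0 <= y)%E -> (y \in `[0%E, +oo%E])%R by rewrite in_itv /= leey andbT.
have -> : e%:E = ((e `^ p)%:E `^ p^-1)%E.
  by rewrite poweR_EFin -powRrM divff ?gt_eqF // powRr1.
apply: gt0_ler_poweR; rewrite ?invr_ge0 ?(ltW p0) //; apply: iv => //.
by rewrite lee_fin powR_ge0.
Qed.

Lemma int_le_Np p (g : plane -> R) e : 0 < p -> 0 <= e ->
  (Np p g <= e%:E)%E -> (\int[mu]_x (`|g x| `^ p)%:E <= (e `^ p)%:E)%E.
Proof.
move=> p0 e0; rewrite NpE; set I := (\int[mu]_x _)%E => h.
have I0 : (0 <= I)%E by apply: integral_ge0 => x _; rewrite lee_fin powR_ge0.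
have iv (y : \bar R) : (0 <= y)%E -> (y \in `[0%E, +oo%E])%R by rewrite in_itv /= leey andbT.
rewrite -(poweRVK p0 I0) -poweR_EFin; apply: gt0_ler_poweR => //; first exact: ltW.
  by apply: iv; exact: poweR_ge0.
by apply: iv; rewrite lee_fin.
Qed.

(** The inequality min(g, T)^p <= T^(p-1) g turns smallness in L_1 into smallness in L_p for
    truncated functions. *)
Lemma trunc_le p (g : plane -> R) (T e : R) : 1 <= p -> 0 < T -> measurable_fun setT g ->
  (forall x, 0 <= g x) -> 0 <= e ->
  (\int[mu]_x (g x)%:E <= (e `^ p / T `^ (p - 1))%:E)%E ->
  (Np p (fun x => Num.min (g x) T) <= e%:E)%E.
Proof.
move=> p1 T0 mg g0 e0 h; have p0 : 0 < p by lra.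
have m0 x : 0 <= Num.min (g x) T by rewrite le_min g0 ltW.
apply: Np_le_int => //.
have mm : measurable_fun setT (fun x => Num.min (g x) T).
  by apply: measurable_minr => //; exact: measurable_cst.
apply: (@le_trans _ _ (\int[mu]_x (T `^ (p - 1) * g x)%:E)%E).
  apply: ge0_le_integral => //.
  - by apply/measurable_EFinP; exact: measurable_power.
  - by apply/measurable_EFinP; apply: measurable_funM => //; exact: measurable_cst.
  move=> x _; rewrite lee_fin ger0_norm //.
  rewrite -(mulr_powRB1 (m0 x) p0) mulrC; apply: ler_pM; rewrite ?powR_ge0 //.
    by apply: ge0_ler_powR; rewrite ?nnegrE ?subr_ge0 ?ge_min ?lexx ?orbT ?(ltW T0).
  by rewrite ge_min lexx.
under eq_integral do rewrite EFinM.
rewrite ge0_integralZl //; last 3 first.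
- by apply/measurable_EFinP.
- by move=> x _; rewrite lee_fin.
- by rewrite lee_fin powR_ge0.
apply: le_trans (lee_wpmul2l _ h) _; first by rewrite lee_fin powR_ge0.
by rewrite -EFinM lee_fin mulrCA divff ?mulr1 // gt_eqF // powR_gt0.
Qed.

(** The truncation of |h| at height T is at most |S N| plus the truncation of |h - S N|, which
    [trunc_le] makes small in L_p; monotone convergence then lets T tend to infinity. This avoids
    extracting an almost everywhere convergent subsequence. *)
Lemma Lp_limit p e (h : func) (S : nat -> func) : 1 <= p -> 0 <= e ->
  cmeasurable h -> (forall N, cmeasurable (S N)) ->
  (normL 1 (fun x => h x - S N x)%R @[N --> \oo] --> 0%E)%E ->
  (forall N, (normL p%:E (S N) <= e%:E)%E) -> (normL p%:E h <= e%:E)%E.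
Proof.
move=> p1 e0 mh mS cS bS; have p0 : 0 < p by lra.
pose H x := ComplexField.Normc.normc (h x).
have mH : measurable_fun setT H := measurable_normc mh.
have H0 x : 0 <= H x by exact: normc_ge0.
have trunc (T : R) : 0 < T -> (Np p (fun x => Num.min (H x) T) <= e%:E)%E.
  move=> T0; apply/lee_addgt0Pr => d d0.
  (* The L_1 distance that [trunc_le] converts into an L_p distance d at height T. *)
  pose c := d `^ p / T `^ (p - 1).
  have c0 : 0 < c by rewrite divr_gt0 // powR_gt0.
  have [N hN] : exists N : nat, (normL 1 (fun x => (h x - S N x)%R) < c%:E)%E.
    have /fine_cvgP[F1 F2] := cS.
    have F3 : \forall N \near \oo, fine (normL 1 (fun x => h x - S N x)) < c.
      by move/cvgr_lt : F2; apply.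
    near \oo => N; exists N.
    have FN : normL 1 (fun x => h x - S N x) \is a fin_num by near: N.
    rewrite -(fineK FN) lte_fin; by near: N.
  pose D x := ComplexField.Normc.normc (h x - S N x).
  have mD : measurable_fun setT D by apply: measurable_normc; exact: cmeasurableB.
  have D0 x : 0 <= D x by exact: normc_ge0.
  have mG := measurable_normc (mS N).
  have mDT : measurable_fun setT (fun x => Num.min (D x) T).
    by apply: measurable_minr => //; exact: measurable_cst.
  have : (Np p (fun x => Num.min (H x) T) <=
      Np p (fun x => (ComplexField.Normc.normc (S N x) + Num.min (D x) T)%R))%E.
    apply: Np_le => //.
    - by apply: measurable_minr => //; exact: measurable_cst.
    - exact: measurable_funD.
    move=> x; rewrite !ger0_norm ?addr_ge0 ?normc_ge0 ?le_min ?H0 ?D0 ?(ltW T0) //.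
    have HD : H x <= ComplexField.Normc.normc (S N x) + D x.
      rewrite /H /D -{1}[h x](subrK (S N x)) addrC; exact: le_normcD.
    have := normc_ge0 (S N x); have := H0 x; have := D0 x.
    by rewrite minEle minEle; case: ifP; case: ifP; lra.
  move=> /le_trans; apply; apply: le_trans (NpD p1 mG mDT) _.
  apply: leeD; first exact: bS.
  apply: trunc_le => //; first exact: ltW.
  apply: ltW; apply: le_lt_trans hN; rewrite normLE NpE invr1 poweRe1.
    rewrite le_eqVlt; apply/orP; left; apply/eqP; apply: eq_integral => x _.
    by rewrite powRr1 // ger0_norm ?normc_ge0.
  by apply: integral_ge0 => x _; rewrite lee_fin powR_ge0.
rewrite normLE; apply: Np_le_int => //.
pose g (n : nat) x : \bar R := (Num.min (H x) n%:R `^ p)%:E.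
have mn0 n x : 0 <= Num.min (H x) n%:R by rewrite le_min H0 /=.
have mgn n : measurable_fun setT (g n).
  apply/measurable_EFinP; apply: (measurableT_comp (measurable_powR p)).
  by apply: measurable_minr => //; exact: measurable_cst.
have gnd x : {homo g^~ x : n m / (n <= m)%N >-> (n <= m)%E}.
  move=> n m nm; rewrite lee_fin; apply: ge0_ler_powR; rewrite ?nnegrE ?(ltW p0) //.
  by rewrite le_min !ge_min lexx /= ler_nat nm orbT.
have glim x : limn (g^~ x) = (`|H x| `^ p)%:E.
  apply/cvg_lim => //; apply: cvg_near_cst.
  near=> n; rewrite /g ger0_norm //; congr (_ `^ _)%:E; apply/min_idPl.
  near: n; exact: nbhs_infty_ger.
have := @cvg_monotone_convergence _ _ _ mu setT measurableT g mgn
  (fun n x _ => ltac:(by rewrite /g lee_fin powR_ge0)) (fun x _ => gnd x).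
under eq_integral do rewrite glim.
move=> /cvg_lim <- //; apply: lime_le.
  apply: ereal_nondecreasing_is_cvgn => n m nm; apply: ge0_le_integral => //.
  - by move=> x _; rewrite lee_fin powR_ge0.
  - by move=> x _; exact: gnd.
near=> n; have n0 : 0 < n%:R :> R by rewrite ltr0n; near: n; exact: nbhs_infty_gt.
have := int_le_Np p0 e0 (trunc _ n0); apply: le_trans.
rewrite le_eqVlt; apply/orP; left; apply/eqP; apply: eq_integral => x _.
by rewrite /g [in RHS]ger0_norm.
Unshelve. all: by end_near.
Qed.

End Limits.

(** * Coding of complex polynomials with errors in L_p *)

Section ComplexCoding.
Variable R : realType.
Local Notation plane := (measurableTypeR R * measurableTypeR R)%type.
Local Notation mu := (@torus_measure R).
Local Notation func := (plane -> R[i]).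

Definition Qbox (N : nat) : set (int * int) :=
  [set k | (`|k.1| < N)%N /\ (`|k.2| < N)%N].

Lemma finite_Qbox N : finite_set (Qbox N).
Proof.
pose f (p : 'I_(2 * N) * 'I_(2 * N)) : int * int := (p.1%:Z - N%:Z, p.2%:Z - N%:Z).
apply: (@sub_finite_set _ _ (f @` setT)); last by apply: finite_image; exact: finite_finset.
move=> k [k1 k2].
have h1 : (absz (k.1 + N%:Z)%R < 2 * N)%N by lia.
have h2 : (absz (k.2 + N%:Z)%R < 2 * N)%N by lia.
exists (Ordinal h1, Ordinal h2) => //; rewrite /f /=.
by apply: injective_projections => /=; lia.
Qed.

Lemma finite_Q n : finite_set (Q n).
Proof.
apply: (@sub_finite_set _ _ (Qbox (2 ^ n))); last exact: finite_Qbox.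
move=> k [[s1 s2] s12 [/andP[_ k1] /andP[_ k2]]]; have {}s12 : (s1 + s2 <= n)%N by [].
by split; [apply: leq_trans k1 _|apply: leq_trans k2 _]; rewrite leq_exp2l //=; lia.
Qed.

Lemma expiE (k : int * int) (x : plane) : expi (dot k x) = (wave k 0 x +i* wave k (- (pi / 2)) x)%C :> R[i].
Proof. by rewrite /expi /wave addr0 cosBpihalf. Qed.

Lemma cReM (c d : R[i]) : complex.Re (c * d) = complex.Re c * complex.Re d - complex.Im c * complex.Im d.
Proof. by case: c; case: d. Qed.

Lemma cImM (c d : R[i]) : complex.Im (c * d) = complex.Re c * complex.Im d + complex.Im c * complex.Re d.
Proof. by case: c; case: d => a b c d /=. Qed.

Lemma cReD (c d : R[i]) : complex.Re (c + d) = complex.Re c + complex.Re d.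
Proof. by case: c; case: d. Qed.

Lemma cImD (c d : R[i]) : complex.Im (c + d) = complex.Im c + complex.Im d.
Proof. by case: c; case: d. Qed.

Lemma cReN (c : R[i]) : complex.Re (- c) = - complex.Re c.
Proof. by case: c. Qed.

Lemma cImN (c : R[i]) : complex.Im (- c) = - complex.Im c.
Proof. by case: c. Qed.

Lemma cRe_sum (I : Type) (s : seq I) (P : pred I) (F : I -> R[i]) :
  complex.Re (\sum_(i <- s | P i) F i) = \sum_(i <- s | P i) complex.Re (F i).
Proof.
elim: s => [|i s ih]; rewrite ?big_nil // !big_cons.
by case: ifP => _; rewrite ?cReD ih.
Qed.

Lemma cIm_sum (I : Type) (s : seq I) (P : pred I) (F : I -> R[i]) :
  complex.Im (\sum_(i <- s | P i) F i) = \sum_(i <- s | P i) complex.Im (F i).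
Proof.
elim: s => [|i s ih]; rewrite ?big_nil // !big_cons.
by case: ifP => _; rewrite ?cImD ih.
Qed.

Lemma trig_poly_ReIm (K : set (int * int)) (t : func) : finite_set K -> trig_poly K t ->
  tp K (fun x => complex.Re (t x)) /\ tp K (fun x => complex.Im (t x)).
Proof.
move=> fK [c ->].
have E x : \sum_(k \in K) c k * expi (dot k x) = \sum_(k <- finmap.enum_fset (fset_set K)) c k * expi (dot k x).
  exact: fsbig_finite.
have inK k : k \in finmap.enum_fset (fset_set K) -> K k.
  by move=> kK; apply: set_mem; rewrite -(in_fset_set fK); exact: kK.
have gen (F : int * int -> plane -> R) : (forall k, K k -> tp K (F k)) ->
    tp K (fun x => \sum_(k <- finmap.enum_fset (fset_set K)) F k x).
  move=> tF; under eq_fun do rewrite big_seq_cond.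
  by apply: tp_sum => k /andP[/inK Kk _]; exact: tF.
split.
  have -> : (fun x => complex.Re (\sum_(k \in K) c k * expi (dot k x))) = fun x =>
      \sum_(k <- finmap.enum_fset (fset_set K)) (complex.Re (c k) * wave k 0 x - complex.Im (c k) * wave k (- (pi / 2)) x).
    by apply/funext => x; rewrite E cRe_sum; apply: eq_bigr => k _; rewrite expiE cReM.
  by apply: gen => k Kk; apply: tpB; apply: tpZ; exact: tp_wave.
have -> : (fun x => complex.Im (\sum_(k \in K) c k * expi (dot k x))) = fun x =>
    \sum_(k <- finmap.enum_fset (fset_set K)) (complex.Re (c k) * wave k (- (pi / 2)) x + complex.Im (c k) * wave k 0 x).
  by apply/funext => x; rewrite E cIm_sum; apply: eq_bigr => k _; rewrite expiE cImM.
by apply: gen => k Kk; apply: tpD; apply: tpZ; exact: tp_wave.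
Qed.

Definition cnice (f : func) : Prop :=
  nice (fun x => complex.Re (f x)) /\ nice (fun x => complex.Im (f x)).

Lemma cnice_cmeas f : cnice f -> cmeasurable f.
Proof. by move=> [[m1 _] [m2 _]]. Qed.

Lemma trig_poly_cnice K t : finite_set K -> trig_poly K t -> cnice t.
Proof. by move=> fK /(trig_poly_ReIm fK)[/tp_nice t1 /tp_nice t2]. Qed.

Lemma cniceB f g : cnice f -> cnice g -> cnice (fun x => f x - g x).
Proof.
move=> [f1 f2] [g1 g2]; split.
  by under eq_fun do rewrite cReD cReN; exact: niceB.
by under eq_fun do rewrite cImD cImN; exact: niceB.
Qed.

Lemma cnice_normL p f : 1 <= p -> cnice f -> (normL p%:E f < +oo)%E.
Proof.
move=> p1 nf; have p0 : 0 < p by lra.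
apply: le_lt_trans (normL_le_ReIm p1 (cnice_cmeas nf)) _.
by case: nf => n1 n2; rewrite !Np_nice // -EFinD ltry.
Qed.

(** Where |g| <= s its p-th power is at most s^p, elsewhere at most s^(p-m) |g|^m; both parts have
    mean at most s^p. *)
Lemma Np_le_moment (p s : R) m (g : plane -> R) : 1 <= p -> p <= m%:R -> nice g -> 0 < s ->
  mean (fun x => `|g x| ^+ m) <= s ^+ m -> (Np p g <= (2 * s)%:E)%E.
Proof.
move=> p1 pm ng s0 hm; have p0 : 0 < p by lra.
rewrite Np_nice // lee_fin.
have m2 : mean (fun x => `|g x| `^ p) <= 2 * s `^ p.
  apply: (@le_trans _ _ (mean (fun x => s `^ p + s `^ (p - m%:R) * `|g x| ^+ m))).
    apply: le_mean; [by apply: nice_power => //; exact: ltW| |].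
      by apply: niceD; [exact: nice_cst|apply: niceZ; apply: niceX; exact: nice_norm].
    move=> x; have [gs|sg] := leP `|g x| s.
      rewrite -[leLHS]addr0; apply: lerD; last by rewrite mulr_ge0 ?powR_ge0 ?exprn_ge0.
      by apply: ge0_ler_powR; rewrite ?nnegrE // ltW.
    have := @power_interpolation R `|g x| s p m (normr_ge0 _) s0 p1 pm.
    have gp : 0 < `|g x| by apply: lt_trans sg.
    move=> _; rewrite -[leLHS]add0r; apply: lerD; first exact: powR_ge0.
    have -> : `|g x| `^ p = `|g x| `^ (p - m%:R) * `|g x| ^+ m.
      by rewrite -powR_mulrn // -powRD ?subrK // gt_eqF // implybT.
    rewrite ler_wpM2r ?exprn_ge0 // -(opprB m%:R p) !powRN lef_pV2 ?posrE ?powR_gt0 //.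
    by apply: ge0_ler_powR; rewrite ?nnegrE ?subr_ge0 // ltW.
  rewrite meanD; [|exact: nice_cst|by apply: niceZ; apply: niceX; exact: nice_norm].
  rewrite mean_cst meanZ; last by apply: niceX; exact: nice_norm.
  have := ler_wpM2l (powR_ge0 s (p - m%:R)) hm.
  rewrite -powR_mulrn ?(ltW s0) // -powRD ?subrK ?gt_eqF ?implybT //; lra.
have s2 : (2 * s `^ p) `^ p^-1 <= 2 * s.
  rewrite powRM ?powR_ge0 // -powRrM divff ?gt_eqF // powRr1 ?(ltW s0) //.
  rewrite ler_wpM2r ?(ltW s0) // -[leRHS]powRr1 //.
  by apply: ler_powR; [lra|rewrite invf_le1].
apply: le_trans s2; apply: ge0_ler_powR => //; rewrite ?nnegrE ?invr_ge0 ?(ltW p0) //.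
  by apply: mean_ge0 => x; rewrite powR_ge0.
by rewrite mulr_ge0 // powR_ge0.
Qed.

Lemma Np_le_interp (p c w : R) m (g : plane -> R) : 1 <= p -> p <= m%:R -> (1 < m)%N -> nice g ->
  0 < w -> 0 < c -> mean (fun x => `|g x|) <= 2 -> mean (fun x => `|g x| ^+ m) <= (c * w) ^+ m ->
  (Np p g <= ((2 + c ^+ m) * w `^ (m%:R / (m%:R - 1) * (1 - p^-1)))%:E)%E.
Proof.
move=> p1 pm m1 ng w0 c0 h1 hm; have p0 : 0 < p by lra.
have m0 : 0 < m%:R - 1 :> R by rewrite subr_gt0 ltr1n.
pose tau := m%:R / (m%:R - 1) : R.
(* This height balances the two terms of [power_interpolation], as T^(p-m) w^m = T^(p-1). The
   resulting exponent of w tends to 1 - 1/p as m grows. *)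
pose T := w `^ tau; have T0 : 0 < T by exact: powR_gt0.
rewrite Np_nice // lee_fin.
have c2 : 1 <= 2 + c ^+ m by have := exprn_ge0 m (ltW c0); lra.
have m2 : mean (fun x => `|g x| `^ p) <= (2 + c ^+ m) * T `^ (p - 1).
  apply: (@le_trans _ _ (mean (fun x => T `^ (p - 1) * `|g x| + T `^ (p - m%:R) * `|g x| ^+ m))).
    apply: le_mean; [by apply: nice_power => //; exact: ltW| |].
      by apply: niceD; apply: niceZ; [|apply: niceX]; exact: nice_norm.
    by move=> x; apply: power_interpolation.
  rewrite meanD; [|by apply: niceZ; exact: nice_norm|by apply: niceZ; apply: niceX; exact: nice_norm].
  rewrite !meanZ; [|by apply: niceX; exact: nice_norm|exact: nice_norm].
  have e1 := ler_wpM2l (powR_ge0 T (p - 1)) h1.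
  have e2 := ler_wpM2l (powR_ge0 T (p - m%:R)) hm.
  have e3 : T `^ (p - m%:R) * (c * w) ^+ m = c ^+ m * T `^ (p - 1).
    have wm : w ^+ m = T `^ (m%:R - 1).
      by rewrite /T -powRrM /tau mulrVK ?unitfE ?gt_eqF // powR_mulrn // ltW.
    rewrite exprMn wm mulrCA -powRD; last by rewrite (gt_eqF T0) implybT.
    by congr (_ * _ `^ _); ring.
  by rewrite e3 in e2; lra.
apply: (@le_trans _ _ (((2 + c ^+ m) * T `^ (p - 1)) `^ p^-1)).
  apply: ge0_ler_powR => //; rewrite ?nnegrE ?invr_ge0 ?(ltW p0) //.
    by apply: mean_ge0 => x; rewrite powR_ge0.
  by rewrite mulr_ge0 ?powR_ge0 //; lra.
rewrite powRM ?powR_ge0 //; last lra.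
apply: ler_pM; rewrite ?powR_ge0 //.
  rewrite -[leRHS]powRr1; last lra.
  by apply: ler_powR => //; rewrite invf_le1.
rewrite /T -!powRrM le_eqVlt; apply/orP; left; apply/eqP; congr (_ `^ _).
by rewrite /tau; field; rewrite !gt_eqF.
Qed.

Definition cross_cball (n : nat) (A : R) : set func :=
  [set t | trig_poly (Q n) t /\ (normL 1 t <= A%:E)%E].

Lemma normalize_ball n A t : 0 < A -> cross_cball n A t ->
  cross_ball n (fun x => A^-1 * complex.Re (t x)) /\ cross_ball n (fun x => A^-1 * complex.Im (t x)).
Proof.
move=> A0 [tt tA]; have [tR tI] := trig_poly_ReIm (finite_Q n) tt.
have mt := cnice_cmeas (trig_poly_cnice (finite_Q n) tt).
have gen u : tp (Q n) u -> (Np 1 u <= normL 1 t)%E -> cross_ball n (fun x => A^-1 * u x).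
  move=> tu ut; split; first exact: tpZ.
  have nu := tp_nice tu.
  have -> : (fun x => `|A^-1 * u x|) = (fun x => A^-1 * `|u x|).
    by apply/funext => x; rewrite normrM ger0_norm // invr_ge0 ltW.
  rewrite meanZ; last exact: nice_norm.
  rewrite mulrC ler_pdivrMr // mul1r -lee_fin -Np1_nice //.
  exact: le_trans ut tA.
by split; apply: gen => //; [exact: Np_Re|exact: Np_Im].
Qed.

Lemma Np_scale p A (g : plane -> R) e : 0 < p -> 0 < A -> nice g ->
  (Np p (fun x => A^-1 * g x)%R <= e%:E)%E -> (Np p g <= (A * e)%:E)%E.
Proof.
move=> p0 A0 ng; have nAg := niceZ A^-1 ng.
move=> h0; have h := eq_ind _ (fun z => (z <= e%:E)%E) h0 _ (Np_nice p0 nAg).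
rewrite lee_fin in h; rewrite (Np_nice p0 ng) lee_fin.
have gE x : `|g x| `^ p = A `^ p * `|A^-1 * g x| `^ p.
  have -> : `|A^-1 * g x| = A^-1 * `|g x| by rewrite normrM gtr0_norm // invr_gt0.
  have An : A != 0 by rewrite gt_eqF.
  have Ap : A `^ p != 0 by rewrite gt_eqF // powR_gt0.
  rewrite (powRM _ _ (normr_ge0 (g x))); last by rewrite invr_ge0 ltW.
  by rewrite -(powR_inv1 (ltW A0)) -powRrM mulN1r powRN mulVKf.
have -> : (fun x => `|g x| `^ p) = (fun x => A `^ p * `|A^-1 * g x| `^ p) by apply/funext.
rewrite meanZ; last by apply: nice_power => //; exact: ltW.
rewrite powRM ?powR_ge0 //; last by apply: mean_ge0 => x; rewrite powR_ge0.
by rewrite -powRrM divff ?gt_eqF // powRr1 ?(ltW A0) // ler_wpM2l // ltW.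
Qed.

(** Real and imaginary parts are coded separately, which doubles the number of bits. The first
    estimate serves small w; the second, which also exploits the L_1 bound, serves large w. *)
Lemma block_coding (p : R) (m0 : nat) : 1 <= p -> p <= (2 * m0.+1)%:R ->
  exists C : R, 0 < C /\ forall n (w A : R), 0 < w -> 0 < A ->
  exists (M : nat) (code : func -> nat),
  [/\ M%:R <= expR (8192 * cross_size R n * (ln (1 + w) / w + ln (1 + w^-1))),
      forall t, cross_cball n A t -> (code t < M)%N &
      forall t s, cross_cball n A t -> cross_cball n A s -> code t = code s ->
        (normL p%:E (fun x => t x - s x)%R <= (A * (C * w))%:E)%E /\
        (normL p%:E (fun x => t x - s x)%R <=
          (A * (C * w `^ ((2 * m0.+1)%:R / ((2 * m0.+1)%:R - 1) * (1 - p^-1))))%:E)%E].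
Proof.
move=> p1 pm; have p0 : 0 < p by lra.
have [c [c0 cod]] := coding R m0.
set m := (2 * m0.+1)%N in pm cod *.
pose C := 4 * c + 2 * (2 + c ^+ m).
have cm := exprn_ge0 m (ltW c0).
exists C; split; first by rewrite /C; lra.
move=> n w A w0 A0; have [M [code [hM hc hq]]] := cod n w w0.
pose re (t : func) x := A^-1 * complex.Re (t x).
pose im (t : func) x := A^-1 * complex.Im (t x).
exists (M * M)%N, (fun t => code (re t) * M + code (im t))%N; split.
- rewrite natrM (_ : 8192 * cross_size R n * _ = 4096 * cross_size R n * (ln (1 + w) / w + ln (1 + w^-1)) +
    4096 * cross_size R n * (ln (1 + w) / w + ln (1 + w^-1))); last by ring.
  by rewrite expRD; apply: ler_pM.
- move=> t /(normalize_ball A0)[b1 b2].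
  have h1 : (code (re t) < M)%N := hc _ b1; have h2 : (code (im t) < M)%N := hc _ b2.
  apply: (@leq_trans (code (re t) * M + M)); first by rewrite ltn_add2l.
  by rewrite -mulSnr leq_mul2r h1 orbT.
move=> t s bt bs; have [t1 t2] := normalize_ball A0 bt; have [s1 s2] := normalize_ball A0 bs.
move=> cc.
have [c1 c2] : code (re t) = code (re s) /\ code (im t) = code (im s).
  have l1 : (code (im t) < M)%N := hc _ t2; have l2 : (code (im s) < M)%N := hc _ s2.
  have M0 : (0 < M)%N by exact: leq_ltn_trans l1.
  split.
    have := congr1 (divn^~ M) cc; rewrite !divnMDl // !divn_small // !addn0; exact.
  have := congr1 (modn^~ M) cc; rewrite !modnMDl !modn_small //; exact.
have m1 : (1 < m)%N by rewrite /m mulnS.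
have gen (u v : plane -> R) : cross_ball n u -> cross_ball n v -> code u = code v ->
   (Np p (fun x => u x - v x)%R <= (2 * (c * w))%:E)%E /\
   (Np p (fun x => u x - v x)%R <= ((2 + c ^+ m) * w `^ (m%:R / (m%:R - 1) * (1 - p^-1)))%:E)%E.
  move=> bu bv cuv; have [tu u1] := bu; have [tv v1] := bv.
  have nu := tp_nice tu; have nv := tp_nice tv; have nuv := niceB nu nv.
  have hm : mean (fun x => `|u x - v x| ^+ m) <= (c * w) ^+ m.
    have := hq u v bu bv cuv; congr (_ <= _); congr mean; apply/funext => x.
    by rewrite /m !exprM real_normK ?num_real.
  split; first by apply: (@Np_le_moment p (c * w) m) => //; rewrite mulr_gt0.
  apply: Np_le_interp => //.
  apply: (@le_trans _ _ (mean (fun x => `|u x| + `|v x|))).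
    apply: le_mean; [exact: nice_norm|by apply: niceD; exact: nice_norm|].
    by move=> x; exact: ler_normB.
  rewrite meanD; [lra|exact: nice_norm..].
have [R1 R2] := gen (re t) (re s) t1 s1 c1; have [I1 I2] := gen (im t) (im s) t2 s2 c2.
have nt := trig_poly_cnice (finite_Q n) bt.1; have ns := trig_poly_cnice (finite_Q n) bs.1.
have nts := cniceB nt ns; have [nR nI] := nts.
have EReal : (fun x => re t x - re s x) = (fun x => A^-1 * complex.Re (t x - s x)).
  by apply/funext => x; rewrite /re cReD cReN mulrBr.
have EIm : (fun x => im t x - im s x) = (fun x => A^-1 * complex.Im (t x - s x)).
  by apply/funext => x; rewrite /im cImD cImN mulrBr.
rewrite EReal in R1 R2; rewrite EIm in I1 I2.
have tot e : 0 <= e -> (Np p (fun x => A^-1 * complex.Re (t x - s x))%R <= e%:E)%E ->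
    (Np p (fun x => A^-1 * complex.Im (t x - s x))%R <= e%:E)%E ->
    (normL p%:E (fun x => t x - s x)%R <= (A * (2 * e))%:E)%E.
  move=> e0 h1 h2; apply: le_trans (normL_le_ReIm p1 (cnice_cmeas nts)) _.
  apply: le_trans (leeD (Np_scale p0 A0 nR h1) (Np_scale p0 A0 nI h2)) _.
  by rewrite -EFinD lee_fin; lra.
split.
  apply: le_trans (tot _ _ R1 I1) _; first by rewrite !mulr_ge0 // ltW.
  rewrite lee_fin ler_wpM2l ?(ltW A0) // mulrA mulrA ler_wpM2r ?(ltW w0) // /C; lra.
apply: le_trans (tot _ _ R2 I2) _; first by rewrite mulr_ge0 ?powR_ge0 //; lra.
rewrite lee_fin ler_wpM2l ?(ltW A0) // mulrA ler_wpM2r ?powR_ge0 // /C; lra.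
Qed.

End ComplexCoding.

(** * Upper bound *)

Section Combine.
Variable R : realType.
Local Notation plane := (measurableTypeR R * measurableTypeR R)%type.
Local Notation func := (plane -> R[i]).

Lemma cnice_sum (I : Type) (s : seq I) (F : I -> func) :
  (forall i, cnice (F i)) -> cnice (fun x => \sum_(i <- s) F i x).
Proof.
move=> nF; split.
  under eq_fun do rewrite cRe_sum; apply: nice_sum => i _; exact: (nF i).1.
under eq_fun do rewrite cIm_sum; apply: nice_sum => i _; exact: (nF i).2.
Qed.

Lemma cnice0 : cnice (fun=> 0 : R[i]).
Proof. by split; exact: nice_cst. Qed.

Lemma normL0 p : 1 <= p -> normL p%:E (fun=> 0 : R[i]) = 0%E.
Proof.
move=> p1; rewrite /normL; have -> : (fun x : plane => (ComplexField.Normc.normc (0 : R[i]))%:E) = cst 0%E.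
  by apply/funext => x; rewrite normc_sqrt /= expr0n /= addr0 sqrtr0.
by rewrite Lnorm0 // gt_eqF // lte_fin; lra.
Qed.

Lemma normL_sum p (I : Type) (s : seq I) (F : I -> func) : 1 <= p -> (forall i, cnice (F i)) ->
  (normL p%:E (fun x => \sum_(i <- s) F i x)%R <= \sum_(i <- s) normL p%:E (F i))%E.
Proof.
move=> p1 nF; elim: s => [|i s ih].
  rewrite big_nil (_ : (fun x : plane => _) = fun=> 0) ?normL0 //.
  by apply/funext => x; rewrite big_nil.
rewrite big_cons (_ : (fun x : plane => _) = fun x => F i x + \sum_(j <- s) F j x); last first.
  by apply/funext => x; rewrite big_cons.
apply: le_trans (normLD p1 _ _) _; [exact: cnice_cmeas|exact: cnice_cmeas (cnice_sum _ nF)|].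
by apply: leeD.
Qed.

(** Convergence is asked in L_1, the form available for both classes when q = 1; the L_p estimates
    come back through [Lp_limit]. *)
Definition synthesizable (B : nat -> set func) : set func := [set f | L 1%E f /\
  exists t : nat -> func, (forall n, (1 <= n)%N -> B n (t n)) /\
    (normL 1 (fun x => f x - \sum_(1 <= n < N.+1) t n x)%R @[N --> \oo] --> 0%E)%E].

Variables (p : R) (p1 : 1 <= p) (B : nat -> set func) (M : nat -> nat).
Variables (code : nat -> func -> nat) (e : nat -> R) (eps : R) (k n0 : nat).
Hypothesis B_cnice : forall n t, B n t -> cnice t.
Hypothesis B0 : forall n, B n (fun=> 0).
Hypothesis code_lt : forall n t, B n t -> (code n t < M n)%N.
Hypothesis code_close : forall n t s, B n t -> B n s -> code n t = code n s ->
  (normL p%:E (fun x => t x - s x)%R <= (e n)%:E)%E.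
Hypothesis M_prod : (\prod_(1 <= n < n0.+1) M n <= 2 ^ k)%N.
Hypothesis M_tail : forall n, (n0 < n)%N -> (M n <= 1)%N.
Hypothesis e_sum : forall N, \sum_(1 <= n < N.+1) e n <= eps.

(** A mixed radix number whose digit in base [M n] is the code of block n; division and remainder
    recover the digits. *)
Fixpoint total_code (t : nat -> func) (N : nat) : nat :=
  if N is m.+1 then (total_code t m * M m.+1 + code m.+1 (t m.+1))%N else 0%N.

Lemma total_code_lt t N : (forall n, (1 <= n)%N -> B n (t n)) ->
  (total_code t N < \prod_(1 <= n < N.+1) M n)%N.
Proof.
move=> Bt; elim: N => [|N ih]; first by rewrite big_geq.
rewrite big_nat_recr //=.
have h := code_lt (Bt N.+1 isT).
apply: (@leq_trans ((total_code t N).+1 * M N.+1)).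
  by rewrite mulSnr -addnS leq_add2l.
by rewrite leq_mul2r ih orbT.
Qed.

Lemma total_code_inj t s N : (forall n, (1 <= n)%N -> B n (t n)) ->
  (forall n, (1 <= n)%N -> B n (s n)) -> total_code t N = total_code s N ->
  forall n, (1 <= n <= N)%N -> code n (t n) = code n (s n).
Proof.
move=> Bt Bs; elim: N => [|N ih] /= E n; first by case: n.
have ht := code_lt (Bt N.+1 isT); have hs := code_lt (Bs N.+1 isT).
have M0 : (0 < M N.+1)%N by exact: leq_ltn_trans ht.
have E1 : total_code t N = total_code s N.
  by have := congr1 (divn^~ (M N.+1)) E; rewrite !divnMDl // !divn_small // !addn0.
have E2 : code N.+1 (t N.+1) = code N.+1 (s N.+1).
  by have := congr1 (modn^~ (M N.+1)) E; rewrite !modnMDl !modn_small.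
move=> /andP[n1]; rewrite leq_eqVlt => /orP[/eqP -> //|]; rewrite ltnS => nN.
by apply: ih => //; rewrite n1.
Qed.

(** Beyond n0 every code is 0, so agreement up to n0 is agreement everywhere. *)
Let close_all (t s : nat -> func) : (forall n, (1 <= n)%N -> B n (t n)) ->
  (forall n, (1 <= n)%N -> B n (s n)) -> total_code t n0 = total_code s n0 ->
  forall n, (1 <= n)%N -> (normL p%:E (fun x => t n x - s n x)%R <= (e n)%:E)%E.
Proof.
move=> Bt Bs E n n1; apply: code_close; [exact: Bt|exact: Bs|].
have [nn|nn] := leqP n n0; first by apply: (total_code_inj Bt Bs E); rewrite n1.
have := leq_trans (code_lt (Bt n n1)) (M_tail nn); have := leq_trans (code_lt (Bs n n1)) (M_tail nn).
by rewrite !ltnS !leqn0 => /eqP -> /eqP ->.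
Qed.

Let eps0 : 0 <= eps.
Proof. by have := e_sum 0; rewrite big_geq. Qed.

Let L1_cmeas (f : func) q : L q f -> cmeasurable f.
Proof. by case. Qed.

Let partial_cnice (t : nat -> func) N : (forall n, (1 <= n)%N -> B n (t n)) ->
  cnice (fun x => \sum_(1 <= n < N.+1) t n x).
Proof.
move=> Bt; have := @cnice_sum _ (index_iota 1 N.+1) (fun n => if (1 <= n)%N then t n else fun=> 0).
have -> : (fun x => \sum_(i <- index_iota 1 N.+1) (if (1 <= i)%N then t i else fun=> 0) x) =
    (fun x => \sum_(1 <= n < N.+1) t n x).
  by apply/funext => x; apply: eq_big_nat => i /andP[-> _].
apply=> i; case: ifP => [i1|_]; [exact: B_cnice (Bt i i1)|exact: cnice0].
Qed.

Lemma close_sum (f g : func) (t s : nat -> func) (d : nat -> R) (D : R) : 0 <= D ->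
  cmeasurable f -> cmeasurable g ->
  (forall n, (1 <= n)%N -> B n (t n)) -> (forall n, (1 <= n)%N -> B n (s n)) ->
  (normL 1 (fun x => f x - \sum_(1 <= n < N.+1) t n x)%R @[N --> \oo] --> 0%E)%E ->
  (normL 1 (fun x => g x - \sum_(1 <= n < N.+1) s n x)%R @[N --> \oo] --> 0%E)%E ->
  (forall n, (1 <= n)%N -> (normL p%:E (fun x => t n x - s n x)%R <= (d n)%:E)%E) ->
  (forall N, \sum_(1 <= n < N.+1) d n <= D) ->
  (normL p%:E (fun x => f x - g x)%R <= D%:E)%E.
Proof.
move=> D0 mf mg Bt Bs cf cg td sD.
pose S N x := \sum_(1 <= n < N.+1) t n x; pose S' N x := \sum_(1 <= n < N.+1) s n x.
have nS N := partial_cnice N Bt; have nS' N := partial_cnice N Bs.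
apply: (@Lp_limit R p D _ (fun N x => S N x - S' N x)) => //.
- exact: cmeasurableB.
- by move=> N; apply: cnice_cmeas; exact: (cniceB (nS N) (nS' N)).
- have u0 N : (0 <= normL 1 (fun x => ((f x - g x) - (S N x - S' N x))%R))%E by exact: Lnorm_ge0.
  have ub N : (normL 1 (fun x => ((f x - g x) - (S N x - S' N x))%R) <=
      normL 1 (fun x => (f x - S N x)%R) + normL 1 (fun x => (g x - S' N x)%R))%E.
    rewrite (_ : (fun x => _) = fun x => (f x - S N x) - (g x - S' N x)); last first.
      by apply/funext => x; rewrite !opprB addrACA [RHS]addrACA; congr (_ + _); rewrite addrC.
    apply: normLB => //; apply: cmeasurableB => //; [exact: cnice_cmeas (nS N)|exact: cnice_cmeas (nS' N)].
  apply: (@squeeze_cvge _ _ _ _ (fun=> 0%E) _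
    (fun N => (normL 1 (fun x => (f x - S N x)%R) + normL 1 (fun x => (g x - S' N x)%R))%E)).
  + by apply: nearW => N; rewrite u0 ub.
  + exact: cvg_cst.
  + by rewrite -[X in _ --> X](adde0 0%E); apply: cvgeD.
- move=> N; rewrite /S /S'.
  have -> : (fun x => \sum_(1 <= n < N.+1) t n x - \sum_(1 <= n < N.+1) s n x) =
      (fun x => \sum_(n <- index_iota 1 N.+1) (if (1 <= n)%N then (fun y => t n y - s n y) else fun=> 0) x).
    by apply/funext => x; rewrite -sumrB; apply: eq_big_nat => n /andP[-> _].
  apply: le_trans (normL_sum _ p1 _) _.
    move=> n; case: ifP => [n1|_]; last exact: cnice0.
    by apply: cniceB; apply: B_cnice; [exact: Bt|exact: Bs].
  apply: le_trans (_ : (\sum_(1 <= n < N.+1) (d n)%:E <= _)%E).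
    rewrite big_nat_cond [leRHS]big_nat_cond; apply: lee_sum => n /andP[/andP[n1 _] _].
    by rewrite n1; exact: td.
  by rewrite sumEFin lee_fin.
Qed.

(** Elements of [A] with the same total code differ by at most the sum of the e n. The centres are
    elements of [A], one for each code that occurs, and 0 for the others. *)
Lemma entropy_le (A : set func) : A `<=` synthesizable B -> (entropyL p%:E A k <= eps%:E)%E.
Proof.
move=> AB.
have p0 : 0 < p by exact: lt_le_trans ltr01 p1.
have [T hT] : {T : func -> nat -> func & forall f, A f -> (forall n, (1 <= n)%N -> B n (T f n)) /\
    (normL 1 (fun x => f x - \sum_(1 <= n < N.+1) T f n x)%R @[N --> \oo] --> 0%E)%E}.
  apply: (@choice _ _ (fun f t => A f -> (forall n, (1 <= n)%N -> B n (t n)) /\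
    (normL 1 (fun x => f x - \sum_(1 <= n < N.+1) t n x)%R @[N --> \oo] --> 0%E)%E)).
  move=> f; have [Af|nA] := pselect (A f); last by exists (fun _ _ => 0).
  by case: (AB f Af) => _ [t ht]; exists t.
have Lp f : A f -> L p%:E f.
  move=> Af; have [[per mf _] _] := AB f Af; have [Bt ct] := hT f Af.
  split => //.
  (* Membership in L_p comes from comparing f with 0: beyond n0 a block has the same code as 0 and
     hence norm at most e n, while the first n0 blocks add a finite amount. *)
  pose d n := e n + (if (n <= n0)%N then fine (normL p%:E (T f n)) else 0).
  pose D := eps + \sum_(1 <= n < n0.+1) fine (normL p%:E (T f n)).
  have fin n : (1 <= n)%N -> normL p%:E (T f n) \is a fin_num.
    move=> n1; rewrite ge0_fin_numE; last exact: Lnorm_ge0.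
    by apply: cnice_normL => //; exact: B_cnice (Bt n n1).
  have g0 n : 0 <= fine (normL p%:E (T f n)) by apply: fine_ge0; exact: Lnorm_ge0.
  have e0 n : (1 <= n)%N -> 0 <= e n.
    move=> n1; rewrite -lee_fin; apply: le_trans (code_close (B0 n) (B0 n) erefl).
    exact: Lnorm_ge0.
  have D0 : 0 <= D by rewrite addr_ge0 // sumr_ge0.
  have Bz n : (1 <= n)%N -> B n (fun=> 0) by move=> _; exact: B0.
  have := @close_sum f (fun=> 0) (T f) (fun _ _ => 0) d D D0 mf (cnice_cmeas cnice0) Bt Bz ct.
  have -> : (fun x : plane => f x - 0) = f by apply/funext => x; rewrite subr0.
  move=> H; apply: le_lt_trans (ltry D); apply: H.
  - have -> : (fun N => normL 1 (fun x : plane => 0 - \sum_(1 <= n < N.+1) (0 : R[i])))%R = (fun=> 0%E).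
      apply/funext => N; rewrite big1 // -(@normL0 1) //; congr normL.
      by apply/funext => x; rewrite subr0.
    exact: cvg_cst.
  - move=> n n1; have -> : (fun x : plane => T f n x - 0) = T f n by apply/funext => x; rewrite subr0.
    rewrite /d; case: leqP => nn.
      by rewrite -(fineK (fin n n1)) lee_fin lerDr e0.
    have := code_close (Bt n n1) (B0 n).
    have -> : (fun x : plane => T f n x - 0) = T f n by apply/funext => x; rewrite subr0.
    rewrite addr0; apply.
    have := leq_trans (code_lt (Bt n n1)) (M_tail nn); have := leq_trans (code_lt (B0 n)) (M_tail nn).
    by rewrite !ltnS !leqn0 => /eqP -> /eqP ->.
  - move=> N; rewrite /d big_split /=; apply: lerD; first exact: e_sum.
    have [Nn|nN] := leqP N n0.
      rewrite (big_cat_nat (n := N.+1) (p := n0.+1)) //= -[leLHS]addr0; apply: lerD; last exact: sumr_ge0.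
      rewrite big_nat_cond [leRHS]big_nat_cond; apply: ler_sum => n /andP[/andP[_ nN] _].
      by rewrite (leq_trans _ Nn).
    rewrite (big_cat_nat (n := n0.+1)) //=; last exact: ltnW.
    rewrite -[leRHS]addr0; apply: lerD.
      by rewrite big_nat_cond [leRHS]big_nat_cond; apply: ler_sum => n /andP[/andP[_ nN'] _]; rewrite -ltnS nN'.
    rewrite big_nat_cond big1 // => n /andP[/andP[nn _] _].
    by rewrite leqNgt nn.
pose c f := total_code (T f) n0.
have c_lt f : A f -> (c f < 2 ^ k)%N.
  by move=> Af; apply: leq_trans (total_code_lt _ _) M_prod; case: (hT f Af).
have [Y hY] : {Y : 'I_(2 ^ k) -> func & forall j : 'I_(2 ^ k),
    (exists2 f, A f & c f = nat_of_ord j) -> A (Y j) /\ c (Y j) = nat_of_ord j}.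
  apply: (@choice _ _ (fun (j : 'I_(2 ^ k)) y => (exists2 f, A f & c f = nat_of_ord j) -> A y /\ c y = nat_of_ord j)).
  move=> j; have [[f Af cf]|nj] := pselect (exists2 f, A f & c f = nat_of_ord j); first by exists f.
  by exists (fun=> 0).
apply: ereal_inf_lbound; exists eps => //.
exists (fun j => if `[< exists2 f, A f & c f = nat_of_ord j >] then Y j else fun=> 0); split.
  move=> j; case: asboolP => [h|_]; first by apply: Lp; case: (hY j h).
  split; [by move=> x y|exact: cnice_cmeas cnice0|exact: cnice_normL cnice0].
move=> f Af; have h : exists2 g, A g & c g = nat_of_ord (Ordinal (c_lt f Af)) by exists f.
exists (Ordinal (c_lt f Af)) => //=; split; first exact: Lp.
case: asboolP => // _; have [AY cY] := hY _ h.
have [Bt ct] := hT f Af; have [Bs cs] := hT _ AY.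
have mf : cmeasurable f by apply: L1_cmeas (Lp f Af).
have mY := L1_cmeas (Lp _ AY).
apply: (@close_sum _ _ _ _ e eps) ct cs _ e_sum => //.
by apply: close_all => //; rewrite -/(c f) -/(c (Y _)) cY.
Qed.

End Combine.

(** * Elementary estimates: bits per coordinate, series, and the rate at level m *)

Section Numeric.
Variable R : realType.
Implicit Types (a b w x y : R).

Lemma powRE x y : 0 < x -> x `^ y = expR (y * ln x).
Proof. by move=> x0; rewrite mulrC expRM lnK. Qed.

Lemma ln_le_pow y s : 0 < y -> 0 < s -> ln y <= y `^ s / s.
Proof.
move=> y0 s0; rewrite ler_pdivlMr // mulrC -ln_powR.
have ys : 0 < y `^ s by exact: powR_gt0.
have : ln (1 + (y `^ s - 1)) <= y `^ s - 1 by apply: le_ln1Dx; lra.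
by rewrite addrC subrK; lra.
Qed.

Lemma pow2_le2 s : 0 <= s -> s <= 1 -> (2 : R) `^ s <= 2.
Proof. by move=> s0 s1; rewrite -[leRHS]powRr1 //; apply: ler_powR => //; lra. Qed.

(** Any power dominates the logarithm: for w >= 1 this handles ln(1 + w) / w with exponent 1 - g,
    for w < 1 it handles ln(1 + 1/w) with exponent g, and the other summand is trivially bounded in
    each case. *)
Lemma ratio_bits_le (g w : R) : 0 < g -> g < 1 -> 0 < w ->
  ln (1 + w) / w + ln (1 + w^-1) <= (2 / (1 - g) + 2 / g + 2) * w `^ (- g).
Proof.
move=> g0 g1 w0; pose s := 1 - g; have s0 : 0 < s by rewrite /s; lra.
have iw0 : 0 < w^-1 by rewrite invr_gt0.
have W0 : 0 <= w `^ (- g) by exact: powR_ge0.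
have A0 : 0 <= 2 / (1 - g) by rewrite divr_ge0 // ltW.
have B0 : 0 <= 2 / g by rewrite divr_ge0 // ltW.
have [w1|w1] := leP 1 w.
  have h1 : ln (1 + w) / w <= 2 / (1 - g) * w `^ (- g).
    rewrite ler_pdivrMr //.
    have -> : 2 / (1 - g) * w `^ (- g) * w = (2 * w `^ s) / s.
      rewrite -/s; have -> : w `^ s = w `^ (- g) * w.
        by rewrite -{3}(powRr1 (ltW w0)) -powRD ?(gt_eqF w0) ?implybT //; congr (_ `^ _); rewrite /s; ring.
      by field; rewrite gt_eqF.
    apply: le_trans (ln_le_pow _ s0) _; first lra.
    rewrite ler_pM2r ?invr_gt0 //; apply: (@le_trans _ _ ((2 * w) `^ s)).
      by apply: ge0_ler_powR; rewrite ?nnegrE ?(ltW s0) //; lra.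
    rewrite powRM ?(ltW w0) // ler_wpM2r ?powR_ge0 // pow2_le2 ?(ltW s0) //; rewrite /s; lra.
  have h2 : ln (1 + w^-1) <= w `^ (- g).
    apply: (@le_trans _ _ w^-1); first by apply: le_ln1Dx; lra.
    by rewrite -powR_inv1 ?(ltW w0) //; apply: ler_powR => //; lra.
  apply: le_trans (lerD h1 h2) _; nra.
have wg : 1 <= w `^ (- g).
  rewrite powRN invr_ge1 ?unitfE ?gt_eqF ?powR_gt0 //.
  apply: (@le_trans _ _ (1 `^ g)); last by rewrite powR1.
  by apply: ge0_ler_powR; rewrite ?nnegrE ?(ltW w0) ?(ltW g0) ?(ltW w1).
have h1 : ln (1 + w) / w <= w `^ (- g).
  apply: le_trans wg; rewrite ler_pdivrMr // mul1r; apply: le_ln1Dx; lra.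
have h2 : ln (1 + w^-1) <= 2 / g * w `^ (- g).
  apply: le_trans (ln_le_pow _ g0) _; first lra.
  rewrite mulrAC ler_pM2r ?invr_gt0 //; apply: (@le_trans _ _ ((2 * w^-1) `^ g)).
    apply: ge0_ler_powR; rewrite ?nnegrE ?(ltW g0) //; try lra.
    have : 1 <= w^-1 by rewrite invr_ge1 ?unitfE ?gt_eqF // ltW.
    lra.
  rewrite powRM ?(ltW iw0) // -powR_inv1 ?(ltW w0) // -powRrM mulN1r.
  by rewrite ler_wpM2r // pow2_le2 // ltW.
apply: le_trans (lerD h1 h2) _; nra.
Qed.

Lemma sum_poly_exp (b l : R) : 0 <= b -> 0 < l ->
  exists S : R, 0 < S /\ forall D, \sum_(d < D) d.+1%:R `^ b * expR (- (l * d%:R)) <= S.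
Proof.
move=> b0 l0; pose b' := b + 1; have b'0 : 0 < b' by rewrite /b'; lra.
(* Chosen with b' z = l / 2, so that ln(z y) <= z y - 1 absorbs the power into half of the
   exponential decay. *)
pose z := l / (2 * b'); have z0 : 0 < z by rewrite divr_gt0 // mulr_gt0.
pose C := expR (l / 2 - b' * ln z).
pose q := expR (- (l / 2)).
have q0 : 0 < q by exact: expR_gt0.
have q1 : q < 1 by rewrite /q expR_lt1; lra.
exists (C / (1 - q)); split; first by rewrite divr_gt0 ?expR_gt0 ?subr_gt0.
move=> D; apply: (@le_trans _ _ (\sum_(d < D) C * q ^+ d)); last first.
  by rewrite -mulr_sumr ler_wpM2l ?expR_ge0 //; apply: geometric_le => //; exact: ltW.
apply: ler_sum => d _; have d1 : (1 : R) <= d.+1%:R by rewrite ler1n.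
have dp : (0 : R) < d.+1%:R by rewrite ltr0n.
apply: (@le_trans _ _ (d.+1%:R `^ b' * expR (- (l * d%:R)))).
  by rewrite ler_wpM2r ?expR_ge0 //; apply: ler_powR => //; rewrite /b'; lra.
rewrite powRE // -expRD /C /q -expRM_natl -expRD ler_expR.
have hl : ln (1 + (z * d.+1%:R - 1)) <= z * d.+1%:R - 1.
  by apply: le_ln1Dx; have := mulr_gt0 z0 dp; lra.
rewrite addrC subrK lnM ?posrE // in hl.
have h2 : b' * (ln z + ln d.+1%:R) <= b' * (z * d.+1%:R - 1) by rewrite ler_pM2l.
have e1 : b' * (z * d.+1%:R) = l / 2 * d.+1%:R.
  by rewrite /z; field; rewrite gt_eqF.
rewrite mulrBr e1 -natr1 in h2.
rewrite -natr1 in hl *; nra.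
Qed.

Definition dist (n m : nat) : nat := ((n - m) + (m - n))%N.

(** Each distance to m is attained at most twice. *)
Lemma sum_dist (psi : nat -> R) (S : R) m N : (forall d, 0 <= psi d) ->
  (forall D, \sum_(d < D) psi d <= S) -> \sum_(1 <= n < N) psi (dist n m) <= 2 * S.
Proof.
move=> p0 pS.
apply: (@le_trans _ _ (\sum_(0 <= n < m + N) psi (dist n m))).
  case: N => [|N]; first by rewrite big_geq // sumr_ge0.
  rewrite (big_cat_nat (n := N.+1) (p := (m + N.+1)%N)) //=; last by rewrite leq_addl.
  rewrite -[leLHS]addr0; apply: lerD; last exact: sumr_ge0.
  by rewrite [leRHS]big_ltn // lerDr.
rewrite (big_cat_nat (n := m)) //=; last by rewrite leq_addr.
have -> : 2 * S = S + S by lra.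
apply: lerD.
  rewrite big_nat_rev /= big_mkord; apply: le_trans (pS m.+1).
  rewrite big_ord_recl -[leLHS]add0r; apply: lerD => //.
  apply: ler_sum => i _; have im := ltn_ord i; rewrite le_eqVlt; apply/orP; left; apply/eqP.
  by congr psi; rewrite /dist add0n lift0; lia.
rewrite -{1}[m]add0n big_addn addKn big_mkord; apply: le_trans (pS N).
by apply: ler_sum => i _; rewrite le_eqVlt; apply/orP; left; apply/eqP; congr psi; rewrite /dist; lia.
Qed.

(** Peetre's inequality: it rests on n <= m (1 + |n - m|), with n and m exchanged when b is
    negative. *)
Lemma pow_shift (b : R) (n m : nat) : (0 < n)%N -> (0 < m)%N ->
  n%:R `^ b <= m%:R `^ b * (dist n m).+1%:R `^ `|b|.
Proof.
move=> n0 m0; have nr : (0 : R) < n%:R by rewrite ltr0n. have mr : (0 : R) < m%:R by rewrite ltr0n.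
have [b0|b0] := leP 0 b.
  rewrite ger0_norm // -powRM //; apply: ge0_ler_powR; rewrite ?nnegrE ?mulr_ge0 //.
  rewrite -natrM ler_nat /dist mulnS.
  have : ((n - m) + (m - n) <= m * ((n - m) + (m - n)))%N by rewrite leq_pmull.
  lia.
rewrite ltr0_norm //; set c := - b; have c0 : 0 <= c by rewrite /c; lra.
have bE : b = - c by rewrite /c opprK.
clearbody c; rewrite {}bE in b0 *.
rewrite !powRN [leRHS]mulrC ler_pdivlMr ?powR_gt0 // mulrC ler_pdivrMr ?powR_gt0 // mulrC -powRM //.
apply: ge0_ler_powR; rewrite ?nnegrE ?mulr_ge0 //.
rewrite -natrM ler_nat /dist mulnS.
have : ((n - m) + (m - n) <= n * ((n - m) + (m - n)))%N by rewrite leq_pmull.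
lia.
Qed.

Lemma cross_size_dist (n m : nat) : (0 < m)%N ->
  cross_size R n <= 2 * (dist n m).+1%:R * (m%:R * 2 ^+ m) *
    (if (n <= m)%N then 2 `^ (- (dist n m)%:R) else 2 `^ ((dist n m)%:R)).
Proof.
move=> m0; have X0 : 0 <= m%:R * 2 ^+ m :> R by rewrite mulr_ge0 // exprn_ge0.
have two0 : (2 : R) != 0 by [].
case: ifP => nm; rewrite /cross_size.
  have dE : dist n m = (m - n)%N by rewrite /dist; lia.
  have -> : 2 ^+ n = 2 ^+ m * 2 `^ (- (dist n m)%:R) :> R.
    rewrite dE -!powR_mulrn // -powRD; last by rewrite two0 implybT.
    by congr (_ `^ _); rewrite natrB //; ring.
  rewrite !mulrA ler_wpM2r ?powR_ge0 // ler_wpM2r ?exprn_ge0 // -natrM -natrM ler_nat; nia.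
have dE : dist n m = (n - m)%N by rewrite /dist; lia.
have -> : 2 ^+ n = 2 ^+ m * 2 `^ ((dist n m)%:R) :> R.
  rewrite dE -!powR_mulrn // -powRD; last by rewrite two0 implybT.
  by congr (_ `^ _); rewrite natrB; [ring|lia].
rewrite !mulrA ler_wpM2r ?powR_ge0 // ler_wpM2r ?exprn_ge0 // -natrM -natrM ler_nat dE; nia.
Qed.

Definition rate a b (k : nat) : R := k%:R `^ (- a) * ln k%:R `^ (a + b).

Lemma level_exists (k : nat) : (2 <= k)%N ->
  exists m, [/\ (0 < m)%N, (m * 2 ^ m <= k)%N & (k < m.+1 * 2 ^ m.+1)%N].
Proof.
move=> k2.
have ex : exists m, (m * 2 ^ m <= k)%N by exists 1%N.
have bd m : (m * 2 ^ m <= k)%N -> (m <= k)%N.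
  by apply: leq_trans; rewrite leq_pmulr // expn_gt0.
case: (ex_maxnP ex bd) => m mk mmax; exists m; split => //.
  exact: (mmax 1%N).
by rewrite ltnNge; apply/negP => /mmax; rewrite ltnn.
Qed.

Lemma pow_between (s u v x y : R) : 0 < u -> u <= v -> 0 < x -> u * x <= y -> y <= v * x ->
  Num.min (u `^ s) (v `^ s) * x `^ s <= y `^ s /\ y `^ s <= Num.max (u `^ s) (v `^ s) * x `^ s.
Proof.
move=> u0 uv x0 h1 h2; have v0 : 0 < v by apply: lt_le_trans uv.
have ux := mulr_gt0 u0 x0; have y0 : 0 < y by apply: lt_le_trans h1.
have xs := powR_gt0 s x0.
have [s0|s0] := leP 0 s.
  have m1 : (u * x) `^ s <= y `^ s by apply: ge0_ler_powR; rewrite ?nnegrE ?(ltW ux) ?(ltW y0).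
  have m2 : y `^ s <= (v * x) `^ s by apply: ge0_ler_powR; rewrite ?nnegrE ?(ltW y0) ?(ltW (mulr_gt0 v0 x0)).
  rewrite !powRM ?(ltW u0) ?(ltW v0) ?(ltW x0) // in m1 m2; split.
    by apply: le_trans m1; rewrite ler_pM2r // ge_min lexx.
  by apply: le_trans m2 _; rewrite ler_pM2r // le_max lexx orbT.
have ns0 : 0 <= - s by lra.
have inv (z1 z2 : R) : 0 < z1 -> z1 <= z2 -> z2 `^ s <= z1 `^ s.
  move=> z0 z12; have e z : z `^ s = (z `^ (- s))^-1 by rewrite -powRN opprK.
  rewrite !e lef_pV2 ?posrE ?powR_gt0 //; last by apply: lt_le_trans z12.
  by apply: ge0_ler_powR; rewrite ?nnegrE ?(ltW z0) //; apply: le_trans z12; exact: ltW.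
have m1 := inv _ _ ux h1; have m2 := inv _ _ y0 h2.
rewrite !powRM ?(ltW u0) ?(ltW v0) ?(ltW x0) // in m1 m2; split.
  by apply: le_trans m2; rewrite ler_pM2r // ge_min lexx orbT.
by apply: le_trans m1 _; rewrite ler_pM2r // le_max lexx.
Qed.

(** At this level k is comparable with m 2^m and ln k with m, and the powers of m combine to -a + (a
    + b) = b; [pow_between] covers exponents of either sign. *)
Lemma rate_level a b : 0 < a -> exists c1 c2 : R, [/\ 0 < c1, 0 < c2 & forall k m,
  (0 < m)%N -> (m * 2 ^ m <= k)%N -> (k < m.+1 * 2 ^ m.+1)%N ->
  c1 * (2 `^ (- (a * m%:R)) * m%:R `^ b) <= rate a b k /\
  rate a b k <= c2 * (2 `^ (- (a * m%:R)) * m%:R `^ b)].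
Proof.
move=> a0; pose s := a + b.
have l2 : 0 < ln (2 : R) by rewrite ln_gt0 // ltr1n.
have l4 : ln (2 : R) <= 4.
  have : ln (1 + 1 : R) <= 1 by apply: le_ln1Dx; lra.
  rewrite (_ : 1 + 1 = 2 :> R); lra.
pose lo := Num.min ((1 : R) `^ (- a)) (4 `^ (- a)) * Num.min (ln 2 `^ s) (4 `^ s).
pose hi := Num.max ((1 : R) `^ (- a)) (4 `^ (- a)) * Num.max (ln 2 `^ s) (4 `^ s).
exists lo, hi; split.
- by rewrite mulr_gt0 // lt_min !powR_gt0.
- by rewrite mulr_gt0 // lt_max !powR_gt0.
move=> k m m0 mk km.
have mr : (0 : R) < m%:R by rewrite ltr0n.
have kp : (0 < k)%N by apply: leq_trans mk; rewrite muln_gt0 m0 expn_gt0.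
have kr : (0 : R) < k%:R by rewrite ltr0n.
pose X : R := m%:R * 2 ^+ m; have X0 : 0 < X by rewrite mulr_gt0 // exprn_gt0.
have h1 : 1 * X <= k%:R by rewrite mul1r /X -natrX -natrM ler_nat.
have k4 : (k <= 4 * (m * 2 ^ m))%N.
  apply: leq_trans (ltnW km) _; rewrite expnS; have := expn_gt0 2 m; nia.
have h2 : k%:R <= 4 * X by rewrite /X -natrX -!natrM ler_nat.
have lk1 : ln 2 * m%:R <= ln k%:R :> R.
  rewrite mulrC -ln_powR ler_ln ?posrE ?powR_gt0 //.
  rewrite powR_mulrn // -natrX ler_nat; apply: leq_trans mk.
  by rewrite leq_pmull.
have lk2 : ln k%:R <= 4 * m%:R :> R.
  apply: (@le_trans _ _ (ln (2 `^ (4 * m%:R)))).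
    rewrite ler_ln ?posrE ?powR_gt0 // -natrM powR_mulrn // -natrX ler_nat.
    apply: leq_trans k4 _; rewrite (_ : 4 * m = 2 + m + m + (m + m - 2))%N; last by lia.
    rewrite !expnD; have h := ltn_expl m (isT : (1 < 2)%N).
    have h3 : (m * 2 ^ m <= 2 ^ m * 2 ^ m)%N by rewrite leq_mul2r ltnW ?orbT.
    apply: (@leq_trans (2 ^ 2 * (2 ^ m * 2 ^ m))%N); first by rewrite leq_mul2l h3 orbT.
    by rewrite mulnA leq_pmulr // expn_gt0.
  rewrite ln_powR -[leRHS]mulr1 ler_wpM2l ?mulr_ge0 //.
  have : ln (1 + 1 : R) <= 1 by apply: le_ln1Dx; lra.
  by rewrite (_ : 1 + 1 = 2 :> R) //; lra.
have [A1 A2] := @pow_between (- a) 1 4 X k%:R ltr01 (ltac:(lra)) X0 h1 h2.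
have [B1 B2] := @pow_between s (ln 2) 4 m%:R (ln k%:R) l2 l4 mr lk1 lk2.
have E : X `^ (- a) * m%:R `^ s = 2 `^ (- (a * m%:R)) * m%:R `^ b.
  rewrite /X powRM ?exprn_ge0 // -powR_mulrn // -powRrM.
  rewrite mulrAC -powRD ?(gt_eqF mr) ?implybT // mulrC; congr (_ `^ _ * _ `^ _); rewrite /s; ring.
have lnk0 : 0 < ln k%:R :> R by apply: lt_le_trans lk1; rewrite mulr_gt0.
split.
  rewrite -E /rate /lo mulrACA; apply: ler_pM => //.
  - by rewrite mulr_ge0 ?powR_ge0 // le_min !powR_ge0.
  - by rewrite mulr_ge0 ?powR_ge0 // le_min !powR_ge0.
rewrite -E /rate /hi mulrACA; apply: ler_pM => //; exact: powR_ge0.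
Qed.

End Numeric.

(** * Allocation of precision among the blocks and the total number of bits *)

Section Weights.
Variable R : realType.
Variable c8 : R.
Implicit Types (a b w x y : R).

Lemma dist_le n m : (n <= m)%N -> m = (n + dist n m)%N.
Proof. by rewrite /dist; lia. Qed.

Lemma dist_ge n m : (m <= n)%N -> n = (m + dist n m)%N.
Proof. by rewrite /dist; lia. Qed.

Lemma pow2_exp x : 2 `^ x = expR (x * ln 2) :> R.
Proof. by rewrite powRE // ltr0n. Qed.

Definition bits n w : R := c8 * cross_size R n * (ln (1 + w) / w + ln (1 + w^-1)).

Lemma bits_ge0 n w : 0 <= c8 -> 0 < w -> 0 <= bits n w.
Proof.
move=> c80 w0; have iw : 0 < w^-1 by rewrite invr_gt0.
have l1 : 0 <= ln (1 + w) by rewrite ln_ge0; lra.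
have l2 : 0 <= ln (1 + w^-1) by rewrite ln_ge0; lra.
apply: mulr_ge0; first by rewrite mulr_ge0 // /cross_size mulr_ge0 // exprn_ge0.
apply: addr_ge0; last exact: l2.
exact: (divr_ge0 l1 (ltW w0)).
Qed.

(* Precision, relative to the size of block n, with which block n is coded when 2^k balls are
   available, k being about m 2^m: finer below the critical level m and coarser above it, so
   that both the bits and the errors decay geometrically in [dist n m]. *)
Definition weight a (eta B : R) m n : R :=
  B * (if (n <= m)%N then 2 `^ (- ((a + 1) * (dist n m)%:R)) else 2 `^ ((1 + eta) * (dist n m)%:R)).

Lemma weight_gt0 a eta B m n : 0 < B -> 0 < weight a eta B m n.
Proof. by move=> B0; rewrite /weight mulr_gt0 //; case: ifP => _; rewrite powR_gt0. Qed.

Lemma weight_pow a eta B m n s : 0 < B -> weight a eta B m n `^ s =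
  B `^ s * (if (n <= m)%N then 2 `^ (- ((a + 1) * (dist n m)%:R * s))
            else 2 `^ ((1 + eta) * (dist n m)%:R * s)).
Proof.
move=> B0; rewrite /weight; case: ifP => _; rewrite powRM ?(ltW B0) ?powR_ge0 // -powRrM //.
by rewrite mulNr.
Qed.

Lemma weight_bits_sum a eta : 0 <= c8 -> 0 < a -> 0 < eta -> eta <= 1 -> exists B : R, 1 <= B /\
  forall m N, (0 < m)%N -> \sum_(1 <= n < N) bits n (weight a eta B m n) <= (m * 2 ^ m)%:R * ln 2.
Proof.
move=> c80 a0 e0 e1.
have l2 : 0 < ln (2 : R) by rewrite ln_gt0 // ltr1n.
(* With d = |n - m|, below m the exponent g1 gives w^(-g1) the factor 2^(d/2) against a dimension
   smaller by 2^(-d); above m, g2 gives 2^(-(1 + eta/2) d) against 2^d. Both products decay at least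
   like 2^(-eta d / 2). *)
pose g1 := 1 / (2 * (a + 1)); pose g2 := (1 + eta / 2) / (1 + eta).
have a1 : 0 < 2 * (a + 1) by lra.
have ee : 0 < 1 + eta by lra.
have g10 : 0 < g1 by rewrite divr_gt0.
have g1h : g1 < 1 / 2 by rewrite /g1 ltr_pdivrMr //; lra.
have g2h : 1 / 2 < g2 by rewrite /g2 ltr_pdivlMr //; lra.
have g21 : g2 < 1 by rewrite /g2 ltr_pdivrMr //; lra.
pose K1 := 2 / (1 - g1) + 2 / g1 + 2; pose K2 := 2 / (1 - g2) + 2 / g2 + 2.
have K10 : 0 < K1 by rewrite !addr_gt0 ?divr_gt0 //; lra.
have K20 : 0 < K2 by rewrite !addr_gt0 ?divr_gt0 //; lra.
pose K := K1 + K2.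
have [S [S0 hS]] := @sum_poly_exp R 1 (eta / 2 * ln 2) ler01 (mulr_gt0 (divr_gt0 e0 (ltr0n _ 2)) l2).
pose X := Num.max 1 (c8 * 2 * K * (2 * S) / ln 2).
have X1 : 1 <= X by rewrite /X le_max lexx.
have X2 : c8 * 2 * K * (2 * S) / ln 2 <= X by rewrite /X le_max lexx orbT.
have X0 : 0 < X by lra.
(* Then B^(-g1) = 1 / X, and X is large enough to bring the whole sum below m 2^m ln 2; since g1 <=
   g2 and B >= 1, the same gain holds for g2. *)
pose B := X `^ (g1^-1).
have B1 : 1 <= B.
  by rewrite -(powRr0 X) /B; apply: ler_powR => //; rewrite invr_ge0 ltW.
have B0 : 0 < B by lra.
have Bg : B `^ (- g1) = X^-1.
  by rewrite /B -powRrM mulrN mulVf ?gt_eqF // powR_inv1 // ltW.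
exists B; split => // m N m0.
pose E : R := m%:R * 2 ^+ m; have E0 : 0 < E by rewrite mulr_gt0 ?ltr0n // exprn_gt0.
pose psi d : R := d.+1%:R `^ 1 * expR (- (eta / 2 * ln 2 * d%:R)).
apply: (@le_trans _ _ (\sum_(1 <= n < N) c8 * 2 * K * E * X^-1 * psi (dist n m))); last first.
  rewrite -mulr_sumr.
  have hd := @sum_dist R psi S m N (fun d => mulr_ge0 (powR_ge0 _ _) (expR_ge0 _)) hS.
  have iX : 0 < X^-1 by rewrite invr_gt0.
  have F0 : 0 <= c8 * 2 * K * E * X^-1.
    by rewrite !mulr_ge0 ?(ltW E0) ?(ltW iX) // /K; lra.
  apply: (le_trans (ler_wpM2l F0 hd)).
  rewrite natrM natrX -/E mulrAC ler_pdivrMr //.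
  rewrite ler_pdivrMr // in X2.
  have -> : c8 * 2 * K * E * (2 * S) = E * (c8 * 2 * K * (2 * S)) by ring.
  by rewrite -[leRHS]mulrA ler_pM2l // [leRHS]mulrC.
apply: ler_sum => n _.
set d := dist n m.
have w0 := weight_gt0 a eta m n B0.
have psiE : psi d = d.+1%:R * 2 `^ (- (eta / 2 * d%:R)).
  rewrite /psi powRr1 // pow2_exp; congr (_ * expR _); ring.
have d0 : (0 : R) <= d%:R by [].
have dp : (0 : R) < d.+1%:R by rewrite ltr0n.
have two0 : (2 : R) != 0 by [].
have cs := @cross_size_dist R n m m0; rewrite -/d -/E in cs.
have cs0 : 0 <= cross_size R n by rewrite /cross_size mulr_ge0 // exprn_ge0.
have iX : 0 < X^-1 by rewrite invr_gt0.
have key (g L e : R) : 0 < g -> g < 1 -> g1 <= g -> 2 / (1 - g) + 2 / g + 2 <= K ->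
    weight a eta B m n `^ (- g) = B `^ (- g) * 2 `^ e ->
    cross_size R n <= 2 * d.+1%:R * E * 2 `^ L -> L + e <= - (eta / 2 * d%:R) ->
    bits n (weight a eta B m n) <= c8 * 2 * K * E * X^-1 * psi d.
  move=> g0 g1' gg KK we cs' Le; rewrite /bits.
  have rb := ratio_bits_le g0 g1' w0.
  have Bg' : B `^ (- g) <= X^-1 by rewrite -Bg; apply: ler_powR => //; lra.
  have rb2 : ln (1 + weight a eta B m n) / weight a eta B m n + ln (1 + (weight a eta B m n)^-1) <= K * (X^-1 * 2 `^ e).
    apply: le_trans rb _; apply: ler_pM => //; last by rewrite we ler_wpM2r // powR_ge0.
    - by rewrite !addr_ge0 ?divr_ge0 ?(ltW g0) // subr_ge0 ltW.
    - exact: powR_ge0.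
  apply: (@le_trans _ _ (c8 * cross_size R n * (K * (X^-1 * 2 `^ e)))).
    by rewrite ler_wpM2l // mulr_ge0.
  apply: (@le_trans _ _ (c8 * (2 * d.+1%:R * E * 2 `^ L) * (K * (X^-1 * 2 `^ e)))).
    rewrite ler_wpM2r //; first by rewrite !mulr_ge0 ?powR_ge0 ?(ltW iX) // /K; lra.
    by rewrite ler_wpM2l.
  have -> : c8 * (2 * d.+1%:R * E * 2 `^ L) * (K * (X^-1 * 2 `^ e)) =
    c8 * 2 * K * E * X^-1 * (d.+1%:R * (2 `^ L * 2 `^ e)) by ring.
  rewrite -powRD ?two0 ?implybT // psiE ler_wpM2l //.
    by rewrite !mulr_ge0 ?(ltW E0) ?(ltW iX) // /K; lra.
  by rewrite ler_wpM2l //; apply: ler_powR => //; lra.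
have [nm|nm] := boolP (n <= m)%N.
  apply: (key g1 (- d%:R) ((a + 1) * d%:R * g1)) => //; first lra.
  - by rewrite /K -/K1; lra.
  - by rewrite weight_pow // nm -/d; congr (_ * 2 `^ _); ring.
  - by rewrite nm in cs.
  - have -> : (a + 1) * d%:R * g1 = d%:R / 2.
      by rewrite /g1; field; rewrite gt_eqF //; lra.
    nra.
apply: (key g2 (d%:R) (- ((1 + eta) * d%:R * g2))) => //; first lra.
- lra.
- by rewrite /K -/K2; lra.
- by rewrite weight_pow // (negbTE nm) -/d; congr (_ * 2 `^ _); ring.
- by rewrite (negbTE nm) in cs.
have -> : (1 + eta) * d%:R * g2 = (1 + eta / 2) * d%:R.
  by rewrite /g2; field; rewrite gt_eqF //; lra.
lra.
Qed.

End Weights.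

(** * Summation of the block errors *)

Section BlockErrors.
Variable R : realType.

(** The size of block n times an estimate of [block_coding]: the linear one in w up to the level m,
    the interpolated one, with exponent [tau * th], beyond it. *)
Definition block_error a b (tau th eta B C : R) m n : R :=
  2 `^ (- (a * n%:R)) * n%:R `^ b *
  (C * (if (n <= m)%N then weight a eta B m n else weight a eta B m n `^ (tau * th))).

Lemma error_sum (a b tau th eta B C : R) : 0 < a -> 0 <= th -> th <= 1 -> 0 <= tau -> tau <= 1 + eta ->
  0 < eta -> eta <= 1 -> (1 + eta) ^+ 2 * th < a -> 1 <= B -> 0 < C ->
  exists K : R, 0 < K /\ forall m N, (0 < m)%N ->
    \sum_(1 <= n < N) block_error a b tau th eta B C m n <= K * (2 `^ (- (a * m%:R)) * m%:R `^ b).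
Proof.
move=> a0 th0 th1 tau0 tau1 e0 e1 sa B1 C0.
have l2 : 0 < ln (2 : R) by rewrite ln_gt0 // ltr1n.
have B0 : 0 < B by lra.
(* The decay rate in |n - m|: below m it is (a + 1) - a = 1, above m it is a - (1 + eta)^2 th. *)
pose kap := Num.min 1 (a - (1 + eta) ^+ 2 * th).
have kap0 : 0 < kap by rewrite /kap lt_min ltr01 subr_gt0.
have kap1 : kap <= 1 by rewrite /kap ge_min lexx.
have kap2 : kap <= a - (1 + eta) ^+ 2 * th by rewrite /kap ge_min lexx orbT.
have [S [S0 hS]] := @sum_poly_exp R `|b| (kap * ln 2) (normr_ge0 _) (mulr_gt0 kap0 l2).
exists (C * B ^+ 2 * (2 * S)); split; first by rewrite !mulr_gt0 // exprn_gt0.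
move=> m N m0.
pose Y : R := 2 `^ (- (a * m%:R)) * m%:R `^ b.
have Y0 : 0 <= Y by rewrite mulr_ge0 ?powR_ge0.
pose psi d : R := d.+1%:R `^ `|b| * expR (- (kap * ln 2 * d%:R)).
have hd := @sum_dist R psi S m N (fun d => mulr_ge0 (powR_ge0 _ _) (expR_ge0 _)) hS.
apply: (@le_trans _ _ (\sum_(1 <= n < N) C * B ^+ 2 * Y * psi (dist n m))); last first.
  rewrite -mulr_sumr -/Y.
  have F0 : 0 <= C * B ^+ 2 * Y by rewrite !mulr_ge0 ?(ltW C0) ?(ltW B0).
  by apply: le_trans (ler_wpM2l F0 hd) _; rewrite le_eqVlt; apply/orP; left; apply/eqP; ring.
rewrite big_nat [leRHS]big_nat; apply: ler_sum => n /andP[n1 _].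
set d := dist n m.
have psiE : psi d = d.+1%:R `^ `|b| * 2 `^ (- (kap * d%:R)).
  rewrite /psi pow2_exp; congr (_ * expR _); ring.
have d0 : (0 : R) <= d%:R by [].
have two0 : (2 : R) != 0 by [].
have nb := pow_shift b n1 m0; rewrite -/d in nb.
have B12 : B <= B ^+ 2 by rewrite expr2; nra.
have key (x : R) (L e : R) : 0 <= x -> x <= B ^+ 2 * 2 `^ e -> - (a * n%:R) = - (a * m%:R) + L ->
   L + e <= - (kap * d%:R) ->
   2 `^ (- (a * n%:R)) * n%:R `^ b * (C * x) <= C * B ^+ 2 * Y * psi d.
  move=> x0 xe -> Le; rewrite powRD ?two0 ?implybT //.
  apply: (@le_trans _ _ (2 `^ (- (a * m%:R)) * 2 `^ L * (m%:R `^ b * d.+1%:R `^ `|b|) * (C * (B ^+ 2 * 2 `^ e)))).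
    apply: ler_pM.
    - by rewrite !mulr_ge0 ?powR_ge0.
    - by rewrite mulr_ge0 // ltW.
    - by rewrite ler_wpM2l // mulr_ge0 ?powR_ge0.
    - by rewrite ler_wpM2l // ltW.
  have -> : 2 `^ (- (a * m%:R)) * 2 `^ L * (m%:R `^ b * d.+1%:R `^ `|b|) * (C * (B ^+ 2 * 2 `^ e)) =
    C * B ^+ 2 * Y * (d.+1%:R `^ `|b| * (2 `^ L * 2 `^ e)) by rewrite /Y; ring.
  rewrite -powRD ?two0 ?implybT // psiE ler_wpM2l //.
    by rewrite !mulr_ge0 ?(ltW C0) ?(ltW B0).
  by rewrite ler_wpM2l ?powR_ge0 //; apply: ler_powR => //; lra.
rewrite /block_error; have w0 := weight_gt0 a eta m n B0.
have [nm|nm] := boolP (n <= m)%N.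
  have nd : n%:R = m%:R - d%:R :> R.
    have -> : m%:R = n%:R + d%:R :> R by rewrite -natrD -dist_le.
    by rewrite addrK.
  apply: (key _ (a * d%:R) (- ((a + 1) * d%:R))); first exact: ltW.
  - by rewrite /weight nm ler_wpM2r ?powR_ge0.
  - by rewrite nd; ring.
  - nra.
have nm' : (m <= n)%N by rewrite ltnW // ltnNge.
have nd : n%:R = m%:R + d%:R :> R.
  by rewrite -natrD -dist_ge.
apply: (key _ (- (a * d%:R)) ((1 + eta) ^+ 2 * th * d%:R)); first exact: powR_ge0.
- have tt : tau * th <= (1 + eta) * th by rewrite ler_wpM2r.
  have tt0 : 0 <= tau * th by rewrite mulr_ge0.
  rewrite weight_pow // (negbTE nm) -/d; apply: ler_pM; rewrite ?powR_ge0 //.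
    by rewrite -powR_mulrn ?(ltW B0) //; apply: ler_powR => //; nra.
  apply: ler_powR; first by rewrite ler1n.
  have : 0 <= (1 + eta) * d%:R by rewrite mulr_ge0 //; lra.
  move=> h; have := ler_wpM2l h tt; rewrite expr2; lra.
- by rewrite nd; ring.
nra.
Qed.

End BlockErrors.

(** * The upper bound for synthesizable classes *)

Section Upper.
Variable R : realType.
Local Notation plane := (measurableTypeR R * measurableTypeR R)%type.
Local Notation func := (plane -> R[i]).

(** Applied to the bits with e = ln 2: sufficiently far blocks have fewer than two codes, which is
    the hypothesis [M_tail]. *)
Lemma bounded_sum_tail (r : nat -> R) S e : (forall n, 0 <= r n) ->
  (forall N, \sum_(1 <= n < N) r n <= S) -> 0 < e -> exists n0, forall n, (n0 < n)%N -> r n < e.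
Proof.
move=> r0 rS e0.
have cv : cvgn (series r).
  apply: nondecreasing_is_cvgn.
    by apply/nondecreasing_seqP => n; rewrite /series /= big_nat_recr //= lerDl.
  exists (r 0%N + S) => _ [N _ <-]; rewrite /series /=.
  case: N => [|N]; last by rewrite big_ltn // lerD2l.
  by rewrite big_geq // addr_ge0 //; have := rS 0%N; rewrite big_geq.
have := cvg_series_cvg_0 cv => /cvgrPdist_lt /(_ e e0) [n0 _ hn0].
exists n0 => n nn; have := hn0 n (ltnW nn); rewrite /= sub0r normrN; apply: le_lt_trans; exact: ler_norm.
Qed.

Lemma prod_expR (M : nat -> nat) (r : nat -> R) n0 : (forall n, (M n)%:R <= expR (r n)) ->
  (\prod_(1 <= n < n0) M n)%:R <= expR (\sum_(1 <= n < n0) r n).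
Proof.
move=> h; elim: n0 => [|n0 ih]; first by rewrite !big_geq // expR0.
case: n0 ih => [|n0] ih; first by rewrite !big_geq // expR0.
by rewrite !(big_nat_recr n0.+1) //= natrM expRD; apply: ler_pM.
Qed.

Lemma entropy_upper (p a b c : R) : 1 <= p -> 1 - p^-1 < a -> 0 < c -> exists C : R, 0 < C /\
  forall A k, (2 <= k)%N ->
  A `<=` synthesizable (fun n => cross_cball n (c * (2 `^ (- (a * n%:R)) * (maxn n 1)%:R `^ b))) ->
  (entropyL p%:E A k <= (C * rate a b k)%:E)%E.
Proof.
move=> p1 pa c0; pose th := 1 - p^-1.
have p0 : 0 < p by lra.
have ip1 : p^-1 <= 1 by rewrite invf_le1.
have ip0 : 0 < p^-1 by rewrite invr_gt0.
have th0 : 0 <= th by rewrite /th; lra.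
have th1 : th <= 1 by rewrite /th; lra.
have a0 : 0 < a by apply: le_lt_trans pa.
(* As eta and th are at most 1, (1 + eta)^2 th <= th + 3 eta <= th + 3 (a - th) / 4 < a. *)
pose eta := Num.min 1 ((a - th) / 4).
have e0 : 0 < eta by rewrite /eta lt_min ltr01 divr_gt0 // subr_gt0.
have e1 : eta <= 1 by rewrite /eta ge_min lexx.
have e2 : eta <= (a - th) / 4 by rewrite /eta ge_min lexx orbT.
have sa : (1 + eta) ^+ 2 * th < a by rewrite expr2; nra.
have ie : 0 < eta^-1 by rewrite invr_gt0.
(* The moment order mm = 2 (m0 + 1) exceeds p and 1 + 1 / eta; the latter makes tau = mm / (mm - 1)
   at most 1 + eta. *)
pose m0 := Num.trunc (p + eta^-1).
have hm0 : p + eta^-1 < m0.+1%:R.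
  by have /andP[] := truncn_itv (ltW (addr_gt0 p0 ie)).
pose mm : R := (2 * m0.+1)%:R.
have mmE : mm = 2 * m0.+1%:R by rewrite /mm natrM.
have pm : p <= mm by rewrite mmE; lra.
have mm1 : 1 < mm by rewrite mmE; lra.
pose tau := mm / (mm - 1).
have tau0 : 0 <= tau by rewrite divr_ge0; lra.
have tau1 : tau <= 1 + eta.
  rewrite /tau ler_pdivrMr ?subr_gt0 //.
  have : 1 <= eta * (mm - 1).
    rewrite mulrC -ler_pdivrMr // mul1r mmE; lra.
  lra.
have [C0 [C00 cod]] := @block_coding R p m0 p1 pm.
have c8 : 0 <= (8192 : R) by exact: ler0n.
have [B [B1 bsum]] := weight_bits_sum c8 a0 e0 e1.
have B0 : 0 < B by exact: lt_le_trans ltr01 B1.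
have [K [K0 esum]] := @error_sum R a b tau th eta B C0 a0 th0 th1 tau0 tau1 e0 e1 sa B1 C00.
have [c1 [c2 [c10 c20 rl]]] := @rate_level R a b a0.
exists (c * K / c1); split; first by rewrite !mulr_gt0 // invr_gt0.
move=> A k k2 AB.
have [m [m1 mk km]] := level_exists k2.
pose w n := weight a eta B m n.
have w0 n : 0 < w n by exact: weight_gt0.
pose Y n : R := c * (2 `^ (- (a * n%:R)) * (maxn n 1)%:R `^ b).
have Y0 n : 0 < Y n by rewrite /Y !mulr_gt0 // powR_gt0 // ltr0n leq_max orbT.
have [M hM] := choice (fun n => cod n (w n) (Y n) (w0 n) (Y0 n)).
have [code hc] := choice hM.
pose e n : R := Y n * (C0 * (if (n <= m)%N then w n else w n `^ (tau * th))).
have Me n : (M n)%:R <= expR (bits 8192 n (w n)) by have [h _ _] := hc n.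
have [n0 hn0] := @bounded_sum_tail (fun n => bits 8192 n (w n)) _ (ln 2)
  (fun n => bits_ge0 n c8 (w0 n)) (fun N => bsum m N m1) (ln_gt0 (ltr1n R 2)).
apply: (@le_trans _ _ (c * (K * (2 `^ (- (a * m%:R)) * m%:R `^ b)))%:E).
  apply: (@entropy_le R p p1 (fun n => cross_cball n (Y n)) M code e _ k n0) => //.
  - by move=> n t [tt _]; exact: trig_poly_cnice (finite_Q n) tt.
  - move=> n; split.
      exists (fun=> 0); apply/funext => x; rewrite fsbig1 // => i _; exact: mul0r.
    by rewrite normL0 // lee_fin ltW.
  - by move=> n t bt; have [_ h _] := hc n; exact: h.
  - move=> n t s bt bs ts; have [_ _ h] := hc n; have [h1 h2] := h t s bt bs ts.
    by rewrite /e; case: ifP.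
  - rewrite -(ler_nat R); apply: le_trans (prod_expR _ Me) _.
    apply: (@le_trans _ _ (2 ^ (m * 2 ^ m))%:R); last by rewrite ler_nat leq_pexp2l.
    rewrite natrX -powR_mulrn // pow2_exp ler_expR; exact: bsum.
  - move=> n nn; rewrite -ltnS -(ltr_nat R); apply: le_lt_trans (Me n) _.
    by rewrite -[ltRHS]lnK ?posrE // ltr_expR; exact: hn0.
  - move=> N; rewrite (_ : \sum_(1 <= n < N.+1) e n = c * \sum_(1 <= n < N.+1) block_error a b tau th eta B C0 m n).
      by rewrite ler_pM2l //; exact: esum.
    rewrite big_distrr /= !big_nat; apply: eq_bigr => n /andP[n1 _].
    rewrite /e /Y /block_error /w; have -> : maxn n 1 = n by apply/maxn_idPl.
    by rewrite !mulrA.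
have [h _] := rl k m m1 mk km.
rewrite lee_fin (_ : c * K / c1 * rate a b k = c * (K * (rate a b k / c1))); last by rewrite mulrAC !mulrA.
by rewrite ler_pM2l // ler_pM2l // ler_pdivlMr // mulrC.
Qed.

End Upper.

(** * Lower bound *)

Section FourierTrig.
Variable R : realType.
Local Notation plane := (measurableTypeR R * measurableTypeR R)%type.
Local Notation func := (plane -> R[i]).
Local Notation mu := (torus_measure R).
Local Notation normc := (ComplexField.Normc.normc).

Lemma expiD (s t : R) : expi (s + t) = expi s * expi t.
Proof. rewrite /expi cosD sinD; apply/eqP; rewrite eq_complex /= eqxx /=; apply/eqP; ring. Qed.

Lemma normc_expi (t : R) : normc (expi t) = 1.
Proof. by rewrite normc_sqrt /= cos2Dsin2 sqrtr1. Qed.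

Lemma dotB (k q : int * int) (x : plane) : dot (k - q) x = dot k x - dot q x.
Proof. by case: k q => [k1 k2] [q1 q2]; rewrite /dot /= !rmorphB /=; ring. Qed.

Lemma mean_expi (k : int * int) (c : R[i]) :
  mean (fun x => complex.Re (c * expi (dot k x))) = (if k == 0 then complex.Re c else 0) /\
  mean (fun x => complex.Im (c * expi (dot k x))) = (if k == 0 then complex.Im c else 0).
Proof.
have n1 := nice_wave k (0 : R); have n2 := nice_wave k (- (pi / 2) : R).
have E1 : mean (wave k (0 : R)) = if k == 0 then 1 else 0 by rewrite mean_wave cos0.
have E2 : mean (wave k (- (pi / 2) : R)) = 0 by rewrite mean_wave cosN cos_pihalf; case: ifP.
split.
  rewrite (_ : (fun x => _) = fun x => complex.Re c * wave k 0 x - complex.Im c * wave k (- (pi / 2)) x).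
    rewrite meanB ?meanZ ?E1 ?E2 //; try exact: niceZ.
    by case: ifP => _; ring.
  by apply/funext => x; rewrite expiE; exact: cReM.
rewrite (_ : (fun x => _) = fun x => complex.Re c * wave k (- (pi / 2)) x + complex.Im c * wave k 0 x).
  rewrite meanD ?meanZ ?E1 ?E2 //; try exact: niceZ.
  by case: ifP => _; ring.
by apply/funext => x; rewrite expiE; exact: cImM.
Qed.

Definition tsum (I : Type) (s : seq I) (g : I -> int * int) (c : I -> R[i]) : func :=
  fun x => \sum_(i <- s) c i * expi (dot (g i) x).

Lemma cnice_expi (k : int * int) (c : R[i]) : cnice (fun x => c * expi (dot k x)).
Proof.
have n1 := nice_wave k (0 : R); have n2 := nice_wave k (- (pi / 2) : R).
split; under eq_fun do rewrite expiE ?cReM ?cImM.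
  by apply: niceB; exact: niceZ.
by apply: niceD; exact: niceZ.
Qed.

Lemma tsum_cnice (I : Type) (s : seq I) g (c : I -> R[i]) : cnice (tsum s g c).
Proof. by apply: cnice_sum => i; exact: cnice_expi. Qed.

Lemma fourier_tsum (I : Type) (s : seq I) g (c : I -> R[i]) q :
  fourier (tsum s g c) q = \sum_(i <- s | g i == q) c i.
Proof.
have E x : tsum s g c x * expi (- dot q x) = \sum_(i <- s) c i * expi (dot (g i - q) x).
  rewrite /tsum mulr_suml; apply: eq_bigr => i _.
  by rewrite -mulrA -expiD dotB.
have ni i := cnice_expi (g i - q) (c i).
have Emean i := mean_expi (g i - q) (c i).
apply/eqP; rewrite eq_complex; apply/andP; split; apply/eqP.
  rewrite [LHS](_ : _ = mean (fun x => \sum_(i <- s) complex.Re (c i * expi (dot (g i - q) x)))); last first.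
    by rewrite /fourier /cintegral /=; congr Rintegral; apply/funext => x; rewrite E cRe_sum.
  rewrite mean_sum; last by move=> i; case: (ni i).
  rewrite cRe_sum [RHS]big_mkcond; apply: eq_bigr => i _; have [-> _] := Emean i.
  by rewrite subr_eq0.
rewrite [LHS](_ : _ = mean (fun x => \sum_(i <- s) complex.Im (c i * expi (dot (g i - q) x)))); last first.
  by rewrite /fourier /cintegral /=; congr Rintegral; apply/funext => x; rewrite E cIm_sum.
rewrite mean_sum; last by move=> i; case: (ni i).
rewrite cIm_sum [RHS]big_mkcond; apply: eq_bigr => i _; have [_ ->] := Emean i.
by rewrite subr_eq0.
Qed.

Lemma mem_enum_fset_set (K : set (int * int)) k : finite_set K ->
  (k \in finmap.enum_fset (fset_set K)) = (k \in K).
Proof. by move=> fK; rewrite -(in_fset_set fK). Qed.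

Lemma trig_polyP K (f : func) : finite_set K ->
  trig_poly K f <-> exists c, f = tsum (finmap.enum_fset (fset_set K)) id c.
Proof.
move=> fK; split=> -[c ->]; exists c; apply/funext => x; rewrite /tsum.
  exact: fsbig_finite.
by rewrite fsbig_finite.
Qed.

Lemma trig_polyD K (f g : func) : finite_set K -> trig_poly K f -> trig_poly K g ->
  trig_poly K (fun x => f x + g x).
Proof.
move=> fK /(trig_polyP _ fK)[c ->] /(trig_polyP _ fK)[d ->]; apply/trig_polyP => //.
exists (fun k => c k + d k); apply/funext => x; rewrite /tsum -big_split /=.
by apply: eq_bigr => k _; rewrite mulrDl.
Qed.

Lemma trig_polyB K (f g : func) : finite_set K -> trig_poly K f -> trig_poly K g ->
  trig_poly K (fun x => f x - g x).
Proof.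
move=> fK /(trig_polyP _ fK)[c ->] /(trig_polyP _ fK)[d ->]; apply/trig_polyP => //.
exists (fun k => c k - d k); apply/funext => x; rewrite /tsum -sumrB /=.
by apply: eq_bigr => k _; rewrite mulrBl.
Qed.

Lemma trig_poly0 K : trig_poly K (fun=> 0 : R[i]).
Proof. by exists (fun=> 0); apply/funext => x; rewrite fsbig1 // => i _; exact: mul0r. Qed.

Lemma trig_poly_expi (K : set (int * int)) k (c : R[i]) : finite_set K -> K k ->
  trig_poly K (fun x => c * expi (dot k x)).
Proof.
move=> fK Kk; apply/trig_polyP => //; exists (fun q => if q == k then c else 0).
apply/funext => x; rewrite /tsum (bigD1_seq k) /=; last 2 first.
- by rewrite mem_enum_fset_set // inE.
- exact: finmap.fset_uniq.
by rewrite eqxx big1 ?addr0 // => q /negbTE ->; rewrite mul0r.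
Qed.

Lemma tsum_trig_poly (I : eqType) (s : seq I) g (c : I -> R[i]) K : finite_set K ->
  (forall i, i \in s -> K (g i)) -> trig_poly K (tsum s g c).
Proof.
move=> fK; elim: s => [|i s ih] h.
  have -> : tsum [::] g c = fun=> 0 by apply/funext => x; rewrite /tsum big_nil.
  exact: trig_poly0.
have -> : tsum (i :: s) g c = fun x => c i * expi (dot (g i) x) + tsum s g c x.
  by apply/funext => x; rewrite /tsum big_cons.
apply: trig_polyD => //; first by apply: trig_poly_expi => //; apply: h; rewrite inE eqxx.
by apply: ih => j js; apply: h; rewrite inE js orbT.
Qed.

Lemma trig_poly_subset K K' (f : func) : finite_set K' -> K `<=` K' -> trig_poly K f -> trig_poly K' f.
Proof.
move=> fK' KK'; have fK := sub_finite_set KK' fK'.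
move=> /(trig_polyP _ fK)[c ->]; apply: tsum_trig_poly => // k.
by rewrite mem_enum_fset_set // inE => /KK'.
Qed.

Lemma fourier_trig_poly K (c : int * int -> R[i]) q : finite_set K ->
  fourier (fun x => \sum_(k \in K) c k * expi (dot k x)) q = if `[< K q >] then c q else 0.
Proof.
move=> fK.
have -> : (fun x : plane => \sum_(k \in K) c k * expi (dot k x)) =
    tsum (finmap.enum_fset (fset_set K)) id c.
  by apply/funext => x; exact: fsbig_finite.
rewrite fourier_tsum /=; case: asboolP => Kq.
  rewrite -big_filter (_ : [seq i <- _ | i == q] = [:: q]) ?big_seq1 //.
  rewrite filter_pred1_uniq //; first exact: finmap.fset_uniq.
  by rewrite mem_enum_fset_set // inE.
rewrite big_seq_cond big1 // => k /andP[]; rewrite mem_enum_fset_set // inE => Kk /eqP kq.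
by case: Kq; rewrite -kq.
Qed.

Lemma normL1_bound (f : func) C : cnice f -> (forall x, normc (f x) <= C) -> (normL 1 f <= C%:E)%E.
Proof.
move=> nf fC.
have C0 : 0 <= C by apply: le_trans (fC (0, 0)); exact: normc_ge0.
have nC : cnice (fun=> (C +i* 0)%C) by split; exact: nice_cst.
apply: (@le_trans _ _ (normL 1 (fun=> (C +i* 0)%C))).
  apply: (@normL_le _ 1 _ _ ltr01 (cnice_cmeas nf) (cnice_cmeas nC)) => x.
  by rewrite [leRHS]normc_sqrt /= expr0n addr0 sqrtr_sqr; apply: le_trans (fC x) (ler_norm _).
rewrite normLE (_ : (fun x => _) = fun=> C).
  rewrite Np1_nice; last exact: nice_cst.
  by rewrite mean_cst ger0_norm.
by apply/funext => x; rewrite normc_sqrt /= expr0n addr0 sqrtr_sqr ger0_norm.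
Qed.

Lemma normL1_tsum (I : Type) (s : seq I) g (c : I -> R[i]) :
  (normL 1 (tsum s g c) <= (\sum_(i <- s) normc (c i))%:E)%E.
Proof.
apply: normL1_bound => [|x]; first exact: tsum_cnice.
rewrite /tsum; elim: s => [|i s ih]; first by rewrite !big_nil ComplexField.Normc.normc0.
rewrite !big_cons; apply: le_trans (le_normcD _ _) _; apply: lerD => //.
by rewrite ComplexField.Normc.normcM normc_expi mulr1.
Qed.

Lemma Re_fourier_le (f : func) q e : cnice f -> (normL 1 f <= e%:E)%E ->
  `|complex.Re (fourier f q)| <= e.
Proof.
move=> nf fe.
pose g x := f x * expi (- dot q x).
have ng : cnice g.
  have dN x : - dot q x = dot (- q) x by case: (q) => q1 q2; rewrite /dot /= !rmorphN /=; ring.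
  have [e1 e2] := cnice_expi (- q) 1; case: nf => f1 f2.
  split; rewrite /g; under eq_fun do rewrite ?cReM ?cImM dN -[expi _]mul1r.
    by apply: niceB; apply: niceM.
  by apply: niceD; apply: niceM.
have -> : complex.Re (fourier f q) = mean (fun x => complex.Re (g x)) by [].
case: (ng) => g1 g2.
apply: le_trans (norm_mean g1) _; rewrite -lee_fin -Np1_nice //.
apply: le_trans (Np_Re _ _) _ => //; first exact: cnice_cmeas.
apply: le_trans fe; apply: normL_le => //; try exact: cnice_cmeas.
by move=> x; rewrite /g ComplexField.Normc.normcM normc_expi mulr1.
Qed.

End FourierTrig.

(** * Enumeration of the frequencies of a hyperbolic layer *)

Lemma in_dyadic_inj s s' k : in_dyadic s k -> in_dyadic s' k -> s = s'.
Proof.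
have gen u v : in_dyadic u k -> in_dyadic v k -> ~ (u < v)%N.
  move=> /andP[_ uk] /andP[vk _] uv.
  have : (2 ^ u <= 2 ^ v %/ 2)%N.
    by rewrite -(ltn_predK uv) expnS mulKn // leq_pexp2l // -ltnS (ltn_predK uv).
  by move=> h; have := leq_trans uk h; rewrite ltnNge vk.
by move=> sk s'k; case: (ltngtP s s') => //; [move/(gen _ _ sk s'k)|move/(gen _ _ s'k sk)].
Qed.

(** The first half of the indices gives the positive integers of the block, the second half the
    negative ones; for s = 0 the threshold is 0 and the only value is 0. *)
Definition dyadic_elt (s i : nat) : int := if (i < 2 ^ s %/ 2)%N then (2 ^ s %/ 2 + i)%N%:Z else - i%:Z.

Lemma dyadic_eltP s i : (i < 2 ^ s)%N -> in_dyadic s (dyadic_elt s i).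
Proof.
rewrite /in_dyadic /dyadic_elt; have := leq_divM (2 ^ s) 2; set h := (2 ^ s %/ 2)%N => hh.
move: (2 ^ s)%N h hh => M h hh iM.
by case: ltnP => hi; lia.
Qed.

Lemma dyadic_elt_inj s i i' : dyadic_elt s i = dyadic_elt s i' -> i = i'.
Proof. by rewrite /dyadic_elt; set h := (2 ^ s %/ 2)%N; case: ltnP => hi; case: ltnP => hi'; lia. Qed.

Definition hyper_layer (n : nat) : set (int * int) :=
  \bigcup_(s in [set s : nat * nat | (s.1 + s.2)%N = n]) rho s.

Lemma hyper_layer_sub m n : (m <= n)%N -> hyper_layer m `<=` Q n.
Proof. by move=> mn k [s /= sm sk]; exists s => //=; rewrite sm. Qed.

Lemma finite_hyper_layer n : finite_set (hyper_layer n).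
Proof. exact: sub_finite_set (hyper_layer_sub (leqnn n)) (finite_Q n). Qed.

(** The layer consists of n + 1 blocks of 2^n frequencies, whence the index set; within block s the
    number q.2 is written in base 2^(n-s). *)
Definition freq n (q : 'I_n.+1 * 'I_(2 ^ n)) : int * int :=
  (dyadic_elt q.1 (q.2 %/ 2 ^ (n - q.1)), dyadic_elt (n - q.1) (q.2 %% 2 ^ (n - q.1))).

Lemma freq_bounds n (q : 'I_n.+1 * 'I_(2 ^ n)) :
  in_dyadic q.1 (freq q).1 /\ in_dyadic (n - q.1) (freq q).2.
Proof.
have qn : (q.1 <= n)%N by rewrite -ltnS.
split; apply: dyadic_eltP; last by rewrite ltn_pmod // expn_gt0.
by rewrite ltn_divLR ?expn_gt0 // -expnD subnKC.
Qed.

Lemma freq_in n (q : 'I_n.+1 * 'I_(2 ^ n)) : hyper_layer n (freq q).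
Proof.
have [h1 h2] := freq_bounds q.
exists (nat_of_ord q.1, (n - q.1)%N) => //=; by rewrite subnKC // -ltnS.
Qed.

Lemma freq_inj n : injective (@freq n).
Proof.
move=> q r qr; have [q1 q2] := freq_bounds q; have [r1 r2] := freq_bounds r.
rewrite qr in q1 q2.
have e1 : q.1 = r.1 by apply/val_inj; exact: in_dyadic_inj q1 r1.
have [] : (freq q).1 = (freq r).1 /\ (freq q).2 = (freq r).2 by rewrite qr.
rewrite /freq e1 /= => /dyadic_elt_inj d1 /dyadic_elt_inj d2.
have e2 : q.2 = r.2.
  by apply/val_inj => /=; rewrite (divn_eq q.2 (2 ^ (n - r.1))) d1 d2 -divn_eq.
by case: q r e1 e2 {qr q1 q2 r1 r2 d1 d2} => [? ?] [? ?] /= -> ->.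
Qed.

(** * The counting argument on one layer *)

Section Lower.
Variable R : realType.
Local Notation plane := (measurableTypeR R * measurableTypeR R)%type.
Local Notation func := (plane -> R[i]).
Local Notation normc := (ComplexField.Normc.normc).

Lemma Re_mulrn (z : R[i]) m : complex.Re (z *+ m) = complex.Re z *+ m.
Proof. by elim: m => // m ih; rewrite !mulrS cReD ih. Qed.

(** Elements of the ball with the same code are at distance at most 2 eps, so twice their difference
    is again in the ball of radius r when 4 eps <= r; this is what allows iteration. *)
Lemma cover_bound (k n : nat) (eps r : R) (y : 'I_(2 ^ k) -> func) : (k < n.+1 * 2 ^ n)%N ->
  0 < r -> 4 * eps <= r -> (forall j, cmeasurable (y j)) ->
  (forall t, trig_poly (hyper_layer n) t -> (normL 1 t <= r%:E)%E ->
     exists j, (normL 1 (fun x => t x - y j x)%R <= eps%:E)%E) -> False.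
Proof.
move=> kK r0 epsr my cov; set D := hyper_layer n in cov.
have fD : finite_set D := finite_hyper_layer n.
pose U (t : func) := trig_poly D t /\ (normL 1 t <= r%:E)%E.
have Uc t : U t -> cnice t by case=> ? _; exact: trig_poly_cnice fD _.
have hc t : exists j, U t -> (normL 1 (fun x => t x - y j x)%R <= eps%:E)%E.
  have [Ut|nU] := pselect (U t); last by exists (Ordinal (expn_gt0 2 k : (0 < 2 ^ k)%N)).
  by have [j hj] := cov t Ut.1 Ut.2; exists j.
have [code hcode] := choice hc.
have U0 : U (fun=> 0).
  by split; [exact: trig_poly0|rewrite normL0 // lee_fin ltW].
have hr i : exists t, U t /\ forall s, U s -> code s = i -> code t = i.
  have [[s [Us si]]|ns] := pselect (exists s, U s /\ code s = i); first by exists s.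
  by exists (fun=> 0); split => // s Us si; case: ns; exists s.
have [rep hrep] := choice hr.
(* Equal codes give [phi t - phi s = 2 (t - s)]; hence j successive codes, which take at most
   2^(k j) values, determine an element up to 2^(1 - j) r. *)
pose phi (t : func) : func := fun x => (t x - rep (code t) x) + (t x - rep (code t) x).
have phiU t : U t -> U (phi t).
  move=> Ut; have [Ur hr'] := hrep (code t); have cr := hr' t Ut erefl.
  have d1 : trig_poly D (fun x => t x - rep (code t) x) by apply: trig_polyB; [|exact: Ut.1|exact: Ur.1].
  have c1 := trig_poly_cnice fD d1.
  split; first exact: trig_polyD.
  have n1 : (normL 1 (fun x => t x - rep (code t) x)%R <= (eps + eps)%:E)%E.
    rewrite (_ : (fun x : plane => _) = fun x => (t x - y (code t) x) - (rep (code t) x - y (code t) x)); last first.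
      by apply/funext => x; ring.
    have m1 := cmeasurableB (cnice_cmeas (Uc _ Ut)) (my (code t)).
    have m2 := cmeasurableB (cnice_cmeas (Uc _ Ur)) (my (code t)).
    apply: le_trans (@normLB _ 1 _ _ (lexx 1) m1 m2) _; rewrite EFinD; apply: leeD; first exact: hcode.
    by have := hcode _ Ur; rewrite cr.
  apply: le_trans (@normLD _ 1 _ _ (lexx 1) (cnice_cmeas c1) (cnice_cmeas c1)) _.
  apply: le_trans (leeD n1 n1) _; rewrite -EFinD lee_fin; lra.
have iterU t l : U t -> U (iter l phi t) by move=> Ut; elim: l => //= l; exact: phiU.
have iter_diff t s j : (forall l, (l < j)%N -> code (iter l phi t) = code (iter l phi s)) ->
    forall x, iter j phi t x - iter j phi s x = (t x - s x) *+ (2 ^ j).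
  elim: j => [|j ih] h x; first by rewrite mulr1n.
  rewrite /= {1 3}/phi (h j) // expnS mulnC mulrnA -ih; last by move=> l lj; apply: h; exact: ltnW.
  by rewrite mulr2n; ring.
pose I : finType := ('I_n.+1 * 'I_(2 ^ n))%type.
pose K := #|I|.
have KE : K = (n.+1 * 2 ^ n)%N by rewrite /K card_prod !card_ord.
have K0 : (0 < K)%N by rewrite KE muln_gt0 expn_gt0.
(* There are N^K = 2^(nu K) grid polynomials and at most 2^(k j) code sequences. Since 2^lam > 2K, j
   doublings carry distinct coefficients further apart than 2r allows; since nu > k lam and k < K, k
   (nu + lam) < nu K. *)
pose lam := (2 * K)%N; pose nu := (k * lam).+1; pose N := (2 ^ nu)%N; pose j := (nu + lam)%N.
have N0 : (0 < N)%N by rewrite expn_gt0.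
have NK0 : (0 : R) < (N * K)%:R by rewrite ltr0n muln_gt0 N0.
pose cf (z : {ffun I -> 'I_N}) (i : I) : R := r * (z i)%:R / (N * K)%:R.
pose P (z : {ffun I -> 'I_N}) : func := tsum (index_enum I) (@freq n) (fun i => (cf z i +i* 0)%C).
have PU z : U (P z).
  split; first by apply: tsum_trig_poly => // i _; exact: freq_in.
  apply: le_trans (normL1_tsum _ _ _) _; rewrite lee_fin.
  apply: (@le_trans _ _ (\sum_(i : I) r / K%:R)); last first.
    by rewrite sumr_const -[leLHS]mulr_natr -mulrA mulVf ?mulr1 // gt_eqF // ltr0n.
  apply: ler_sum => i _; rewrite normc_sqrt /= expr0n addr0 sqrtr_sqr /cf.
  rewrite ger0_norm; last by rewrite divr_ge0 ?mulr_ge0 // ltW.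
  rewrite ler_pdivrMr //; have -> : r / K%:R * (N * K)%:R = r * N%:R.
    by rewrite natrM; field; rewrite gt_eqF // ltr0n.
  by rewrite ler_pM2l // ler_nat ltnW.
pose codes z := [ffun l : 'I_j => code (iter l phi (P z))].
have inj : injective codes.
  move=> z z' zz'; apply/ffunP => i; apply/eqP; apply: contraT => zi.
  have same l : (l < j)%N -> code (iter l phi (P z)) = code (iter l phi (P z')).
    by move=> lj; have /ffunP /(_ (Ordinal lj)) := zz'; rewrite !ffunE.
  pose f x := iter j phi (P z) x - iter j phi (P z') x.
  have fU : (normL 1 f <= (r + r)%:E)%E.
    have [h1 h2] := (iterU _ j (PU z), iterU _ j (PU z')).
    apply: le_trans (@normLB _ 1 _ _ (lexx 1) (cnice_cmeas (Uc _ h1)) (cnice_cmeas (Uc _ h2))) _.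
    by rewrite EFinD; apply: leeD; [exact: h1.2|exact: h2.2].
  have fE : f = tsum (index_enum I) (@freq n) (fun i => ((cf z i - cf z' i) +i* 0)%C *+ (2 ^ j)).
    apply/funext => x; rewrite /f iter_diff // /P /tsum -sumrB -sumrMnl; apply: eq_bigr => i' _.
    rewrite mulrnAl -mulrBl; congr (_ * _ *+ _).
    by apply/eqP; rewrite eq_complex /= !subr0 !eqxx.
  have nf : cnice f by rewrite fE; exact: tsum_cnice.
  have := Re_fourier_le (freq i) nf fU; rewrite fE fourier_tsum.
  rewrite (eq_bigl (pred1 i)); last by move=> i' /=; rewrite (inj_eq (@freq_inj n)).
  rewrite big_pred1_eq Re_mulrn /= -mulr_natr normrM normr_nat /cf -mulrBl -mulrBr.
  rewrite !normrM (ger0_norm (ltW r0)) (gtr0_norm (_ : 0 < (N * K)%:R^-1)) ?invr_gt0 //.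
  have dz : (1 : R) <= `|(z i)%:R - (z' i)%:R|.
    have nz : (z i : nat) != z' i by rewrite -val_eqE in zi.
    have gen (u v : nat) : (u < v)%N -> (1 : R) <= `|v%:R - u%:R|.
      move=> uv; apply: le_trans (ler_norm _).
      by rewrite lerBrDr addrC natr1 ler_nat.
    by case: (ltngtP (z i) (z' i)) nz => // h _; [rewrite distrC|]; exact: gen.
  have big : (2 * N * K < 2 ^ j)%N.
    rewrite /j expnD -/N mulnAC mulnC ltn_pmul2l // /lam; exact: ltn_expl.
  move=> h; have : r * 1 / (N * K)%:R * (2 ^ j)%:R <= r + r.
    apply: le_trans h; rewrite ler_pM2r ?ltr0n ?expn_gt0 // ler_pM2r ?invr_gt0 // ler_pM2l //.
  have -> : r + r = r * 2 by ring.
  rewrite mulr1 -mulrA ler_pM2l // mulrC ler_pdivrMr // -natrM ler_nat.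
  by rewrite mulnA leqNgt big.
have := leq_card codes inj; rewrite !card_ffun !card_ord -/K -!expnM leq_exp2l //.
apply/negP; rewrite -ltnNge.
have kK' : (k < K)%N by rewrite KE.
apply: (@leq_trans (nu * k.+1)); last by rewrite leq_mul2l kK' orbT.
by rewrite /j mulnDr mulnS addnC [(nu * k)%N]mulnC ltn_add2r.
Qed.

Lemma entropy_lower (p a b : R) : 1 <= p -> 0 < a -> exists c : R, 0 < c /\ forall A k, (2 <= k)%N ->
  (forall n t, (1 <= n)%N -> trig_poly (hyper_layer n) t ->
     (normL 1 t <= (2 `^ (- (a * n%:R)) * n%:R `^ b)%:E)%E -> A t) ->
  ((c * rate a b k)%:E <= entropyL p%:E A k)%E.
Proof.
move=> p1 a0; have [c1 [c2 [c10 c20 rl]]] := @rate_level R a b a0.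
pose q := Num.min ((1 : R) `^ b) (2 `^ b) * 2 `^ (- a).
have q0 : 0 < q by rewrite mulr_gt0 ?powR_gt0 // lt_min !powR_gt0.
exists (q / (4 * c2)); split; first by rewrite divr_gt0 // mulr_gt0.
move=> A k k2 hA; have [m [m1 mk km]] := level_exists k2.
have mr : (0 : R) < m%:R by rewrite ltr0n.
(* The layer m + 1 is used, because k < (m+1) 2^(m+1) is below its dimension (m+2) 2^(m+1). *)
pose r : R := 2 `^ (- (a * m.+1%:R)) * m.+1%:R `^ b.
have r0 : 0 < r by rewrite mulr_gt0 ?powR_gt0 // ltr0n.
have u1 : 1 * m%:R <= (m.+1%:R : R) by rewrite mul1r ler_nat.
have u2 : (m.+1%:R : R) <= 2 * m%:R.
  by rewrite -natrM ler_nat mulSn mul1n -addn1 leq_add2l.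
have [h1 _] := pow_between b ltr01 (ler1n R 2) mr u1 u2.
have h2 : q * (2 `^ (- (a * m%:R)) * m%:R `^ b) <= r.
  rewrite /q /r (_ : - (a * m.+1%:R) = - a + - (a * m%:R)); last by rewrite -natr1; ring.
  rewrite powRD; last by rewrite (_ : (2 : R) != 0) ?implybT.
  have := ler_wpM2l (mulr_ge0 (powR_ge0 2 (- a)) (powR_ge0 2 (- (a * m%:R)))) h1.
  apply: le_trans; rewrite le_eqVlt; apply/orP; left; apply/eqP; ring.
have [_ h3] := rl k m m1 mk km.
have h4 : q / (4 * c2) * rate a b k <= r / 4.
  apply: (@le_trans _ _ (q / (4 * c2) * (c2 * (2 `^ (- (a * m%:R)) * m%:R `^ b)))).
    by rewrite ler_wpM2l // divr_ge0 ?mulr_ge0 // ltW.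
  have -> : q / (4 * c2) * (c2 * (2 `^ (- (a * m%:R)) * m%:R `^ b)) =
      q * (2 `^ (- (a * m%:R)) * m%:R `^ b) / 4 by field; rewrite gt_eqF.
  by rewrite ler_pM2r // invr_gt0.
apply: (@le_trans _ _ (r / 4)%:E); first by rewrite lee_fin.
apply: le_ereal_inf_tmp => _ [eps [y [Ly cov]] <-]; rewrite lee_fin.
rewrite leNgt; apply/negP => er.
apply: (@cover_bound k m.+1 eps r y) => //.
- by apply: ltn_trans km _; rewrite ltn_pmul2r ?expn_gt0.
- lra.
- by move=> j; have [_ ? _] := Ly j.
move=> t tt tr; have [j _ [Lt /= hj]] := cov t (hA m.+1 t (ltn0Sn m) tt tr).
exists j; apply: le_trans hj; apply: normL1_le => //.
have [_ m2 _] := Ly j; apply: cmeasurableB m2.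
by have [_ ? _] := Lt.
Qed.

End Lower.

(** * Trigonometric approximation of indicators *)

Section Smoothing.
Variable R : realType.

(* [smooth] is a polynomial self-map of [0, 1] whose iterates tend to 0 below 1/2 and to 1
   above it: they turn trigonometric polynomials into indicators of level sets. *)
Definition smooth (t : R) : R := 3 * t ^+ 2 - 2 * t ^+ 3.

Lemma smooth_compl t : smooth (1 - t) = 1 - smooth t.
Proof. by rewrite /smooth; ring. Qed.

Lemma smooth_ge0 t : 0 <= t <= 1 -> 0 <= smooth t.
Proof.
move=> /andP[t0 t1]; rewrite (_ : smooth t = t ^+ 2 * (3 - 2 * t)); last by rewrite /smooth; ring.
by rewrite mulr_ge0 ?sqr_ge0 //; lra.
Qed.

Lemma smooth_itv t : 0 <= t <= 1 -> 0 <= smooth t <= 1.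
Proof.
move=> t01; rewrite smooth_ge0 //= -subr_ge0 -smooth_compl smooth_ge0 //.
by case/andP: t01 => *; apply/andP; split; lra.
Qed.

Lemma iter_smooth_itv n t : 0 <= t <= 1 -> 0 <= iter n smooth t <= 1.
Proof. by move=> t01; elim: n => //= n; exact: smooth_itv. Qed.

Lemma iter_smooth_compl n t : iter n smooth (1 - t) = 1 - iter n smooth t.
Proof. by elim: n => //= n ->; exact: smooth_compl. Qed.

Lemma iter_smooth_half n : iter n smooth 2^-1 = 2^-1.
Proof. by elim: n => //= n ->; rewrite /smooth; field. Qed.

Lemma iter_smooth_lt n q : 0 <= q -> q < 2^-1 -> 0 <= iter n smooth q <= q * (q * (3 - 2 * q)) ^+ n.
Proof.
move=> q0 q1; pose r := q * (3 - 2 * q); have r0 : 0 <= r by rewrite /r; nra.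
have r1 : r <= 1 by rewrite /r; nra.
elim: n => [|n /andP[h1 h2]]; first by rewrite expr0 mulr1 q0 /=.
rewrite -/r in h2 *.
have rn1 : r ^+ n <= 1 by rewrite exprn_ile1.
have rn0 : 0 <= r ^+ n by rewrite exprn_ge0.
set t := iter n smooth q in h1 h2; rewrite iterS -/t.
have tq : t <= q by apply: le_trans h2 _; rewrite -[leRHS]mulr1 ler_wpM2l.
rewrite smooth_ge0 /=; last by rewrite h1; lra.
rewrite (_ : smooth t = t * (t * (3 - 2 * t))); last by rewrite /smooth; ring.
rewrite exprSr [leRHS]mulrA; apply: ler_pM => //; first nra.
by rewrite /r; nra.
Qed.

Lemma cvg_iter_smooth_lt q : 0 <= q -> q < 2^-1 -> iter n smooth q @[n --> \oo] --> (0 : R).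
Proof.
move=> q0 q1; apply: (@squeeze_cvgr _ _ _ _ (fun=> 0) (fun n => q * (q * (3 - 2 * q)) ^+ n)).
- by apply: nearW => n; exact: iter_smooth_lt.
- exact: cvg_cst.
rewrite -[X in _ --> X](mulr0 q); apply: cvgMr; apply: cvg_expr.
by rewrite ger0_norm; nra.
Qed.

Definition step (t : R) : R := if t < 2^-1 then 0 else if t == 2^-1 then 2^-1 else 1.

Lemma step_itv t : 0 <= step t <= 1.
Proof. by rewrite /step; case: ifP => _; [lra|case: ifP => _; lra]. Qed.

Lemma cvg_iter_smooth t : 0 <= t <= 1 -> iter n smooth t @[n --> \oo] --> step t.
Proof.
move=> /andP[t0 t1]; rewrite /step; case: (ltgtP t 2^-1) => h.
- exact: cvg_iter_smooth_lt.
- have -> : (fun n => iter n smooth t) = fun n => 1 - iter n smooth (1 - t).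
    by apply/funext => n; rewrite iter_smooth_compl opprB addrC subrK.
  rewrite -[X in _ --> X]subr0; apply: cvgB; first exact: cvg_cst.
  by apply: cvg_iter_smooth_lt; lra.
- rewrite h; have -> : (fun n => iter n smooth 2^-1) = fun=> 2^-1 by apply/funext => n; exact: iter_smooth_half.
  exact: cvg_cst.
Qed.

End Smoothing.

(** * Weighted L_1 approximation by trigonometric polynomials with values in [0, 1] *)

Section Density.
Variable R : realType.
Local Notation plane := (measurableTypeR R * measurableTypeR R)%type.
Local Notation mu := (torus_measure R).
Local Notation tpT := (@tp R setT).
Variables (w : plane -> R) (w0 : forall x, 0 <= w x) (wi : mu.-integrable setT (EFin \o w)).

Implicit Types (g u : plane -> R).

Let mw : measurable_fun setT w.
Proof. by have /integrableP[/measurable_EFinP] := wi. Qed.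

(** In [L1_dual] the weight is |h|: this distance controls the change of the mean of h u when u is
    replaced by an indicator. *)
Definition wdist (g : plane -> R) : \bar R := (\int[mu]_x (w x * `|g x|)%:E)%E.

Lemma measurable_wdist g : measurable_fun setT g -> measurable_fun setT (fun x : plane => (w x * `|g x|)%:E).
Proof.
move=> mg; apply/measurable_EFinP; apply: measurable_funM => //.
by apply: measurableT_comp.
Qed.

Lemma wdist_le (g1 g2 : plane -> R) : measurable_fun setT g1 -> measurable_fun setT g2 ->
  (forall x, `|g1 x| <= `|g2 x|) -> (wdist g1 <= wdist g2)%E.
Proof.
move=> m1 m2 h; apply: ge0_le_integral => //.
- by move=> x _; rewrite lee_fin mulr_ge0.
- exact: measurable_wdist.
- exact: measurable_wdist.
- by move=> x _; rewrite lee_fin ler_wpM2l.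
Qed.

Lemma wdistD (g1 g2 : plane -> R) : measurable_fun setT g1 -> measurable_fun setT g2 ->
  (wdist (fun x => g1 x + g2 x)%R <= wdist g1 + wdist g2)%E.
Proof.
move=> m1 m2; rewrite /wdist -ge0_integralD //; last 4 first.
- by move=> x _; rewrite lee_fin mulr_ge0.
- exact: measurable_wdist.
- by move=> x _; rewrite lee_fin mulr_ge0.
- exact: measurable_wdist.
apply: ge0_le_integral => //.
- by move=> x _; rewrite lee_fin mulr_ge0.
- by apply: measurable_wdist; exact: measurable_funD.
- by apply: emeasurable_funD; exact: measurable_wdist.
- by move=> x _; rewrite -EFinD lee_fin -mulrDr ler_wpM2l // ler_normD.
Qed.

Definition approximable (g : plane -> R) : Prop := measurable_fun setT g /\ forall d : R, 0 < d ->
  exists u, [/\ tpT u, forall x, 0 <= u x <= 1 & (wdist (fun x => u x - g x)%R <= d%:E)%E].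

Lemma tp_meas u : tpT u -> measurable_fun setT u.
Proof. by move=> /tp_nice[]. Qed.

Lemma approximable_tp u : tpT u -> (forall x, 0 <= u x <= 1) -> approximable u.
Proof.
move=> tu u01; split; first exact: tp_meas.
move=> d d0; exists u; split => //; rewrite /wdist integral0_eq ?lee_fin ?ltW // => x _.
by rewrite subrr normr0 mulr0.
Qed.

Lemma tp_cst c : tpT (fun=> c).
Proof.
have := tpZ c (tp_wave (K := setT) (k := 0) (0 : R) I).
rewrite (_ : (fun x => _) = fun=> c) //; apply/funext => x.
by rewrite /wave /dot /= !mul0r !addr0 cos0 mulr1.
Qed.

Lemma approximable_compl g : approximable g -> approximable (fun x => 1 - g x).
Proof.
move=> [mg hg]; split; first by apply: measurable_funB => //; exact: measurable_cst.
move=> d /hg[u [tu u01 hu]]; exists (fun x => 1 - u x); split.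
- by apply: tpB => //; exact: tp_cst.
- by move=> x; have := u01 x; lra.
apply: le_trans hu; apply: wdist_le.
- by apply: measurable_funB; apply: measurable_funB => //; exact: tp_meas.
- by apply: measurable_funB => //; exact: tp_meas.
by move=> x; rewrite (_ : 1 - u x - _ = - (u x - g x)) ?normrN //; ring.
Qed.

Lemma approximable_mul (g1 g2 : plane -> R) : (forall x, 0 <= g2 x <= 1) -> approximable g1 -> approximable g2 ->
  approximable (fun x => g1 x * g2 x).
Proof.
move=> g201 [m1 h1] [m2 h2]; split; first exact: measurable_funM.
move=> d d0; have d20 : 0 < d / 2 by rewrite divr_gt0.
have [u1 [t1 u101 hu1]] := h1 _ d20; have [u2 [t2 u201 hu2]] := h2 _ d20.
have mu1 := tp_meas t1; have mu2 := tp_meas t2.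
exists (fun x => u1 x * u2 x); split.
- exact: (@tpM R setT setT setT).
- by move=> x; have := u101 x; have := u201 x; nra.
apply: (@le_trans _ _ (wdist (fun x => `|u1 x - g1 x| + `|u2 x - g2 x|)%R)).
  apply: wdist_le.
  - by apply: measurable_funB; exact: measurable_funM.
  - by apply: measurable_funD; apply: measurableT_comp => //; exact: measurable_funB.
  move=> x; rewrite [leRHS]ger0_norm ?addr_ge0 //.
  rewrite (_ : u1 x * u2 x - g1 x * g2 x = (u1 x - g1 x) * g2 x + u1 x * (u2 x - g2 x)); last by ring.
  apply: le_trans (ler_normD _ _) _; rewrite !normrM.
  have /andP[a0 a1] := u101 x; have /andP[b0 b1] := g201 x.
  rewrite (ger0_norm a0) (ger0_norm b0); apply: lerD.
    by rewrite -[leRHS]mulr1 ler_wpM2l.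
  by rewrite -[leRHS]mul1r ler_wpM2r.
apply: le_trans (wdistD _ _) _; try (by apply: measurableT_comp => //; exact: measurable_funB).
have -> : d = d / 2 + d / 2 by lra.
rewrite EFinD; apply: leeD; [apply: le_trans hu1|apply: le_trans hu2]; apply: wdist_le => //.
- by apply: measurableT_comp => //; exact: measurable_funB.
- exact: measurable_funB.
- by move=> x; rewrite normr_id.
- by apply: measurableT_comp => //; exact: measurable_funB.
- exact: measurable_funB.
- by move=> x; rewrite normr_id.
Qed.

(** Values in [0, 1] make the integrable weight itself a dominating function. *)
Lemma approximable_limit (G : nat -> plane -> R) g : (forall n, approximable (G n)) ->
  (forall n x, 0 <= G n x <= 1) -> (forall x, G n x @[n --> \oo] --> g x) -> approximable g.
Proof.
move=> aG G01 Gg; have mG n : measurable_fun setT (G n) by case: (aG n).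
have mg : measurable_fun setT g by apply: (measurable_fun_cvg (h := G)).
split => // d d0; have d20 : 0 < d / 2 by rewrite divr_gt0.
have [_ cv _] := @dominated_convergence _ _ _ mu setT measurableT
  (fun n x => (w x * G n x)%:E) (fun x => (w x * g x)%:E) (EFin \o w)
  (fun n => ltac:(by apply/measurable_EFinP; exact: measurable_funM))
  (ltac:(by apply/measurable_EFinP; exact: measurable_funM))
  (ltac:(by apply: aeW => x _; apply: cvg_EFin; [exact: nearW|apply: cvgMr; exact: Gg]))
  wi
  (ltac:(by apply: aeW => x n _; rewrite lee_fin ger0_norm; have /andP[? ?] := G01 n x; rewrite ?mulr_ge0 //; rewrite -[leRHS]mulr1 ler_wpM2l)).
have [n hn] : exists n, (wdist (fun x => G n x - g x)%R < (d / 2)%:E)%E.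
  have E n : (\int[mu]_(x in setT) `|(w x * G n x)%:E - (w x * g x)%:E| = wdist (fun x => (G n x - g x)%R))%E.
    by apply: eq_integral => x _; rewrite -EFinB /= -mulrBr normrM ger0_norm.
  have /fine_cvgP[F1 F2] := cv.
  have F3 : \forall n \near \oo, fine (wdist (fun x => G n x - g x)) < d / 2.
    by move/cvgr_lt : F2 => /(_ _ d20); apply: filterS => n; rewrite /= E.
  near \oo => n; exists n.
  have Fn : wdist (fun x => G n x - g x) \is a fin_num by rewrite -E; near: n.
  rewrite -(fineK Fn) lte_fin; by near: n.
have [_ /(_ _ d20)[u [tu u01 hu]]] := aG n.
exists u; split => //.
have -> : (fun x => u x - g x) = fun x => (u x - G n x) + (G n x - g x).
  by apply/funext => x; ring.
apply: le_trans (wdistD _ _) _; try (by apply: measurable_funB => //; exact: tp_meas).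
have -> : d = d / 2 + d / 2 by lra.
by rewrite EFinD; apply: leeD => //; exact: ltW.
Unshelve. all: by end_near.
Qed.

Definition open_square : set plane := `]0, 2 * pi[ `*` `]0, 2 * pi[.

(** The open square already carries the full mass 1, so its complement in the whole plane is
    null. *)
Lemma negligible_boundary : mu.-negligible (~` open_square).
Proof.
have mO : measurable open_square by apply: measurableX; exact: measurable_itv.
have tp2 := twopi_gt0 R.
exists (~` open_square); split => //; first exact: measurableC.
have muE A : mu A = (((2 * pi) ^- 2)%:E *
  (@lebesgue_measure R \x @lebesgue_measure R) (A `&` @period_square R))%E by [].
have : mu open_square = 1%E.
  rewrite muE setIidl.
    rewrite product_measure1E; try exact: measurable_itv.
    have L : @lebesgue_measure R `]0, (2 * pi)[%classic = (2 * pi)%:E.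
      by rewrite lebesgue_measure_itv /= lte_fin tp2 sube0.
    pose X := @lebesgue_measure R `]0, (2 * pi)[%classic.
    change ((((2 * pi) ^- 2)%:E * (X * X))%E = 1%E :> \bar R).
    rewrite /X L -!EFinM -expr2 mulVf // sqrf_eq0 gt_eqF //.
  by move=> x [/= h1 h2]; split => /=; rewrite !in_itv /= in h1 h2 *;
    [case/andP: h1|case/andP: h2] => a b; rewrite !ltW.
move=> O1; have T1 : (mu (open_square `|` ~` open_square) = 1)%E.
  by rewrite setUv; exact: torus_measureT.
have := measureU mu mO (measurableC mO) (setICr _).
rewrite [X in X = _]T1 [X in (_ = X + _)%E]O1 => /esym.
have gen (y : \bar R) : (1%:E + y = 1%:E -> y = 0)%E.
  by case: y => [r| |] //= /eqP; rewrite -EFinD eqe -subr_eq0 addrAC subrr add0r => /eqP ->.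
exact: gen.
Qed.

End Density.

(** * From level sets to all measurable sets *)

Section Indicators.
Variable R : realType.
Local Notation plane := (measurableTypeR R * measurableTypeR R)%type.
Local Notation mu := (torus_measure R).
Local Notation tpT := (@tp R setT).
Variables (w : plane -> R) (w0 : forall x, 0 <= w x) (wi : mu.-integrable setT (EFin \o w)).
Implicit Types (g u : plane -> R) (A : set plane).

Lemma indic_itv A x : 0 <= (\1_A x : R) <= 1.
Proof. by rewrite indicE; case: (x \in A); rewrite /= ?lexx ?ler01. Qed.

Lemma approximable_ae g g' : approximable w g -> measurable_fun setT g' ->
  (forall x, open_square x -> g x = g' x) -> approximable w g'.
Proof.
move=> [mg hg] mg' gg'; split => // d /hg[u [tu u01 hu]]; exists u; split => //.
apply: le_trans hu; rewrite le_eqVlt; apply/orP; left; apply/eqP.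
have mu' := tp_meas tu.
apply: ge0_ae_eq_integral => //.
- by apply: measurable_wdist => //; exact: measurable_funB.
- by apply: measurable_wdist => //; exact: measurable_funB.
- by move=> x _; rewrite lee_fin mulr_ge0.
- by move=> x _; rewrite lee_fin mulr_ge0.
apply: negligibleS (negligible_boundary R) => x /= h hO; apply: h => _.
by rewrite gg'.
Qed.

Definition approx_set A : Prop := measurable A /\ approximable w \1_A.

Lemma approx_set_ae A B : approx_set A -> measurable B ->
  (forall x, open_square x -> A x <-> B x) -> approx_set B.
Proof.
move=> [mA aA] mB AB; split => //; apply: approximable_ae aA _ _; first exact: measurable_indic.
move=> x Ox; rewrite !indicE; congr (_%:R); congr nat_of_bool.
by apply/idP/idP; rewrite !inE => /AB; exact.
Qed.

Lemma indic_compl A x : \1_(~` A) x = 1 - \1_A x :> R.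
Proof. by rewrite !indicE in_setC; case: (x \in A); rewrite /= ?subrr ?subr0. Qed.

Lemma approx_setC A : approx_set A -> approx_set (~` A).
Proof.
move=> [mA aA]; split; first exact: measurableC.
have -> : \1_(~` A) = (fun x => 1 - \1_A x) :> (plane -> R) by apply/funext => x; exact: indic_compl.
exact: approximable_compl.
Qed.

Lemma approx_set0 : approx_set set0.
Proof.
split => //; have -> : \1_set0 = (fun=> 0) :> (plane -> R) by apply/funext => x; rewrite indic0.
by apply: approximable_tp => //; [exact: tp_cst|move=> x; rewrite lexx ler01].
Qed.

Lemma approx_setI A B : approx_set A -> approx_set B -> approx_set (A `&` B).
Proof.
move=> [mA aA] [mB aB]; split; first exact: measurableI.
by rewrite indicI; apply: approximable_mul => // x; exact: indic_itv.
Qed.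

Lemma approx_set_bigcup (F : nat -> set plane) : (forall n, approx_set (F n)) ->
  approx_set (\bigcup_n F n).
Proof.
move=> aF; rewrite -[X in approx_set X]setCK; apply: approx_setC.
have mU : measurable (\bigcup_n F n) by apply: bigcup_measurable => n _; case: (aF n).
split; first exact: measurableC.
(* The indicator of the complement of the union is the pointwise limit of finite products,
   eventually constant at each point. *)
pose P n (x : plane) : R := \prod_(i < n) (1 - \1_(F i) x).
have P01 n x : 0 <= P n x <= 1.
  elim: n => [|n ih]; first by rewrite /P big_ord0 ler01 lexx.
  by rewrite /P big_ord_recr /= -/(P n x); have := indic_itv (F n) x; nra.
apply: (@approximable_limit R w w0 wi P) => //.
- elim=> [|n ih].
    rewrite (_ : P 0%N = fun=> 1); last by apply/funext => x; rewrite /P big_ord0.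
    by apply: approximable_tp => //; [exact: tp_cst|move=> x; rewrite lexx ler01].
  rewrite (_ : P n.+1 = fun x => P n x * (1 - \1_(F n) x)); last first.
    by apply/funext => x; rewrite /P big_ord_recr.
  apply: approximable_mul => //; first by move=> x; have := indic_itv (F n) x; lra.
  by apply: approximable_compl => //; case: (aF n).
move=> x; apply: cvg_near_cst; have [[i _ Fix]|nF] := pselect ((\bigcup_n F n) x).
  exists i.+1 => // n /= ni; rewrite /P (bigD1 (Ordinal ni)) //= indicE mem_set // subrr mul0r.
  by rewrite indicE in_setC mem_set //; exists i.
exists 0%N => // n _; rewrite /P big1 => [|i _].
  by rewrite indicE mem_set.
by rewrite indicE memNset ?subr0 // => Fi; apply: nF; exists (nat_of_ord i).
Qed.

Lemma approx_level u (d : R) : tpT u -> (forall x, `|u x| <= 1) -> `|d| <= 1 ->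
  approx_set [set x | d < u x].
Proof.
move=> tu u1 d1.
have [mu' _] := tp_nice tu.
have mset e : measurable [set x | e < u x].
  rewrite (_ : [set x | e < u x] = setT `&` u @^-1` `]e, +oo[); last first.
    by rewrite setTI; apply/seteqP; split => x /=; rewrite in_itv /= andbT.
  by apply: mu' => //; exact: measurable_itv.
split => //.
(* An affine change that moves the level e to 1/2, the threshold of [step], and keeps the values in
   [0, 1] for all e between -1 and 2. *)
pose v e x := 2^-1 + 8^-1 * (u x - e).
have v01 e x : -1 <= e -> e <= 2 -> 0 <= v e x <= 1.
  by move=> e1 e2; have := u1 x; rewrite /v ler_norml; lra.
have tv e : tpT (v e).
  apply: tpD; first exact: tp_cst.
  by apply: tpZ; apply: tpB => //; exact: tp_cst.
have tM f1 f2 : tpT f1 -> tpT f2 -> tpT (fun x => f1 x * f2 x) by exact: tpM.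
have tS f : tpT f -> tpT (fun x => smooth (f x)).
  move=> tf; rewrite (_ : (fun x => _) = fun x => 3 * (f x * f x) - 2 * (f x * (f x * f x))); last first.
    by apply/funext => x; rewrite /smooth; ring.
  by apply: tpB; apply: tpZ; apply: (tM) => //; exact: (tM).
have aS e : -1 <= e -> e <= 2 -> approximable w (fun x => step (v e x)).
  move=> e1 e2; apply: (@approximable_limit R w w0 wi (fun n x => iter n (@smooth R) (v e x))).
  - move=> n; apply: approximable_tp => //; last by move=> x; apply: iter_smooth_itv; exact: v01.
    by elim: n => [|n ih] /=; [exact: tv|exact: tS].
  - by move=> n x; apply: iter_smooth_itv; exact: v01.
  - by move=> x; apply: cvg_iter_smooth; exact: v01.
have h0 n : 0 < (n.+1%:R^-1 : R) <= 1.
  by rewrite invr_gt0 ltr0n /= invf_le1 ?ltr0n // ler1n.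
(* Levels decreasing strictly to d remove the value 1/2 that [step] takes at equality: points with u
   <= d get 0 for every n, and points with u > d eventually get 1. *)
apply: (@approximable_limit R w w0 wi (fun n x => step (v (d + n.+1%:R^-1) x))).
- move=> n; have /andP[h1 h2] := h0 n; move: d1; rewrite ler_norml => /andP[d1 d2].
  by move: (n.+1%:R^-1 : R) h1 h2 => z h1 h2; apply: aS; [lra|lra].
- by move=> n x; exact: step_itv.
move=> x; apply: cvg_near_cst; have [dx|xd] := ltP d (u x).
  have d0 : 0 < u x - d by rewrite subr_gt0.
  have [N _ hN] := (@cvgrPdist_lt _ _ _ _ _ _ _).1 (@cvg_harmonic R) _ d0.
  exists N => // n /= Nn; have := hN n Nn; rewrite /= sub0r normrN gtr0_norm; last by case/andP: (h0 n).
  rewrite indicE mem_set // /step /v; move: (n.+1%:R^-1 : R) => z hn.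
  have h1 : 2^-1 < 2^-1 + 8^-1 * (u x - (d + z)) by lra.
  by rewrite (gt_eqF h1) ltNge (ltW h1).
exists 0%N => // n _; rewrite indicE memNset /=; last by rewrite ltNge xd.
case/andP: (h0 n); rewrite /step /v; move: (n.+1%:R^-1 : R) => z a b.
by rewrite ifT //; lra.
Qed.

(** On the open square a half-plane is a level set of a wave: cos(e/2) - cos(t - e/2) = 2 sin(t/2)
    sin((t - e)/2) has the sign of t - e when both t and e lie between 0 and 2 pi. Other values of e
    give the whole square or nothing. *)
Lemma approx_halfspace (pr : plane -> R) (k : int * int) e : (forall x, dot k x = pr x) ->
  (forall x, open_square x -> 0 < pr x < 2 * pi) -> approx_set [set x | e < pr x].
Proof.
move=> kpr pr01.
have mpr : measurable_fun setT pr.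
  by rewrite (_ : pr = dot k) //; [exact: measurable_dot|apply/funext].
have mset : measurable [set x | e < pr x].
  rewrite (_ : [set x | e < pr x] = setT `&` pr @^-1` `]e, +oo[); last first.
    by rewrite setTI; apply/seteqP; split => x /=; rewrite in_itv /= andbT.
  by apply: mpr => //; exact: measurable_itv.
have [e0|e0] := leP e 0.
  apply: approx_set_ae (approx_setC approx_set0) _ _ => // x /pr01/andP[p0 _].
  by split=> [_|_ []] /=; exact: (le_lt_trans e0 p0).
have [e1|e1] := leP (2 * pi) e.
  apply: approx_set_ae approx_set0 _ _ => // x /pr01/andP[_ p1]; split => //= h.
  by have := lt_trans h (lt_le_trans p1 e1); rewrite ltxx.
have tw : tpT (wave k (pi - e / 2)) by exact: tp_wave.
have := @approx_level (wave k (pi - e / 2)) (- cos (e / 2)) tw (fun x => cos_max _).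
rewrite normrN => /(_ (cos_max _)) h; apply: approx_set_ae h _ _ => // x /pr01/andP[p0 p1] /=.
have -> : wave k (pi - e / 2) x = - cos (pr x - e / 2).
  by rewrite /wave kpr -cosDpi; congr cos; ring.
rewrite ltrN2 -subr_gt0.
have -> : cos (e / 2) - cos (pr x - e / 2) = 2 * (sin (pr x / 2) * sin ((pr x - e) / 2)).
  have -> : e / 2 = pr x / 2 - (pr x - e) / 2 by field.
  have -> : pr x - (pr x / 2 - (pr x - e) / 2) = pr x / 2 + (pr x - e) / 2 by field.
  by rewrite cosB cosD; ring.
have s0 : 0 < sin (pr x / 2) by apply: sin_gt0_pi; lra.
rewrite pmulr_rgt0 // pmulr_rgt0 //; split=> h.
  rewrite ltNge; apply/negP => pe.
  have : 0 <= sin (- ((pr x - e) / 2)) by apply: sin_ge0_pi; lra.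
  by rewrite sinN; lra.
by apply: sin_gt0_pi; lra.
Qed.

Lemma approx_preimage (pr : plane -> R) (k : int * int) (B : set (measurableTypeR R)) :
  (forall x, dot k x = pr x) ->
  (forall x, open_square x -> 0 < pr x < 2 * pi) -> measurable B -> approx_set (pr @^-1` B).
Proof.
move=> kpr pr01 mB.
have : <<s @RGenOInfty.G R >> B by rewrite -[X in X B](RGenOInfty.measurableE R).
apply: (@smallest_sub _ _ _ (fun B => approx_set (pr @^-1` B))).
  split=> [|C hC|F hF].
  - by rewrite preimage_set0; exact: approx_set0.
  - by rewrite setTD preimage_setC; exact: approx_setC.
  - by rewrite preimage_bigcup; exact: approx_set_bigcup.
move=> _ [e ->]; rewrite (_ : pr @^-1` _ = [set x | e < pr x]); first exact: approx_halfspace kpr pr01.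
by apply/seteqP; split => x /=; rewrite in_itv /= andbT.
Qed.

Lemma approx_measurable A : measurable A -> approx_set A.
Proof.
have O1 (x : plane) : open_square x -> 0 < x.1 < 2 * pi by move=> [/= + _]; rewrite in_itv.
have O2 (x : plane) : open_square x -> 0 < x.2 < 2 * pi by move=> [/= _]; rewrite in_itv.
rewrite measurable_prod_measurableType; apply: smallest_sub.
  split; [exact: approx_set0|by move=> C hC; rewrite setTD; exact: approx_setC|].
  exact: approx_set_bigcup.
move=> _ [B mB [C mC] <-].
have -> : B `*` C = (fst @^-1` B) `&` (snd @^-1` C) by [].
apply: approx_setI.
  apply: (@approx_preimage fst (1, 0)) => // x.
  by rewrite /dot /= mul1r mul0r addr0.
apply: (@approx_preimage snd (0, 1)) => // x.
by rewrite /dot /= mul1r mul0r add0r.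
Qed.

End Indicators.

(** * The L_1 norm by duality with trigonometric polynomials *)

Section Dual.
Variable R : realType.
Local Notation plane := (measurableTypeR R * measurableTypeR R)%type.
Local Notation mu := (torus_measure R).

Lemma integrableMnice (h g : plane -> R) : mu.-integrable setT (EFin \o h) -> nice g ->
  mu.-integrable setT (EFin \o (fun x => h x * g x)).
Proof.
move=> ih [mg [M gM]].
have := @integrableMl _ _ _ mu setT measurableT (EFin \o h) g ih mg.
apply; exists M; split; first exact: num_real.
by move=> y My x _; apply: le_trans (gM x) _; exact: ltW.
Qed.

(** The sign of h is a difference of two indicators, each approximated in L_1 with weight |h| by
    polynomials admissible for the hypothesis; hence the factor 2. *)
Lemma L1_dual (h : plane -> R) (e : R) : mu.-integrable setT (EFin \o h) ->
  (forall u, tp setT u -> (forall x, 0 <= u x <= 1) -> `|mean (fun x => h x * u x)| <= e) ->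
  mean (fun x => `|h x|) <= 2 * e.
Proof.
move=> ih hu.
have mh : measurable_fun setT h by have /integrableP[/measurable_EFinP] := ih.
pose w x := `|h x|.
have wi : mu.-integrable setT (EFin \o w) by have := integrable_abse ih.
have nI A : measurable A -> nice (\1_A : plane -> R).
  move=> mA; split; first exact: measurable_indic.
  by exists 1 => x; have /andP[a b] := @indic_itv R A x; rewrite ger0_norm.
have key A : measurable A -> `|mean (fun x => h x * \1_A x)| <= e.
  move=> mA; apply/ler_addgt0Pr => d d0.
  have [_ [_ /(_ d d0)[u [tu u01 ud]]]] := @approx_measurable R w (fun x => normr_ge0 _) wi A mA.
  have nu := tp_nice tu; have nA := nI A mA.
  have nuA := niceB nu nA.
  have i1 := integrableMnice ih nu; have i2 := integrableMnice ih nA; have i3 := integrableMnice ih nuA.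
  have -> : mean (fun x => h x * \1_A x) = mean (fun x => h x * u x) - mean (fun x => h x * (u x - \1_A x)).
    rewrite -[RHS]RintegralB //; congr Rintegral; apply/funext => x; ring.
  apply: le_trans (ler_normB _ _) _; apply: lerD; first exact: hu.
  apply: le_trans (le_normr_Rintegral _ _) _ => //.
  rewrite -lee_fin; apply: le_trans ud; rewrite /Rintegral fineK.
    rewrite le_eqVlt; apply/orP; left; apply/eqP; apply: eq_integral => x _.
    by rewrite normrM.
  have := integrable_fin_num measurableT (integrable_abse i3); exact.
pose P := [set x | 0 <= h x].
have mP : measurable P.
  rewrite (_ : P = setT `&` h @^-1` `[0, +oo[); last first.
    by rewrite setTI; apply/seteqP; split => x /=; rewrite in_itv /= andbT.
  by apply: mh => //; exact: measurable_itv.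
have mN := measurableC mP.
have -> : mean (fun x => `|h x|) = mean (fun x => h x * \1_P x) - mean (fun x => h x * \1_(~` P) x).
  rewrite -[RHS]RintegralB //; try (by apply: integrableMnice => //; exact: nI).
  congr Rintegral; apply/funext => x; rewrite indic_compl indicE /P.
  have [h0|h0] := leP 0 (h x).
    by rewrite mem_set // ger0_norm //=; ring.
  by rewrite memNset /= ?ltr0_norm //; [ring|rewrite leNgt h0].
apply: le_trans (ler_norm _) _; apply: le_trans (ler_normB _ _) _.
by rewrite mulr2n mulrDl mul1r; apply: lerD; exact: key.
Qed.

End Dual.

(** * Layers of a Fourier series *)

Lemma hyper_layer_inj l n k : hyper_layer l k -> hyper_layer n k -> l = n.
Proof.
move=> [s /= <- [s1 s2]] [r /= <- [r1 r2]].
by rewrite (in_dyadic_inj s1 r1) (in_dyadic_inj s2 r2).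
Qed.

Lemma hyper_layerN l k : hyper_layer l k -> hyper_layer l (- k).
Proof.
move=> [s sl [s1 s2]]; exists s => //; case: k s1 s2 => k1 k2 /=.
by rewrite /rho /= /in_dyadic !abszN.
Qed.

Lemma in_dyadic_ex k : exists s, in_dyadic s k.
Proof.
rewrite /in_dyadic; case: (posnP `|k|%N) => [->|k0]; first by exists 0%N.
exists (trunc_log 2 `|k|).+1; rewrite expnS mulKn // trunc_logP //=.
by rewrite -expnS trunc_log_ltn.
Qed.

Lemma hyper_layer_ex k : exists l, hyper_layer l k.
Proof.
have [s1 h1] := in_dyadic_ex k.1; have [s2 h2] := in_dyadic_ex k.2.
by exists (s1 + s2)%N, (s1, s2).
Qed.

Section Layers.
Variable R : realType.
Local Notation plane := (measurableTypeR R * measurableTypeR R)%type.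
Local Notation func := (plane -> R[i]).
Local Notation mu := (torus_measure R).

Lemma finite_level l : finite_set [set s : nat * nat | (s.1 + s.2)%N = l].
Proof.
apply: (@sub_finite_set _ _ (`I_l.+1 `*` `I_l.+1)); last by apply: finite_setX; exact: finite_II.
by move=> [s1 s2] /= <-; split => /=; rewrite ltnS ?leq_addr ?leq_addl.
Qed.

Lemma layerE l (f : func) :
  layer l f = fun x => \sum_(k \in hyper_layer l) fourier f k * expi (dot k x).
Proof.
apply/funext => x; rewrite /layer /delta.
set S := [set s : nat * nat | _]; set F := fun k => fourier f k * expi (dot k x).
have fS : finite_set S := finite_level l.
have fH := finite_hyper_layer l.
transitivity (\sum_(s \in S) \sum_(k \in hyper_layer l) (if k \in rho s then F k else 0)).
  apply: eq_fsbigr => s; rewrite inE => Ss; rewrite -fsbig_mkcondr.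
  apply: eq_fsbigl; apply/seteqP; split=> [k sk|k []//]; split=> //.
  by exists s.
rewrite exchange_fsbig //; apply: eq_fsbigr => k; rewrite inE => -[s Ss sk].
transitivity (\sum_(r \in S) (if r \in [set r | rho r k] then F k else 0)).
  by apply: eq_fsbigr => r _; congr (if _ then _ else _); apply/idP/idP; rewrite !inE.
rewrite -fsbig_mkcondr (_ : S `&` _ = [set s]) ?fsbig_set1 //.
apply/seteqP; split=> [r [_ /= [r1 r2]]|_ ->] //.
case: sk => s1 s2; case: r s r1 r2 s1 s2 {Ss} => [? ?] [? ?] /= r1 r2 s1 s2.
by rewrite (in_dyadic_inj r1 s1) (in_dyadic_inj r2 s2).
Qed.

Lemma trig_poly_layer l (f : func) : trig_poly (hyper_layer l) (layer l f).
Proof. by exists (fourier f); rewrite layerE. Qed.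

Lemma cnice_layer l (f : func) : cnice (layer l f).
Proof. exact: trig_poly_cnice (finite_hyper_layer l) (trig_poly_layer l f). Qed.

Lemma fourier_layer l (f : func) q :
  fourier (layer l f) q = if `[< hyper_layer l q >] then fourier f q else 0.
Proof. by rewrite layerE fourier_trig_poly //; exact: finite_hyper_layer. Qed.

Lemma layer_trig_poly l n (t : func) : trig_poly (hyper_layer n) t ->
  layer l t = if l == n then t else fun=> 0.
Proof.
move=> [c tE]; have fH := finite_hyper_layer n.
have ft q : fourier t q = if `[< hyper_layer n q >] then c q else 0.
  by rewrite tE fourier_trig_poly.
rewrite layerE; case: eqP => [->|ln]; apply/funext => x.
  rewrite [in RHS]tE; apply: eq_fsbigr => k; rewrite inE => nk.
  by rewrite ft asboolT.
rewrite fsbig1 // => k lk; rewrite ft asboolF ?mul0r // => nk.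
by case: ln; exact: hyper_layer_inj lk nk.
Qed.

Lemma periodic_trig_poly K (t : func) : finite_set K -> trig_poly K t -> periodic2 t.
Proof.
move=> fK /(trig_polyP _ fK)[c ->] x y.
have E (k : int * int) (m1 m2 : int) : expi (dot k (x + m1%:~R * (2 * pi), y + m2%:~R * (2 * pi))) = expi (dot k (x, y)) :> R[i].
  rewrite /expi; have -> : dot k (x + m1%:~R * (2 * pi), y + m2%:~R * (2 * pi)) =
      dot k (x, y) + (k.1 * m1 + k.2 * m2)%:~R * (2 * pi) :> R.
    by rewrite /dot /= intrD !intrM; ring.
  by rewrite cos_period sin_period.
split; apply: eq_bigr => k _.
  by have := E k 1 0; rewrite mul1r mul0r addr0 => ->.
by have := E k 0 1; rewrite mul1r mul0r addr0 => ->.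
Qed.

Lemma trig_poly_L p K (t : func) : 1 <= p -> finite_set K -> trig_poly K t -> L p%:E t.
Proof.
move=> p1 fK tt; have nt := trig_poly_cnice fK tt.
split; [exact: periodic_trig_poly tt|exact: cnice_cmeas|exact: cnice_normL].
Qed.

Definition cintegrable (f : func) := mu.-integrable setT (EFin \o (fun x => complex.Re (f x))) /\
  mu.-integrable setT (EFin \o (fun x => complex.Im (f x))).

Lemma Np1E (g : plane -> R) : Np 1 g = (\int[mu]_x `|g x|%:E)%E.
Proof.
rewrite NpE invr1 poweRe1; last by apply: integral_ge0 => x _; rewrite lee_fin powR_ge0.
by apply: eq_integral => x _; rewrite powRr1.
Qed.

Lemma L1_cintegrable (f : func) : L 1%E f -> cintegrable f.
Proof.
move=> [_ mf ff]; have [m1 m2] := mf.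
have gen (g : plane -> R) : measurable_fun setT g -> (Np 1 g <= normL 1 f)%E ->
    mu.-integrable setT (EFin \o g).
  move=> mg gf; apply/integrableP; split; first exact/measurable_EFinP.
  by rewrite -Np1E; exact: le_lt_trans gf ff.
by split; apply: gen => //; [exact: Np_Re|exact: Np_Im].
Qed.

Lemma cnice_cintegrable (f : func) : cnice f -> cintegrable f.
Proof. by case=> n1 n2; split; exact: nice_integrable. Qed.

Lemma cintegrableB (f g : func) : cintegrable f -> cintegrable g -> cintegrable (fun x => f x - g x).
Proof.
move=> [f1 f2] [g1 g2]; split.
  have := integrableB measurableT f1 g1; congr (mu.-integrable _ _).
  by apply/funext => x /=; rewrite -EFinB cReD cReN.
have := integrableB measurableT f2 g2; congr (mu.-integrable _ _).
by apply/funext => x /=; rewrite -EFinB cImD cImN.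
Qed.

Lemma mean_mulD (h u v : plane -> R) : mu.-integrable setT (EFin \o h) -> nice u -> nice v ->
  mean (fun x => h x * (u x + v x)) = mean (fun x => h x * u x) + mean (fun x => h x * v x).
Proof.
move=> ih nu nv; rewrite -[RHS]RintegralD //; try exact: integrableMnice.
by congr Rintegral; apply/funext => x; rewrite mulrDr.
Qed.

Lemma mean_mulZ (h u : plane -> R) c : mu.-integrable setT (EFin \o h) -> nice u ->
  mean (fun x => h x * (c * u x)) = c * mean (fun x => h x * u x).
Proof.
move=> ih nu; rewrite -[RHS]RintegralZl //; last exact: integrableMnice.
by congr Rintegral; apply/funext => x; rewrite mulrCA.
Qed.

Lemma meanD_mul (h g u : plane -> R) : mu.-integrable setT (EFin \o h) ->
  mu.-integrable setT (EFin \o g) -> nice u ->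
  mean (fun x => (h x + g x) * u x) = mean (fun x => h x * u x) + mean (fun x => g x * u x).
Proof.
move=> ih ig nu; rewrite -[RHS]RintegralD //; try exact: integrableMnice.
by congr Rintegral; apply/funext => x; rewrite mulrDl.
Qed.

Lemma fourierE (f : func) k : cintegrable f -> fourier f k =
  ((mean (fun x => complex.Re (f x) * wave k 0 x) - mean (fun x => complex.Im (f x) * wave k (pi / 2) x)) +i*
   (mean (fun x => complex.Im (f x) * wave k 0 x) + mean (fun x => complex.Re (f x) * wave k (pi / 2) x)))%C.
Proof.
move=> [i1 i2].
have n1 := nice_wave k (0 : R); have n2 := nice_wave k (pi / 2 : R).
have E x : expi (- dot k x) = (wave k 0 x +i* wave k (pi / 2) x)%C :> R[i].
  by rewrite /expi /wave cosN sinN addr0 cosDpihalf.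
rewrite /fourier /cintegral; congr (_ +i* _)%C.
  rewrite -[RHS]RintegralB //; try exact: integrableMnice.
  by congr Rintegral; apply/funext => x; rewrite E cReM.
rewrite -[RHS]RintegralD //; try exact: integrableMnice.
by congr Rintegral; apply/funext => x; rewrite E cImM addrC.
Qed.

Lemma waveN k c (x : plane) : wave (- k) c x = wave k (- c) x :> R.
Proof.
rewrite /wave -cosN; congr cos; case: k => k1 k2.
by rewrite /dot /= !rmorphN /=; ring.
Qed.

Lemma wave_phase k c (x : plane) : wave k c x = cos c * wave k 0 x + sin c * wave k (pi / 2) x :> R.
Proof. by rewrite /wave addr0 cosDpihalf cosD; ring. Qed.

(** For complex-valued f the coefficients at k and -k are both used to separate the real and
    imaginary parts. *)
Lemma fourier_wave0 (f : func) k c : cintegrable f -> fourier f k = 0 -> fourier f (- k) = 0 ->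
  mean (fun x => complex.Re (f x) * wave k c x) = 0 /\
  mean (fun x => complex.Im (f x) * wave k c x) = 0.
Proof.
move=> cf; have [i1 i2] := cf.
have n1 := nice_wave k (0 : R); have n2 := nice_wave k (pi / 2 : R).
have w0 (g : plane -> R) : mean (fun x => g x * wave (- k) 0 x) = mean (fun x => g x * wave k 0 x).
  by congr mean; apply/funext => x; rewrite waveN oppr0.
have w1 (g : plane -> R) : mu.-integrable setT (EFin \o g) ->
    mean (fun x => g x * wave (- k) (pi / 2) x) = - mean (fun x => g x * wave k (pi / 2) x).
  move=> ig; rewrite -[RHS]mulN1r -(mean_mulZ (-1) ig n2); congr mean; apply/funext => x; congr (_ * _).
  by rewrite waveN mulN1r /wave cosDpihalf cosBpihalf opprK.
rewrite !fourierE // !w0 !w1 //; set A := mean _; set D := mean _; set C := mean _; set B := mean _.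
move=> /eqP; rewrite eq_complex /= => /andP[/eqP e1 /eqP e2].
move=> /eqP; rewrite eq_complex /= => /andP[/eqP e3 /eqP e4].
have [A0 [B0 [C0 D0]]] : A = 0 /\ B = 0 /\ C = 0 /\ D = 0 by split; [lra|split; [lra|split; lra]].
have gen (g : plane -> R) : mu.-integrable setT (EFin \o g) -> mean (fun x => g x * wave k 0 x) = 0 ->
    mean (fun x => g x * wave k (pi / 2) x) = 0 -> mean (fun x => g x * wave k c x) = 0.
  move=> ig g0 g1.
  rewrite (_ : (fun x => _) = fun x => g x * (cos c * wave k 0 x + sin c * wave k (pi / 2) x)); last first.
    by apply/funext => x; rewrite -wave_phase.
  by rewrite mean_mulD ?mean_mulZ ?g0 ?g1 ?mulr0 ?addr0 //; exact: niceZ.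
by split; apply: gen.
Qed.

End Layers.

(** * Hyperbolic partial sums and the two classes *)

Section PartialSums.
Variable R : realType.
Local Notation plane := (measurableTypeR R * measurableTypeR R)%type.
Local Notation func := (plane -> R[i]).
Local Notation mu := (torus_measure R).

Definition partial_sum (f : func) (N : nat) : func := fun x => \sum_(l < N) layer l f x.

Lemma cnice_partial_sum f N : cnice (partial_sum f N).
Proof. by apply: cnice_sum => l; exact: cnice_layer. Qed.

Lemma fourier_sum (I : Type) (s : seq I) (F : I -> func) q : (forall i, cnice (F i)) ->
  fourier (fun x => \sum_(i <- s) F i x) q = \sum_(i <- s) fourier (F i) q.
Proof.
move=> nF.
have nFe i : cnice (fun x => F i x * expi (- dot q x)).
  have [e1 e2] := cnice_expi (- q) (1 : R[i]); case: (nF i) => f1 f2.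
  have dN (x : plane) : - dot q x = dot (- q) x.
    by case: (q) => q1 q2; rewrite /dot /= !rmorphN /=; ring.
  split; under eq_fun do rewrite ?cReM ?cImM dN -[expi _]mul1r.
    by apply: niceB; apply: niceM.
  by apply: niceD; apply: niceM.
apply/eqP; rewrite eq_complex cRe_sum cIm_sum; apply/andP; split; apply/eqP.
  rewrite [RHS](_ : _ = \sum_(i <- s) mean (fun x => complex.Re (F i x * expi (- dot q x)))) //.
  rewrite -mean_sum; last by move=> i; case: (nFe i).
  by congr Rintegral; apply/funext => x; rewrite mulr_suml cRe_sum.
rewrite [RHS](_ : _ = \sum_(i <- s) mean (fun x => complex.Im (F i x * expi (- dot q x)))) //.
rewrite -mean_sum; last by move=> i; case: (nFe i).
by congr Rintegral; apply/funext => x; rewrite mulr_suml cIm_sum.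
Qed.

Lemma fourier_partial_sum f N l q : hyper_layer l q -> (l < N)%N ->
  fourier (partial_sum f N) q = fourier f q.
Proof.
move=> lq lN; rewrite /partial_sum fourier_sum; last by move=> i; exact: cnice_layer.
rewrite (bigD1 (Ordinal lN)) //= fourier_layer asboolT // big1 ?addr0 // => i il.
rewrite fourier_layer asboolF // => iq; move/negP: il; apply.
by apply/eqP/val_inj; exact: hyper_layer_inj iq lq.
Qed.

Lemma fourierB (f g : func) q : cintegrable f -> cintegrable g ->
  fourier (fun x => f x - g x) q = fourier f q - fourier g q.
Proof.
move=> cf cg; rewrite !fourierE //; last exact: cintegrableB.
have [f1 f2] := cf; have [g1 g2] := cg.
have n1 := nice_wave q (0 : R); have n2 := nice_wave q (pi / 2 : R).
have gen (h k u : plane -> R) : mu.-integrable setT (EFin \o h) -> mu.-integrable setT (EFin \o k) ->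
    nice u -> mean (fun x => (h x - k x) * u x) = mean (fun x => h x * u x) - mean (fun x => k x * u x).
  move=> ih ik nu; rewrite -[RHS]RintegralB //; try exact: integrableMnice.
  by congr Rintegral; apply/funext => x; rewrite mulrBl.
have gR u : nice u -> mean (fun x => complex.Re (f x - g x) * u x) =
    mean (fun x => complex.Re (f x) * u x) - mean (fun x => complex.Re (g x) * u x).
  by move=> nu; rewrite -gen //; congr mean; apply/funext => x; rewrite cReD cReN.
have gI u : nice u -> mean (fun x => complex.Im (f x - g x) * u x) =
    mean (fun x => complex.Im (f x) * u x) - mean (fun x => complex.Im (g x) * u x).
  by move=> nu; rewrite -gen //; congr mean; apply/funext => x; rewrite cImD cImN.
rewrite !gR // !gI //.
by apply/eqP; rewrite eq_complex /=; apply/andP; split; apply/eqP; ring.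
Qed.

(** The polynomial u has finitely many frequencies, each in some layer; once those layers are
    subtracted, the remainder has vanishing coefficients there. *)
Lemma remainder_orthogonal (f : func) u : cintegrable f -> tp setT u -> exists M0, forall M, (M0 <= M)%N ->
  mean (fun x => complex.Re (f x - partial_sum f M x) * u x) = 0 /\
  mean (fun x => complex.Im (f x - partial_sum f M x) * u x) = 0.
Proof.
move=> cf; pose g M x := f x - partial_sum f M x.
have cg M : cintegrable (g M).
  by apply: cintegrableB => //; apply: cnice_cintegrable; exact: cnice_partial_sum.
move: u; apply: tp_ind => [|c k d u _ tu [M1 h1]].
  exists 0%N => M _; split; rewrite -[RHS](mean_cst 0); congr mean; apply/funext => x; exact: mulr0.
have [l lk] := hyper_layer_ex k; have lk' := hyper_layerN lk.
exists (maxn M1 l.+1) => M; rewrite geq_max => /andP[M1M lM].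
have z q : hyper_layer l q -> fourier (g M) q = 0.
  move=> lq; rewrite fourierB //; last by apply: cnice_cintegrable; exact: cnice_partial_sum.
  by rewrite (fourier_partial_sum f lq lM) subrr.
have [z1 z2] := fourier_wave0 d (cg M) (z _ lk) (z _ lk').
have [i1 i2] := cg M; have [r1 r2] := h1 M M1M.
have nw := nice_wave k d; have nu := tp_nice tu; have nc := niceZ c nw.
split.
  by rewrite (mean_mulD i1 nc nu) (mean_mulZ c i1 nw) [X in c * X]z1 [X in _ + X]r1 mulr0 addr0.
by rewrite (mean_mulD i2 nc nu) (mean_mulZ c i2 nw) [X in c * X]z2 [X in _ + X]r2 mulr0 addr0.
Qed.

Lemma abs_mean_le (h u : plane -> R) (B : R) : nice h -> nice u -> (forall x, 0 <= u x <= 1) ->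
  (Np 1 h <= B%:E)%E -> `|mean (fun x => h x * u x)| <= B.
Proof.
move=> nh nu u01 hB; apply: le_trans (norm_mean (niceM nh nu)) _.
rewrite Np1_nice // lee_fin in hB; apply: le_trans hB; apply: le_mean.
- by apply: nice_norm; exact: niceM.
- exact: nice_norm.
by move=> x; have /andP[a b] := u01 x; rewrite normrM (ger0_norm a) -[leRHS]mulr1 ler_wpM2l.
Qed.

(** Against a fixed u the remainder acts as the finite sum of the layers from N to some M depending
    on u, and this pairing is at most S. The constant 4 is the 2 of [L1_dual] taken for the real and
    for the imaginary part. *)
Lemma remainder_bound (f : func) (B : nat -> R) (S : R) N : L 1%E f ->
  (forall l, (normL 1 (layer l f) <= (B l)%:E)%E) ->
  (forall M, \sum_(N <= l < M) B l <= S) ->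
  (normL 1 (fun x => f x - partial_sum f N x)%R <= (4 * S)%:E)%E.
Proof.
move=> Lf hB hS; have cf := L1_cintegrable Lf.
pose g M x := f x - partial_sum f M x.
have cg M : cintegrable (g M).
  by apply: cintegrableB => //; apply: cnice_cintegrable; exact: cnice_partial_sum.
have mg : cmeasurable (g N).
  have [_ mf _] := Lf; apply: cmeasurableB => //; apply: cnice_cmeas; exact: cnice_partial_sum.
have nl l := cnice_layer l f.
pose D M x := \sum_(N <= l < M) layer l f x.
have DE M x : (N <= M)%N -> g N x = g M x + D M x.
  move=> NM; rewrite /g /D /partial_sum -!(big_mkord xpredT (fun l => layer l f x)).
  by rewrite (big_cat_nat (n := N) (p := M)) //=; ring.
have nD M : cnice (D M) by exact: cnice_sum.
have sumB (c : R[i] -> R) (u : plane -> R) M :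
    (forall (s : seq nat) x, c (\sum_(l <- s) layer l f x) = \sum_(l <- s) c (layer l f x)) ->
    (forall l, nice (fun x => c (layer l f x))) ->
    (forall l, (Np 1 (fun x => c (layer l f x)) <= normL 1 (layer l f))%E) ->
    nice u -> (forall x, 0 <= u x <= 1) ->
    `|mean (fun x => c (D M x) * u x)| <= S.
  move=> cs nc cN nu u01; apply: le_trans (hS M).
  rewrite (_ : mean _ = \sum_(N <= l < M) mean (fun x => c (layer l f x) * u x)).
    apply: le_trans (ler_norm_sum _ _ _) _; apply: ler_sum => l _.
    by apply: abs_mean_le => //; apply: le_trans (cN l) (hB l).
  rewrite -mean_sum; last by move=> l _; exact: (niceM (nc l) nu).
  by congr mean; apply/funext => x; rewrite /D cs mulr_suml.
have R1 : mean (fun x => `|complex.Re (g N x)|) <= 2 * S.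
  apply: L1_dual; first by case: (cg N).
  move=> u tu u01; have nu := tp_nice tu.
  have [M0 hM0] := remainder_orthogonal cf tu.
  have [z _] := hM0 (maxn M0 N) (leq_maxl _ _); have NM := leq_maxr M0 N.
  rewrite (_ : (fun x => _) = fun x => (complex.Re (g (maxn M0 N) x) + complex.Re (D (maxn M0 N) x)) * u x); last first.
    by apply/funext => x; rewrite (DE _ _ NM) cReD.
  have [i1 _] := cg (maxn M0 N); have [i2 _] := cnice_cintegrable (nD (maxn M0 N)).
  rewrite (meanD_mul i1 i2 nu) [X in X + _]z add0r; apply: sumB => //.
  - by move=> s x; exact: cRe_sum.
  - by move=> l; case: (nl l).
  - by move=> l; apply: Np_Re => //; exact: cnice_cmeas.
have I1 : mean (fun x => `|complex.Im (g N x)|) <= 2 * S.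
  apply: L1_dual; first by case: (cg N).
  move=> u tu u01; have nu := tp_nice tu.
  have [M0 hM0] := remainder_orthogonal cf tu.
  have [_ z] := hM0 (maxn M0 N) (leq_maxl _ _); have NM := leq_maxr M0 N.
  rewrite (_ : (fun x => _) = fun x => (complex.Im (g (maxn M0 N) x) + complex.Im (D (maxn M0 N) x)) * u x); last first.
    by apply/funext => x; rewrite (DE _ _ NM) cImD.
  have [_ i1] := cg (maxn M0 N); have [_ i2] := cnice_cintegrable (nD (maxn M0 N)).
  rewrite (meanD_mul i1 i2 nu) [X in X + _]z add0r; apply: sumB => //.
  - by move=> s x; exact: cIm_sum.
  - by move=> l; case: (nl l).
  - by move=> l; apply: Np_Im => //; exact: cnice_cmeas.
have NpM (h : plane -> R) : mu.-integrable setT (EFin \o h) -> mean (fun x => `|h x|) <= 2 * S ->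
    (Np 1 h <= (2 * S)%:E)%E.
  move=> ih; rewrite -lee_fin Np1E /mean /Rintegral fineK //.
  by have := integrable_fin_num measurableT (integrable_abse ih).
apply: le_trans (normL_le_ReIm (lexx 1) mg) _.
have -> : 4 * S = 2 * S + 2 * S by lra.
by have [j1 j2] := cg N; rewrite EFinD; apply: leeD; exact: NpM.
Qed.

Definition layer_bound (a b : R) (l : nat) : R := 2 `^ (- (a * l%:R)) * (maxn l 1)%:R `^ b.

Lemma layer_bound_sum a b : 0 < a -> exists S : R, forall N, \sum_(0 <= l < N) layer_bound a b l <= S.
Proof.
move=> a0; have l2 : 0 < ln (2 : R) by rewrite ln_gt0 // ltr1n.
have [S [_ hS]] := @sum_poly_exp R `|b| (a * ln 2) (normr_ge0 _) (mulr_gt0 a0 l2).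
exists S => N; apply: le_trans (hS N); rewrite big_mkord; apply: ler_sum => l _.
rewrite /layer_bound [leLHS]mulrC pow2_exp; apply: ler_pM; rewrite ?powR_ge0 ?expR_ge0 //.
  have m1 : (1 : R) <= (maxn l 1)%:R by rewrite ler1n leq_max orbT.
  apply: (@le_trans _ _ ((maxn l 1)%:R `^ `|b|)); first by apply: ler_powR => //; exact: ler_norm.
  apply: ge0_ler_powR; rewrite ?nnegrE //.
  by rewrite ler_nat geq_max leqnSn.
by rewrite le_eqVlt; apply/orP; left; apply/eqP; congr expR; ring.
Qed.

Lemma W_remainder a b (f : func) : 0 < a -> W a b 1%E f ->
  (normL 1 (fun x => f x - partial_sum f N.+1 x)%R @[N --> \oo] --> 0%E)%E.
Proof.
move=> a0 [Lf hf]; have [S hS] := layer_bound_sum b a0.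
pose B := layer_bound a b.
have B0 l : 0 <= B l by rewrite mulr_ge0 ?powR_ge0.
have cv : cvgn (series B).
  apply: nondecreasing_is_cvgn.
    by apply/nondecreasing_seqP => n; rewrite /series /= big_nat_recr //= lerDl.
  by exists S => _ [N _ <-]; exact: hS.
pose T := limn (series B).
have hT N M : \sum_(N <= l < M) B l <= T - series B N.
  have [NM|MN] := leqP N M.
    rewrite lerBrDl /series /= -(big_cat_nat (n := N)) //=.
    apply: (nondecreasing_cvgn_le (u_ := series B)) => //.
    by apply/nondecreasing_seqP => n; rewrite /series /= big_nat_recr //= lerDl.
  rewrite big_geq 1?ltnW // subr_ge0; apply: (nondecreasing_cvgn_le (u_ := series B)) => //.
  by apply/nondecreasing_seqP => n; rewrite /series /= big_nat_recr //= lerDl.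
have cT : (4 * (T - series B N.+1))%:E @[N --> \oo] --> (0%:E : \bar R).
  apply: cvg_EFin; first exact: nearW.
  rewrite -[X in _ --> X](mulr0 4) -(subrr T); apply: cvgMr; apply: cvgB; first exact: cvg_cst.
  by have := cv; rewrite -(cvg_shiftS (series B)).
apply: (squeeze_cvge _ (cvg_cst 0%E) cT); apply: nearW => N; apply/andP; split.
  exact: Lnorm_ge0.
exact: remainder_bound Lf hf (hT N.+1).
Qed.

(** Synthesis starts at n = 1, so layer 0 is merged into the first block; its bound 1 is 2^a times
    2^(-a), hence the constant 1 + 2^a. *)
Lemma W_synthesizable a b : 0 < a -> W a b 1%E `<=` synthesizable (fun n =>
  cross_cball n ((1 + 2 `^ a) * (2 `^ (- (a * n%:R)) * (maxn n 1)%:R `^ b) : R)).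
Proof.
move=> a0 f Wf; have [Lf hf] := Wf; split => //.
have pa : 0 <= 2 `^ a :> R by exact: powR_ge0.
exists (fun n => if n == 1%N then (fun x => layer 0 f x + layer 1 f x) else layer n f); split.
  move=> n n1; have Q1 l : (l <= n)%N -> trig_poly (Q n) (layer l f).
    move=> ln; exact: trig_poly_subset (finite_Q n) (hyper_layer_sub ln) (trig_poly_layer l f).
  case: eqP => [n1'|_].
    split; first by apply: trig_polyD; [exact: finite_Q|exact: Q1|apply: Q1].
    apply: le_trans (@normLD _ 1 _ _ (lexx 1) (cnice_cmeas (cnice_layer 0 f)) (cnice_cmeas (cnice_layer 1 f))) _.
    apply: le_trans (leeD (hf 0%N) (hf 1%N)) _; rewrite -EFinD lee_fin n1'.
    rewrite (_ : maxn 0 1 = 1%N) // (_ : maxn 1 1 = 1%N) // powR1 !mulr1 mulr0 oppr0 powRr0.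
    rewrite mulrDl mul1r -powRD; last by rewrite (_ : (2 : R) != 0) ?implybT.
    by rewrite subrr powRr0 addrC.
  split; first exact: Q1.
  apply: le_trans (hf n) _; rewrite lee_fin -[leLHS]mul1r ler_wpM2r ?mulr_ge0 ?powR_ge0 //.
  by rewrite lerDl.
have cW := W_remainder a0 Wf.
suff E : {near \oo, (fun N => normL 1 (fun x => f x - partial_sum f N.+1 x)) =1
    (fun N => normL 1 (fun x => f x - \sum_(1 <= n < N.+1)
      (if n == 1%N then (fun x => layer 0 f x + layer 1 f x) else layer n f) x))}.
  by apply: cvg_trans cW; apply: near_eq_cvg; apply: filterS E => N ->.
exists 1%N => // N /= N1; congr normL; apply/funext => x; congr (_ - _).
rewrite /partial_sum -(big_mkord xpredT (fun l => layer l f x)) big_ltn // big_ltn //.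
rewrite [in RHS]big_ltn //= addrA; congr (_ + _).
by rewrite !big_nat; apply: eq_bigr => n /andP[n2 _]; rewrite gtn_eqF.
Qed.

Lemma Wbar_synthesizable a b : Wbar a b 1%E `<=` synthesizable (fun n =>
  cross_cball n (1 * (2 `^ (- (a * n%:R)) * (maxn n 1)%:R `^ b) : R)).
Proof.
move=> f [Lf [t [ht ct]]]; split => //; exists t; split => // n n1.
have [h1 h2] := ht n n1; split => //.
by rewrite mul1r (_ : maxn n 1 = n) //; apply/maxn_idPl.
Qed.

(** A polynomial on one layer has a single nonzero layer, so the class contains the whole L_1 ball
    there; [entropy_lower] asks for no more. *)
Lemma ball_sub_W a b n (t : func) : trig_poly (hyper_layer n) t -> (1 <= n)%N ->
  (normL 1 t <= (2 `^ (- (a * n%:R)) * n%:R `^ b)%:E)%E -> W a b 1%E t.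
Proof.
move=> tt n1 tn; split; first exact: trig_poly_L (lexx 1) (finite_hyper_layer n) tt.
move=> l; rewrite (layer_trig_poly l tt); case: eqP => [->|_].
  by rewrite (_ : maxn n 1 = n) //; apply/maxn_idPl.
by rewrite (@normL0 R 1 (lexx 1)) lee_fin mulr_ge0 ?powR_ge0.
Qed.

Lemma ball_sub_Wbar a b n (t : func) : trig_poly (hyper_layer n) t -> (1 <= n)%N ->
  (normL 1 t <= (2 `^ (- (a * n%:R)) * n%:R `^ b)%:E)%E -> Wbar a b 1%E t.
Proof.
move=> tt n1 tn; split; first exact: trig_poly_L (lexx 1) (finite_hyper_layer n) tt.
exists (fun m => if m == n then t else fun=> 0); split.
  move=> m m1; case: eqP => [->|_].
    by split => //; exact: trig_poly_subset (finite_Q n) (hyper_layer_sub (leqnn n)) tt.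
  by split; [exact: trig_poly0|rewrite (@normL0 R 1 (lexx 1)) lee_fin mulr_ge0 ?powR_ge0].
apply: cvg_near_cst; exists n => // N /= nN.
rewrite (_ : (fun x : plane => _) = fun=> 0) ?(@normL0 R 1 (lexx 1)) //.
apply/funext => x; rewrite (bigD1_seq n) /= ?mem_index_iota ?iota_uniq ?n1 ?ltnS //.
by rewrite eqxx big1 ?addr0 ?subrr // => m /negbTE ->.
Qed.

End PartialSums.

Lemma dominated_by_rate (R : realType) (a b c C : R) (A B : nat -> \bar R) : 0 < c -> 0 < C ->
  (forall k, (2 <= k)%N -> (A k <= (C * rate a b k)%:E)%E) ->
  (forall k, (2 <= k)%N -> ((c * rate a b k)%:E <= B k)%E) -> dominated A B.
Proof.
move=> c0 C0 hA hB; exists (C / c); split=> [|k k2]; first exact: divr_gt0.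
apply: le_trans (hA k k2) _; rewrite (_ : C * _ = C / c * (c * rate a b k)).
  by rewrite EFinM lee_pmul2l ?lte_fin ?divr_gt0 //; exact: hB.
by rewrite mulrA divfK // gt_eqF.
Qed.

Theorem theorem1p3 (R : realType) (p a b : R) :
  1 <= p -> 1 - p^-1 < a ->
  order_equiv (entropyL p%:E (W a b 1%E)) (entropyL p%:E (Wbar a b 1%E)) /\
  order_equiv (entropyL p%:E (Wbar a b 1%E))
    (fun k : nat => (k%:R `^ (- a) * ln k%:R `^ (a + b))%:E).
Proof.
move=> p1 pa.
have a0 : 0 < a.
  by apply: le_lt_trans pa; rewrite subr_ge0 invf_le1 ?(lt_le_trans ltr01 p1).
have cW0 : 0 < 1 + 2 `^ a by rewrite ltr_pwDl ?powR_ge0.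
have [C1 [C10 h1]] := entropy_upper b p1 pa cW0.
have [C2 [C20 h2]] := entropy_upper b p1 pa ltr01.
have [c [c0 h3]] := entropy_lower b p1 a0.
have uW k : (2 <= k)%N -> (entropyL p%:E (W a b 1%E) k <= (C1 * rate a b k)%:E)%E.
  by move=> k2; apply: h1 => //; exact: W_synthesizable.
have uB k : (2 <= k)%N -> (entropyL p%:E (Wbar a b 1%E) k <= (C2 * rate a b k)%:E)%E.
  by move=> k2; apply: h2 => //; exact: Wbar_synthesizable.
have lW k : (2 <= k)%N -> ((c * rate a b k)%:E <= entropyL p%:E (W a b 1%E) k)%E.
  by move=> k2; apply: h3 => // n t n1 tt; exact: ball_sub_W.
have lB k : (2 <= k)%N -> ((c * rate a b k)%:E <= entropyL p%:E (Wbar a b 1%E) k)%E.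
  by move=> k2; apply: h3 => // n t n1 tt; exact: ball_sub_Wbar.
have id k : (2 <= k)%N -> (1 * rate a b k)%:E = (rate a b k)%:E by rewrite mul1r.
split; split.
- exact: dominated_by_rate c0 C10 uW lB.
- exact: dominated_by_rate c0 C20 uB lW.
- by apply: (dominated_by_rate ltr01 C20 uB) => k k2; rewrite id.
- by apply: (dominated_by_rate c0 ltr01 _ lB) => k k2; rewrite id.
Qed.
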